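(* Let $1<p<\infty$, $-1<q\le s<\infty$, and let the function $a(x,t)>0$ be Lipschitz continuous in the time-space variables. Assume that $u$ is a viscosity subsolution in $Q_1$, and that $v$ is a viscosity supersolution in $Q_1$ which is locally uniformly Lipschitz continuous in the $x$-variable, of the equation $$\partial_t w=\big[|Dw|^q+a(x,t)|Dw|^s\big]\Delta_p^N w .$$ If $u\le v$ on $\partial_pQ_1$, then $$u\le v\quad\text{in } Q_1 .$$
   Context: Notation: $B_1\subset\mathbb{R}^n$ is the unit ball centered at the origin, $Q_1=B_1\times(-1,0]$, and $\partial_pQ_1=(\partial B_1\times[-1,0])\cup(B_1\times\{-1\})$ is its parabolic boundary. $D$ and $D^2$ denote the gradient and Hessian in the spatial variable $x$. The normalized $p$-Laplacian is $$\Delta_p^N w=\Delta w+(p-2)\Big\langle D^2w\frac{Dw}{|Dw|},\frac{Dw}{|Dw|}\Big\rangle .$$ Viscosity supersolution: a finite almost everywhere, lower semicontinuous function $v:Q_1\to\mathbb{R}\cup\{+\infty\}$ is a viscosity supersolution in $Q_1$ if, whenever $(x_0,t_0)\in Q_1$ and $\varphi\in C^2(Q_1)$ are such that $v-\varphi$ attains a local minimum at $(x_0,t_0)$ and $D\varphi(x,t)\ne0$ for $x\neq x_0$, one has $$\limsup_{(x,t)\to(x_0,t_0),\,x\ne x_0}\Big(\partial_t\varphi(x,t)-\big[|D\varphi(x,t)|^q+a(x,t)|D\varphi(x,t)|^s\big]\Delta_p^N\varphi(x,t)\Big)\ge0 .$$ Viscosity subsolution: a finite almost everywhere, upper semicontinuous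 function $u:Q_1\to\mathbb{R}\cup\{-\infty\}$ is a viscosity subsolution in $Q_1$ if, whenever $(x_0,t_0)\in Q_1$ and $\varphi\in C^2(Q_1)$ are such that $u-\varphi$ attains a local maximum at $(x_0,t_0)$ and $D\varphi(x,t)\neq0$ for $x\ne x_0$, one has $$\liminf_{(x,t)\to(x_0,t_0),\,x\ne x_0}\Big(\partial_t\varphi(x,t)-\big[|D\varphi(x,t)|^q+a(x,t)|D\varphi(x,t)|^s\big]\Delta_p^N\varphi(x,t)\Big)\le0 .$$ ''Locally uniformly Lipschitz continuous in the $x$-variable'' means: for every compact $K\subset Q_1$ there is a constant $C_K$ with $|v(x,t)-v(y,t)|\le C_K|x-y|$ for all $(x,t),(y,t)\in K$.
   Formalization: Since u and v are only given on Q_1, their values on ∂_pQ_1 are made meaningful: u is assumed upper semicontinuous and < +∞, and v lower semicontinuous and > −∞, on all of Q_1 ∪ ∂_pQ_1. *)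

(* Defs.v *)
From mathcomp Require Import all_boot all_order all_algebra.
From mathcomp Require Import all_classical all_reals all_analysis.

Set Implicit Arguments.
Unset Strict Implicit.
Unset Printing Implicit Defensive.

Import Order.TTheory GRing.Theory Num.Theory.
Import numFieldNormedType.Exports.
Local Open Scope classical_set_scope.
Local Open Scope ring_scope.

Section Defs.
Context {R : realType} {n : nat}.

(* A space-time point is z = (x, t), with z.1 = x and z.2 = t. *)
Local Notation pt := ('rV[R]_n * R)%type.

Definition inner (x y : 'rV[R]_n) : R := \sum_(i < n) x 0 i * y 0 i.

(* The library norm `|x| of 'rV[R]_n is the sup norm; it induces the same
   topology but not the same balls. *)
Definition enorm (x : 'rV[R]_n) : R := Num.sqrt (inner x x).

Definition Q1 : set pt := [set z | enorm z.1 < 1 /\ -1 < z.2 <= 0].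

Definition parabolic_boundary : set pt :=
  [set z | enorm z.1 = 1 /\ -1 <= z.2 <= 0] `|`
  [set z | enorm z.1 < 1 /\ z.2 = -1].

Definition dir_x (i : 'I_n) : pt := (delta_mx 0 i, 0).
Definition dir_t : pt := (0, 1).

Definition dt (w : pt -> R) (z : pt) : R := 'D_dir_t w z.
Definition grad (w : pt -> R) (z : pt) : 'rV[R]_n := \row_i 'D_(dir_x i) w z.
Definition hess (w : pt -> R) (z : pt) : 'M[R]_n :=
  \matrix_(i, j) 'D_(dir_x i) ('D_(dir_x j) w) z.
Definition laplacian (w : pt -> R) (z : pt) : R := \tr (hess w z).

(* Only meaningful where grad w z != 0, as is the case wherever it is used. *)
Definition normalized_p_laplacian (p : R) (w : pt -> R) (z : pt) : R :=
  let nu := (enorm (grad w z))^-1 *: grad w z in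
  laplacian w z + (p - 2) * inner (hess w z *m nu^T)^T nu.

Definition residual (p q s : R) (a : pt -> R) (w : pt -> R) (z : pt) : R :=
  dt w z - (enorm (grad w z) `^ q + a z * enorm (grad w z) `^ s)
           * normalized_p_laplacian p w z.

Fixpoint class_C (k : nat) (U : set pt) (f : pt -> R) : Prop :=
  (forall z, U z -> {for z, continuous f}) /\
  if k is k'.+1 then
    forall v : pt, (forall z, U z -> derivable f z v) /\ class_C k' U ('D_v f)
  else True.

(* Q1 is not open (it contains its top t = 0): C^2(Q1) means C^2 on some open
   neighbourhood of Q1. *)
Definition C2_Q1 (phi : pt -> R) : Prop :=
  exists U : set pt, [/\ open U, Q1 `<=` U & class_C 2 U phi].

Definition test_function (x0 : 'rV[R]_n) (phi : pt -> R) : Prop :=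
  C2_Q1 phi /\ forall z, Q1 z -> z.1 != x0 -> grad phi z != 0.

(* (x, t) -> z0 inside Q1 with x != x0; near a point of t = 0 the points range
   over past times only. *)
Definition approach (z0 : pt) : set_system pt :=
  within [set z | Q1 z /\ z.1 != z0.1] (nbhs z0).

Definition lsc_on (A : set pt) (f : pt -> \bar R) : Prop :=
  lower_semicontinuous (f : subspace A -> \bar R).
Definition usc_on (A : set pt) (f : pt -> \bar R) : Prop :=
  lsc_on A (fun z => - f z)%E.

(* Lebesgue-null subsets of R^n x R, by countable coverings by boxes. *)
Definition box (b c : pt) : set pt :=
  [set z : pt | (forall i, b.1 0 i <= z.1 0 i <= c.1 0 i) /\ b.2 <= z.2 <= c.2].
Definition box_volume (b c : pt) : R :=
  (\prod_(i < n) (c.1 0 i - b.1 0 i)) * (c.2 - b.2).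
Definition lebesgue_null (A : set pt) : Prop :=
  forall e : R, 0 < e -> exists b c : nat -> pt,
    [/\ forall k, (forall i, (b k).1 0 i <= (c k).1 0 i) /\ (b k).2 <= (c k).2,
        A `<=` \bigcup_k box (b k) (c k)
      & (\sum_(0 <= k <oo) (box_volume (b k) (c k))%:E <= e%:E)%E].

Definition finite_ae_Q1 (f : pt -> \bar R) : Prop :=
  lebesgue_null [set z | Q1 z /\ f z \isn't a fin_num].

Definition viscosity_supersolution (p q s : R) (a : pt -> R)
    (v : pt -> \bar R) : Prop :=
  [/\ forall z, Q1 z -> (-oo < v z)%E,
      finite_ae_Q1 v,
      lsc_on Q1 v
    & forall (z0 : pt) (phi : pt -> R), Q1 z0 -> test_function z0.1 phi ->
        (\forall z \near within Q1 (nbhs z0),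
           (v z0 - (phi z0)%:E <= v z - (phi z)%:E)%E) ->
        (0 <= limf_esup (fun z => (residual p q s a phi z)%:E) (approach z0))%E].

Definition viscosity_subsolution (p q s : R) (a : pt -> R)
    (u : pt -> \bar R) : Prop :=
  [/\ forall z, Q1 z -> (u z < +oo)%E,
      finite_ae_Q1 u,
      usc_on Q1 u
    & forall (z0 : pt) (phi : pt -> R), Q1 z0 -> test_function z0.1 phi ->
        (\forall z \near within Q1 (nbhs z0),
           (u z - (phi z)%:E <= u z0 - (phi z0)%:E)%E) ->
        (limf_einf (fun z => (residual p q s a phi z)%:E) (approach z0) <= 0)%E].

(* Since |+oo - +oo| = +oo, the case x = y makes v finite on K. *)
Definition locally_lipschitz_x (v : pt -> \bar R) : Prop :=
  forall K : set pt, compact K -> K `<=` Q1 ->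
    exists C : R, forall (x y : 'rV[R]_n) (t : R), K (x, t) -> K (y, t) ->
      (`|v (x, t) - v (y, t)| <= (C * enorm (x - y))%:E)%E.

End Defs.

Arguments Q1 : clear implicits.
Arguments parabolic_boundary : clear implicits.

(* Main.v *)
(** The operator is odd, so [g := - v] is a subsolution as well, and it suffices to show
    that two subsolutions with [u + g <= 0] on the parabolic boundary satisfy [u + g <= 0].
    Replace [u] by [u - gam (t + 1)], take sup-convolutions [f] and [h] of [u] and [g] in
    space-time with parameter [e], and maximize [f z1 + h z2 - phi (z1 - z2)] for
    [phi (x, t) = j |x|^(2b) / (2b) + t^2 / (2e)] with [b] large. Let [d] be the spatial part
    of [z1 - z2] and [xi = j |d|^(2b - 2) d] the common spatial gradient.

    If [d = 0], the contact is so flat in space that the diffusion term disappears, and the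
    two inequalities between time slopes add up to [gam <= 0].

    If [d <> 0], then [xi <> 0] and the coefficients can be frozen near [xi]. The frozen
    equations are linear, and for those the theorem on sums follows without Aleksandrov's
    theorem, by comparing [f] and [h] with resolvents of finite-difference Laplacians.
    It gives [gam <= N (sqrt k1 - sqrt k2)^2 j |d|^(2b - 2)], where
    [ki = |xi|^q + a(zi) |xi|^s], so that
    [(sqrt k1 - sqrt k2)^2 <= (a(z1) - a(z2))^2 |xi|^(2s - q)]. The Lipschitz bound on [v]
    keeps [|xi|] bounded, and [|d|] is small for large [j], so the right-hand side tends to 0. *)

Require Import Defs.
From mathcomp Require Import all_boot all_order all_algebra.
From mathcomp Require Import all_classical all_reals all_analysis.
From mathcomp Require Import ring lra zify.

Set Implicit Arguments.
Unset Strict Implicit.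
Unset Printing Implicit Defensive.

Import Order.TTheory GRing.Theory Num.Theory.
Import numFieldNormedType.Exports.
Local Open Scope classical_set_scope.
Local Open Scope ring_scope.

(** * Euclidean geometry *)

(** The split according to [d] is forced by the operator: for [q < 0] it blows up as the gradient
    tends to 0, so its coefficients can be frozen only near some [xi <> 0], and at [d = 0] the test
    function itself has to switch the diffusion off. Along [C |x|^(2b)] the diffusion has order
    [|x|^((2b - 1)(q + 1) - 1)], which tends to 0 when [(2b - 1)(q + 1) > 1]; this is what [b] large
    means.

    Freezing works because sup-convolutions are semiconvex: a Hessian touching one of them from
    above is at least [- I / e], so an error in the coefficients costs at most a small multiple of
    its trace, up to a small constant. The same small multiple of the Laplacian is added to both
    frozen equations to pay for it, and these two copies cancel in the sum rule.

    The top [t = 0] belongs to [Q1], and the definition of a solution tests there with past times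
    only, so a maximum at [t = 0] is an interior one. As [u] may be [-oo], each function is carried
    as a real function together with the set where it is finite. *)

Section Euclid.
Context {R : realType} {n : nat}.
Implicit Types (x y z : 'rV[R]_n) (a : R).

Lemma innerC x y : inner x y = inner y x.
Proof. by apply: eq_bigr => i _; rewrite mulrC. Qed.

Lemma innerDl x y z : inner (x + y) z = inner x z + inner y z.
Proof. by rewrite -big_split; apply: eq_bigr => i _; rewrite mxE mulrDl. Qed.

Lemma innerZl a x y : inner (a *: x) y = a * inner x y.
Proof. by rewrite [RHS]big_distrr; apply: eq_bigr => i _ /=; rewrite mxE mulrA. Qed.

Lemma innerNl x y : inner (- x) y = - inner x y.
Proof. by rewrite -scaleN1r innerZl mulN1r. Qed.

Lemma innerBl x y z : inner (x - y) z = inner x z - inner y z.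
Proof. by rewrite innerDl innerNl. Qed.

Lemma inner0l y : inner 0 y = 0.
Proof. by rewrite -(scale0r y) innerZl mul0r. Qed.

Lemma innerDr x y z : inner z (x + y) = inner z x + inner z y.
Proof. by rewrite innerC innerDl !(innerC z). Qed.

Lemma innerZr a x y : inner y (a *: x) = a * inner y x.
Proof. by rewrite innerC innerZl innerC. Qed.

Lemma innerNr x y : inner y (- x) = - inner y x.
Proof. by rewrite innerC innerNl innerC. Qed.

Lemma innerBr x y z : inner z (x - y) = inner z x - inner z y.
Proof. by rewrite innerDr innerNr. Qed.

Lemma inner0r y : inner y 0 = 0.
Proof. by rewrite innerC inner0l. Qed.

Lemma inner_suml (I : Type) (s : seq I) (F : I -> 'rV[R]_n) y :
  inner (\sum_(i <- s) F i) y = \sum_(i <- s) inner (F i) y.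
Proof.
elim: s => [|i s IH]; first by rewrite !big_nil inner0l.
by rewrite !big_cons innerDl IH.
Qed.

Lemma inner_ge0 x : 0 <= inner x x.
Proof. by apply: sumr_ge0 => i _; rewrite -expr2 sqr_ge0. Qed.

Lemma inner_eq0 x : (inner x x == 0) = (x == 0).
Proof.
apply/idP/eqP => [|->]; last by rewrite inner0l.
rewrite psumr_eq0; last by move=> i _; rewrite -expr2 sqr_ge0.
move=> /allP x0; apply/rowP => i; rewrite mxE.
by have /= := x0 i (mem_index_enum _); rewrite mulf_eq0 orbb => /eqP.
Qed.

Lemma enorm_ge0 x : 0 <= enorm x.
Proof. exact: sqrtr_ge0. Qed.

Lemma enorm_sq x : enorm x ^+ 2 = inner x x.
Proof. by rewrite sqr_sqrtr ?inner_ge0. Qed.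

Lemma enorm0 : enorm (0 : 'rV[R]_n) = 0.
Proof. by rewrite /enorm inner0l sqrtr0. Qed.

Lemma enorm_eq0 x : (enorm x == 0) = (x == 0).
Proof. by rewrite -inner_eq0 -enorm_sq expf_eq0. Qed.

Lemma enorm_gt0 x : (0 < enorm x) = (x != 0).
Proof. by rewrite lt_def enorm_ge0 andbT enorm_eq0. Qed.

Lemma enormZ a x : enorm (a *: x) = `|a| * enorm x.
Proof.
by rewrite /enorm innerZl innerZr mulrA -expr2 sqrtrM ?sqr_ge0// sqrtr_sqr.
Qed.

Lemma enormN x : enorm (- x) = enorm x.
Proof. by rewrite -scaleN1r enormZ normrN1 mul1r. Qed.

Lemma enormB x y : enorm (x - y) = enorm (y - x).
Proof. by rewrite -enormN opprB. Qed.

Lemma inner_le_enorm x y : inner x y <= enorm x * enorm y.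
Proof.
have [->|x0] := eqVneq x 0; first by rewrite inner0l enorm0 mul0r.
have [->|y0] := eqVneq y 0; first by rewrite inner0r enorm0 mulr0.
have := inner_ge0 (enorm y *: x - enorm x *: y).
rewrite !(innerBl, innerBr, innerZl, innerZr) -!enorm_sq (innerC y x).
have : 0 < enorm x * enorm y by rewrite mulr_gt0 ?enorm_gt0.
by move: (enorm x) (enorm y) (inner x y) => a b c ab h; nra.
Qed.

Lemma norm_inner_le x y : `|inner x y| <= enorm x * enorm y.
Proof.
by rewrite ler_norml inner_le_enorm andbT lerNl -innerNl -(enormN x) inner_le_enorm.
Qed.

Lemma ler_enormD x y : enorm (x + y) <= enorm x + enorm y.
Proof.
rewrite -(@ler_pXn2r _ 2) ?nnegrE ?addr_ge0 ?enorm_ge0//.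
rewrite enorm_sq innerDl !innerDr sqrrD -!enorm_sq (innerC y x).
by have := inner_le_enorm x y; lra.
Qed.

Lemma ler_enormB x y : enorm (x - y) <= enorm x + enorm y.
Proof. by rewrite -(enormN y) ler_enormD. Qed.

Lemma ler_enorm_dist x y z : enorm (x - z) <= enorm (x - y) + enorm (y - z).
Proof. by rewrite -[x - z](subrKA y) ler_enormD. Qed.

Lemma enorm_sqD x y : enorm (x + y) ^+ 2 = enorm x ^+ 2 + 2 * inner x y + enorm y ^+ 2.
Proof. by rewrite !enorm_sq innerDl !innerDr (innerC y x); ring. Qed.

Lemma enorm_sqB x y : enorm (x - y) ^+ 2 = enorm x ^+ 2 - 2 * inner x y + enorm y ^+ 2.
Proof. by rewrite enorm_sqD innerNr enormN; ring. Qed.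

Lemma norm_coord_le x i : `|x 0 i| <= enorm x.
Proof.
rewrite -(@ler_pXn2r _ 2) ?nnegrE ?enorm_ge0// real_normK ?num_real//.
rewrite enorm_sq /inner (bigD1 i)//= -expr2 lerDl.
by apply: sumr_ge0 => j _; rewrite -expr2 sqr_ge0.
Qed.

Lemma ler_norm_enorm x : `|x| <= enorm x.
Proof.
rewrite /Num.norm/= mx_normrE; apply: bigmax_le; first exact: enorm_ge0.
by case=> i j _ /=; rewrite ord1 norm_coord_le.
Qed.

Lemma enorm_le_norm x : enorm x <= n%:R * `|x|.
Proof.
rewrite -(@ler_pXn2r _ 2) ?nnegrE ?mulr_ge0 ?enorm_ge0// enorm_sq.
apply: (@le_trans _ _ (\sum_(i < n) `|x| ^+ 2)).
  apply: ler_sum => i _; rewrite -expr2 -[leLHS]real_normK ?num_real//.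
  rewrite ler_pXn2r ?nnegrE//.
  rewrite [leRHS]/Num.norm/= mx_normrE.
  by apply: (@le_bigmax _ _ _ _ (fun i => `|x i.1 i.2|) (0, i)).
rewrite sumr_const card_ord exprMn -[leLHS]mulr_natl ler_wpM2r ?sqr_ge0//.
by rewrite -natrX ler_nat; case: (n) => // k; rewrite leq_pmulr.
Qed.

Lemma nbhs_enormP x (P : set 'rV[R]_n) :
  nbhs x P <-> exists2 r, 0 < r & forall y, enorm (y - x) < r -> P y.
Proof.
split=> [/nbhs_ballP[r /= r0 rP]|[r r0 rP]].
  exists r => // y yr; apply: rP; rewrite -ball_normE /= distrC.
  exact: le_lt_trans (ler_norm_enorm _) yr.
apply/nbhs_ballP; exists (r / n.+1%:R); first by rewrite /= divr_gt0.
move=> y; rewrite -ball_normE /= distrC ltr_pdivlMr// => yr; apply: rP.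
apply: le_lt_trans (enorm_le_norm _) _; apply: le_lt_trans yr.
by rewrite mulrC ler_wpM2l// ler_nat.
Qed.

Lemma compact_eball x r : compact [set y | enorm (y - x) <= r].
Proof.
apply: bounded_closed_compact.
  exists (`|x| + r); split; first exact: num_real.
  move=> M hM y /= yr; apply: le_trans (ltW hM).
  rewrite -[y](subrK x) addrC (le_trans (ler_normD _ _))// lerD2l.
  exact: le_trans (ler_norm_enorm _) yr.
move=> y yc /=; apply/ler_addgt0Pr => e e0.
have /yc[z /= [zr zy]] : nbhs y [set z | enorm (z - y) < e].
  by apply/nbhs_enormP; exists e.
apply: le_trans (ler_enorm_dist y z x) _.
by rewrite addrC lerD// enormB ltW.
Qed.

End Euclid.

(** * Approximation by smooth functions *)

Lemma lerXn {R : realType} (k : nat) (x y : R) : 0 <= x -> x <= y -> x ^+ k <= y ^+ k.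
Proof. by move=> x0 xy; rewrite lerXn2r ?nnegrE// (le_trans x0). Qed.

Lemma mvt0_bound {R : realType} (F F' : R -> R) (a B : R) :
  (forall x, is_derive x (1 : R) F (F' x)) ->
  (forall x, `|x| <= `|a| -> `|F' x| <= B) -> `|F a - F 0| <= B * `|a|.
Proof.
move=> dF bF.
have cF x y : {within `[x, y], continuous F}.
  apply: continuous_subspaceT => z; apply: differentiable_continuous.
  by apply/derivable1_diffP; exact: (@ex_derive _ _ _ _ _ _ _ (dF z)).
have [a0|a0] := leP 0 a.
- have [c cab ->] := MVT_segment a0 (fun x _ => dF x) (cF 0 a).
  rewrite subr0 normrM ler_wpM2r// bF//.
  by move: cab; rewrite in_itv /= => /andP[c0 ca]; rewrite !ger0_norm.
- have [c cab] := MVT_segment (ltW a0) (fun x _ => dF x) (cF a 0).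
  rewrite distrC => ->; rewrite sub0r normrM normrN ler_wpM2r// bF//.
  by move: cab; rewrite in_itv /= => /andP[ac c0]; rewrite (ler0_norm c0) (ltr0_norm a0) lerN2.
Qed.

(** Three applications of [mvt0_bound], each gaining a factor [|a|]; the constant is not sharp. *)
Lemma expR_taylor2 {R : realType} (a L : R) : `|a| <= L ->
  `|expR a - (1 + a + a ^+ 2 / 2)| <= expR L * `|a| ^+ 3.
Proof.
move=> aL.
have e1 x : `|x| <= `|a| -> `|expR x| <= expR L.
  move=> xa; rewrite ger0_norm ?expR_ge0// ler_expR.
  by rewrite (le_trans (ler_norm _))// (le_trans xa).
have e2 x : `|x| <= `|a| -> `|expR x - 1| <= expR L * `|a|.
  move=> xa; have := @mvt0_bound _ expR expR x (expR L) (fun z => is_derive_expR z).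
  rewrite expR0 => h; apply: le_trans (h _) _; last by rewrite ler_wpM2l ?expR_ge0.
  by move=> y yx; rewrite e1// (le_trans yx).
have e3 x : `|x| <= `|a| -> `|expR x - (1 + x)| <= expR L * `|a| ^+ 2.
  move=> xa; have := @mvt0_bound _ (fun z => expR z - (1 + z)) (fun z => expR z - 1) x (expR L * `|a|).
  rewrite expR0 addr0 subrr subr0 => h; apply: le_trans (h _ _) _.
  - by move=> z; apply: is_derive_eq; rewrite add0r.
  - by move=> y yx; rewrite e2// (le_trans yx).
  - by rewrite -mulrA ler_wpM2l ?expR_ge0// expr2 ler_wpM2l.
have := @mvt0_bound _ (fun z => expR z - (1 + z + z ^+ 2 / 2)) (fun z => expR z - (1 + z)) a (expR L * `|a| ^+ 2).
rewrite expR0 addr0 expr0n mul0r addr0 subrr subr0 => h.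
apply: le_trans (h _ _) _.
- move=> z; apply: is_derive_eq; rewrite /GRing.scale/= add0r ?mulr1 ?expr1 ?mulr0.
  by congr (_ - (_ + _)); lra.
- exact: e3.
- by rewrite -mulrA -exprSr.
Qed.

(** Only the symmetric part of [H] enters; symmetry is not built in, so that outer products can be
    used directly. *)
Definition qf {R : realType} {n : nat} (H : 'M[R]_n) (y : 'rV[R]_n) : R :=
  inner (y *m H) y.

Section QuadraticForm.
Context {R : realType} {n : nat}.
Implicit Types (x y u v : 'rV[R]_n) (a : R) (H K : 'M[R]_n).

Lemma qfE H y : qf H y = \sum_(i < n) \sum_(j < n) H i j * y 0 i * y 0 j.
Proof.
rewrite /qf /inner exchange_big; apply: eq_bigr => j _ /=.
by rewrite mxE big_distrl; apply: eq_bigr => i _ /=; rewrite (mulrC (y 0 i)).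
Qed.

Lemma qfZ H a y : qf H (a *: y) = a ^+ 2 * qf H y.
Proof. by rewrite /qf -scalemxAl innerZl innerZr mulrA. Qed.

Lemma qfN H y : qf H (- y) = qf H y.
Proof. by rewrite -scaleN1r qfZ sqrrN expr1n mul1r. Qed.

Lemma qf0r H : qf H 0 = 0.
Proof. by rewrite /qf inner0r. Qed.

Lemma qf_parallelogram H x y : qf H (x + y) + qf H (x - y) = 2 * (qf H x + qf H y).
Proof. by rewrite /qf !mulmxDl mulNmx !(innerDl, innerDr, innerNl, innerNr); ring. Qed.

Lemma qfDm H K y : qf (H + K) y = qf H y + qf K y.
Proof. by rewrite /qf mulmxDr innerDl. Qed.

Lemma qfZm a H y : qf (a *: H) y = a * qf H y.
Proof. by rewrite /qf -scalemxAr innerZl. Qed.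

Lemma qfNm H y : qf (- H) y = - qf H y.
Proof. by rewrite -scaleN1r qfZm mulN1r. Qed.

Lemma qfBm H K y : qf (H - K) y = qf H y - qf K y.
Proof. by rewrite qfDm qfNm. Qed.

Lemma qf0m y : qf 0 y = 0.
Proof. by rewrite /qf mulmx0 inner0l. Qed.

Lemma qf1m y : qf 1%:M y = inner y y.
Proof. by rewrite /qf mulmx1. Qed.

Lemma qf_summ (T : Type) (s : seq T) (F : T -> 'M[R]_n) y :
  qf (\sum_(i <- s) F i) y = \sum_(i <- s) qf (F i) y.
Proof.
elim: s => [|i s IH]; first by rewrite !big_nil qf0m.
by rewrite !big_cons qfDm IH.
Qed.

Lemma inner_mulmx u y : y *m u^T = (inner y u)%:M.
Proof.
apply/matrixP => i j; rewrite !ord1 !mxE /=.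
by rewrite /inner; apply: eq_bigr => k _; rewrite !mxE.
Qed.

Lemma qf_outer u v y : qf (u^T *m v) y = inner u y * inner v y.
Proof. by rewrite /qf mulmxA inner_mulmx mul_scalar_mx innerZl (innerC y). Qed.

Lemma qf_bound H : exists2 C : R, 0 <= C & forall y, `|qf H y| <= C * enorm y ^+ 2.
Proof.
exists (\sum_(i < n) \sum_(j < n) `|H i j|).
  by apply: sumr_ge0 => i _; apply: sumr_ge0 => j _.
move=> y; rewrite qfE mulr_suml (le_trans (ler_norm_sum _ _ _))//.
apply: ler_sum => i _; rewrite mulr_suml (le_trans (ler_norm_sum _ _ _))//.
apply: ler_sum => j _; rewrite -mulrA normrM ler_wpM2l// normrM expr2.
by rewrite ler_pM// norm_coord_le.
Qed.

End QuadraticForm.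

(** Stands for third derivatives bounded by a constant uniform on the whole space. The class is
    closed under sums, multiples and translations without any differentiation, which is all that the
    resolvent iteration asks for. *)
Definition cubic_taylor {R : realType} {n : nat} (C : R) (w : 'rV[R]_n -> R) :=
  forall x, exists G H, forall y, enorm y <= 1 ->
    `|w (x + y) - (w x + inner G y + qf H y / 2)| <= C * enorm y ^+ 3.

Section CubicTaylor.
Context {R : realType} {n : nat}.
Implicit Types (w : 'rV[R]_n -> R) (C a : R).

Lemma cubic_taylor_cst C a : 0 <= C -> cubic_taylor C (fun _ : 'rV[R]_n => a).
Proof.
move=> C0 x; exists 0, 0 => y _; rewrite inner0l qf0m mul0r !addr0 subrr normr0.
by rewrite mulr_ge0// exprn_ge0 ?enorm_ge0.
Qed.

Lemma cubic_taylorD C1 C2 w1 w2 : cubic_taylor C1 w1 -> cubic_taylor C2 w2 ->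
  cubic_taylor (C1 + C2) (fun x => w1 x + w2 x).
Proof.
move=> h1 h2 x; have [G1 [H1 {}h1]] := h1 x; have [G2 [H2 {}h2]] := h2 x.
exists (G1 + G2), (H1 + H2) => y y1; rewrite innerDl qfDm [leRHS]mulrDl.
apply: le_trans (lerD (h1 y y1) (h2 y y1)); apply: le_trans (ler_normD _ _).
by rewrite le_eqVlt; apply/orP; left; apply/eqP; congr `|_|; ring.
Qed.

Lemma cubic_taylorZ C a w : cubic_taylor C w ->
  cubic_taylor (`|a| * C) (fun x => a * w x).
Proof.
move=> h x; have [G [H {}h]] := h x.
exists (a *: G), (a *: H) => y y1; rewrite innerZl qfZm -!mulrA -!mulrDr -mulrBr.
by rewrite normrM ler_wpM2l// h.
Qed.

Lemma cubic_taylor_shift C w v : cubic_taylor C w -> cubic_taylor C (fun x => w (x + v)).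
Proof.
move=> h x; have [G [H {}h]] := h (x + v); exists G, H => y y1.
by rewrite addrAC h.
Qed.

Lemma cubic_taylor_sum (I : Type) (s : seq I) (C : I -> R) (w : I -> 'rV[R]_n -> R) :
  (forall i, cubic_taylor (C i) (w i)) ->
  cubic_taylor (\sum_(i <- s) C i) (fun x => \sum_(i <- s) w i x).
Proof.
move=> h; elim: s => [|i s IH].
  rewrite big_nil => x; have [G [H {}h]] := cubic_taylor_cst 0 (lexx 0) x.
  by exists G, H => y y1; rewrite !big_nil h.
rewrite big_cons; have := cubic_taylorD (h i) IH => {}h x.
by have [G [H {}h]] := h x; exists G, H => y y1; rewrite !big_cons h.
Qed.

End CubicTaylor.

Lemma big_seq_wavg_le {R : realType} {T : eqType} (s : seq T) (sg g : T -> R) (B : R) :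
  (forall p, 0 <= sg p) -> \sum_(p <- s) sg p = 1 -> (forall p, p \in s -> `|g p| <= B) ->
  `|\sum_(p <- s) sg p * g p| <= B.
Proof.
move=> sg0 sg1 gB; apply: le_trans (ler_norm_sum _ _ _) _.
rewrite -[B]mul1r -sg1 mulr_suml big_seq [leRHS]big_seq.
by apply: ler_sum => p ps; rewrite normrM ger0_norm// ler_wpM2l// gB.
Qed.

(* Second-order expansion of the quotient [(1 + d1 + d2) q = f0 + f1 + f2], where
   [q] is the quotient of two averages of exponentials. *)
Lemma exp_avg_taylor {R : realType} {T : eqType} (s : seq T) (sg f a : T -> R) (M L r : R) :
  (forall p, 0 <= sg p) -> \sum_(p <- s) sg p = 1 ->
  0 <= M -> (forall p, p \in s -> `|f p| <= M) ->
  0 <= r -> r <= L -> (forall p, p \in s -> `|a p| <= r) ->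
  let E g := \sum_(p <- s) sg p * g p in
  let f0 := E f in let f1 := E (fun p => f p * a p) in
  let f2 := E (fun p => f p * a p ^+ 2) / 2 in
  let d1 := E a in let d2 := E (fun p => a p ^+ 2) / 2 in
  (`| E (fun p => f p * expR (a p)) / E (fun p => expR (a p)) -
     (f0 + (f1 - f0 * d1) + (f2 - f1 * d1 - f0 * d2 + f0 * d1 ^+ 2))| <=
  expR L * (M * (expR L * (2 + 2 * L + 3 * L ^+ 2) + 4 + 2 * L)) * r ^+ 3 : Prop).
Proof.
move=> sg0 sg1 M0 fM r0 rL ar E f0 f1 f2 d1 d2.
have avg := big_seq_wavg_le sg0 sg1.
set K := expR L; have K0 : 0 < K by exact: expR_gt0.
have L0 : 0 <= L by exact: le_trans rL.
have ar2 p : p \in s -> `|a p ^+ 2| <= r ^+ 2.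
  by move=> ps; rewrite normrX lerXn2r ?nnegrE// ar.
have ea p : p \in s -> `|expR (a p) - (1 + a p + a p ^+ 2 / 2)| <= K * r ^+ 3.
  move=> ps; apply: le_trans (expR_taylor2 (le_trans (ar _ ps) rL)) _.
  by apply: ler_wpM2l (ltW K0) _ _ _; rewrite lerXn2r ?nnegrE// ar.
have bf0 : `|f0| <= M by apply: avg.
have bf1 : `|f1| <= M * r by apply: avg => p ps; rewrite normrM ler_pM ?fM ?ar.
have bf2 : `|f2| <= M * r ^+ 2 / 2.
  rewrite normrM (ger0_norm (_ : 0 <= 2^-1)) ?invr_ge0// ler_wpM2r ?invr_ge0//.
  by apply: avg => p ps; rewrite normrM ler_pM ?fM ?ar2.
have bd1 : `|d1| <= r by apply: avg.
have bd2 : `|d2| <= r ^+ 2 / 2.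
  by rewrite normrM (ger0_norm (_ : 0 <= 2^-1)) ?invr_ge0// ler_wpM2r ?invr_ge0// avg.
set D := E (fun p => expR (a p)); set N := E (fun p => f p * expR (a p)).
have E1 : E (fun=> 1) = 1 by rewrite /E -[RHS]sg1; apply: eq_bigr => p _; rewrite mulr1.
have bD : `|D - (1 + d1 + d2)| <= K * r ^+ 3.
  rewrite (_ : D - _ = E (fun p => expR (a p) - (1 + a p + a p ^+ 2 / 2))) ?avg//.
  rewrite -[X in _ - (X + _ + _)]E1 /d2 /E mulr_suml -!big_split -sumrB; apply: eq_bigr => p _ /=; ring.
have bN : `|N - (f0 + f1 + f2)| <= M * (K * r ^+ 3).
  rewrite (_ : N - _ = E (fun p => f p * (expR (a p) - (1 + a p + a p ^+ 2 / 2)))).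
    by apply: avg => p ps; rewrite normrM ler_pM ?fM ?ea.
  rewrite /f2 /E mulr_suml -!big_split -sumrB; apply: eq_bigr => p _ /=; ring.
have Dge : K^-1 <= D.
  rewrite -[K^-1]mul1r -sg1 mulr_suml /D /E big_seq [leRHS]big_seq.
  apply: ler_sum => p ps; rewrite ler_wpM2l// -expRN ler_expR.
  by have := ar p ps; rewrite ler_norml => /andP[h _]; apply: le_trans h; rewrite lerN2.
have D0 : 0 < D by apply: lt_le_trans Dge; rewrite invr_gt0.
clearbody D N f0 f1 f2 d1 d2.
set q1 := f1 - f0 * d1; set q2 := f2 - f1 * d1 - f0 * d2 + f0 * d1 ^+ 2.
have bq1 : `|q1| <= 2 * M * r.
  rewrite (le_trans (ler_normB _ _))// normrM.
  by have := ler_pM (normr_ge0 _) (normr_ge0 _) bf0 bd1; lra.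
have bq2 : `|q2| <= 3 * M * r ^+ 2.
  rewrite (le_trans (ler_normD _ _))// normrM normrX.
  have h1 := ler_pM (normr_ge0 _) (exprn_ge0 2 (normr_ge0 _)) bf0 (lerXn2r 2 (normr_ge0 d1) r0 bd1).
  have h2 := ler_pM (normr_ge0 _) (normr_ge0 _) bf1 bd1.
  have h3 := ler_pM (normr_ge0 _) (normr_ge0 _) bf0 bd2.
  have : `|f2 - f1 * d1 - f0 * d2| <= M * r ^+ 2 / 2 + M * r * r + M * (r ^+ 2 / 2).
    rewrite (le_trans (ler_normB _ _))// (normrM f0); apply: lerD => //.
    by rewrite (le_trans (ler_normB _ _))// (normrM f1) lerD.
  by move: h1 h2 h3; lra.
(* [q1] and [q2] solve [(1 + d1 + d2)(f0 + q1 + q2) = f0 + f1 + f2] up to second order. What remains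
   is the error of the numerator, that of the denominator, and the cross terms of order at least
   three. *)
have -> : N / D - (f0 + q1 + q2) =
    D^-1 * ((N - (f0 + f1 + f2)) - (D - (1 + d1 + d2)) * (f0 + q1 + q2)
            - (d1 * q2 + d2 * q1 + d2 * q2)).
  by rewrite /q1 /q2; field; rewrite gt_eqF.
rewrite normrM -(mulrA K); apply: ler_pM => //.
  by rewrite gtr0_norm ?invr_gt0// -[K]invrK lef_pV2// posrE invr_gt0.
have bq : `|f0 + q1 + q2| <= M * (1 + 2 * L + 3 * L ^+ 2).
  have L2 : r ^+ 2 <= L ^+ 2 by rewrite lerXn2r ?nnegrE.
  have h1 : M * r <= M * L by rewrite ler_wpM2l.
  have h2 : M * r ^+ 2 <= M * L ^+ 2 by rewrite ler_wpM2l.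
  rewrite (le_trans (ler_normD _ _))// (le_trans (lerD (ler_normD _ _) (lexx _)))//.
  by move: bf0 bq1 bq2 h1 h2; lra.
have b3 : `|d1 * q2 + d2 * q1 + d2 * q2| <= M * (4 + 2 * L) * r ^+ 3.
  have h1 := ler_pM (normr_ge0 _) (normr_ge0 _) bd1 bq2.
  have h2 := ler_pM (normr_ge0 _) (normr_ge0 _) bd2 bq1.
  have h3 := ler_pM (normr_ge0 _) (normr_ge0 _) bd2 bq2.
  have h4 : M * r ^+ 3 * r <= M * r ^+ 3 * L by rewrite ler_wpM2l// mulr_ge0// exprn_ge0.
  rewrite (le_trans (ler_normD _ _))// (le_trans (lerD (ler_normD _ _) (lexx _)))// !normrM.
  have h5 : 0 <= M * r ^+ 3 * L by rewrite !mulr_ge0// exprn_ge0.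
  by move: h1 h2 h3 h4 h5; lra.
have b2 := ler_pM (normr_ge0 _) (normr_ge0 _) bD bq.
rewrite (le_trans (ler_normB _ _))// (le_trans (lerD (ler_normB _ _) (lexx _)))// normrM.
by move: bN b2 b3; lra.
Qed.

(* Convex combinations of values of [f] with Gaussian weights: bounded by the bound
   of [f], and with derivatives bounded on the whole space. *)
Definition gauss_wt {R : realType} {n : nat} (k : R) (s : seq 'rV[R]_n)
    (x p : 'rV[R]_n) : R :=
  expR (- k * enorm (x - p) ^+ 2) / \sum_(q <- s) expR (- k * enorm (x - q) ^+ 2).

Definition gauss_avg {R : realType} {n : nat} (k : R) (s : seq 'rV[R]_n)
    (f : 'rV[R]_n -> R) (x : 'rV[R]_n) : R :=
  \sum_(p <- s) gauss_wt k s x p * f p.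

Section GaussAvg.
Context {R : realType} {n : nat}.
Variables (k : R) (s : seq 'rV[R]_n) (f : 'rV[R]_n -> R).
Hypotheses (k0 : 0 <= k) (s0 : s != [::]).

Let wt (x p : 'rV[R]_n) := expR (- k * enorm (x - p) ^+ 2).
Let D (x : 'rV[R]_n) := \sum_(p <- s) wt x p.
Let sg := gauss_wt k s.

Lemma gauss_den_gt0 x : 0 < D x.
Proof.
move: s0; rewrite /D; case: s => // p t _; rewrite big_cons ltr_wpDr ?expR_gt0//.
by apply: sumr_ge0 => q _; rewrite expR_ge0.
Qed.
Let D0 := gauss_den_gt0.

Lemma gauss_wt_ge0 x p : 0 <= gauss_wt k s x p.
Proof. by rewrite divr_ge0 ?expR_ge0// ltW// D0. Qed.

Lemma gauss_wt_sum x : \sum_(p <- s) gauss_wt k s x p = 1.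
Proof. by rewrite /gauss_wt -mulr_suml divff// gt_eqF// (D0 x). Qed.

Lemma gauss_avg_bound (M : R) : (forall p, p \in s -> `|f p| <= M) ->
  forall x, `|gauss_avg k s f x| <= M.
Proof.
move=> fM x; apply: big_seq_wavg_le => //.
- by move=> p; exact: gauss_wt_ge0.
- exact: gauss_wt_sum.
Qed.

(** In [|x + y - p|^2] the terms without [p] cancel between numerator and denominator. A translation
    by [y] thus only tilts the weights at [x] by [expR (2 k <p, y>)], which is controlled uniformly
    in [x] because the centres [p] are bounded. *)
Lemma gauss_avg_shift (x y : 'rV[R]_n) : gauss_avg k s f (x + y) =
  (\sum_(p <- s) sg x p * (f p * expR (2 * k * inner p y))) /
  (\sum_(p <- s) sg x p * expR (2 * k * inner p y)).
Proof.
have wtE p : wt (x + y) p = expR (- (2 * k * inner x y) - k * enorm y ^+ 2) *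
    (wt x p * expR (2 * k * inner p y)).
  rewrite /wt -!expRD; congr expR.
  by rewrite (addrAC x) (enorm_sqD (x - p)) innerBl; ring.
have e0 := expR_gt0 (- (2 * k * inner x y) - k * enorm y ^+ 2).
rewrite (_ : gauss_avg k s f (x + y) = (\sum_(p <- s) wt (x + y) p * f p) / D (x + y)); last first.
  by rewrite /gauss_avg mulr_suml; apply: eq_bigr => p _; rewrite mulrAC.
rewrite /D (eq_bigr _ (fun p _ => congr1 (fun t => t * f p) (wtE p))).
rewrite [in X in _ / X = _](eq_bigr _ (fun p _ => wtE p)).
rewrite [X in X / _ = _](_ : _ = expR (- (2 * k * inner x y) - k * enorm y ^+ 2) *
   \sum_(p <- s) (wt x p * (f p * expR (2 * k * inner p y)))); last first.
  by rewrite mulr_sumr; apply: eq_bigr => p _; ring.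
rewrite -mulr_sumr -mulf_div divff ?gt_eqF// mul1r.
rewrite [X in _ = X / _](_ : _ = (D x)^-1 *
   \sum_(p <- s) (wt x p * (f p * expR (2 * k * inner p y)))); last first.
  by rewrite mulr_sumr; apply: eq_bigr => p _; rewrite /sg /gauss_wt -/(D x) -/(wt x p); ring.
rewrite [X in _ = _ / X](_ : _ = (D x)^-1 *
   \sum_(p <- s) (wt x p * expR (2 * k * inner p y))); last first.
  by rewrite mulr_sumr; apply: eq_bigr => p _; rewrite /sg /gauss_wt -/(D x) -/(wt x p); ring.
by rewrite -mulf_div divff ?mul1r// gt_eqF// invr_gt0.
Qed.

(** By [gauss_avg_shift] the value at [x + y] is a quotient of averages of exponentials of linear
    forms in [y], so [exp_avg_taylor] applies. Its constant depends on the weights only through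
    their being nonnegative with sum 1, hence not on [x]. *)
Lemma gauss_avg_taylor (M r : R) : 0 <= M -> 0 <= r ->
  (forall p, p \in s -> `|f p| <= M) -> (forall p, p \in s -> enorm p <= r) ->
  exists2 C : R, 0 <= C & cubic_taylor C (gauss_avg k s f).
Proof.
move=> M0 r0 fM pr; set L := 2 * k * r.
have L0 : 0 <= L by rewrite !mulr_ge0.
set C := expR L * (M * (expR L * (2 + 2 * L + 3 * L ^+ 2) + 4 + 2 * L)).
have C0 : 0 <= C.
  by rewrite /C !(mulr_ge0, addr_ge0) ?expR_ge0 ?exprn_ge0.
exists (C * L ^+ 3); first by rewrite mulr_ge0// exprn_ge0.
move=> x; set l := fun p : 'rV[R]_n => (2 * k) *: p.
pose E (g : 'rV[R]_n -> R) := \sum_(p <- s) sg x p * g p.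
pose F1 := \sum_(p <- s) (sg x p * f p) *: l p.
pose D1 := \sum_(p <- s) sg x p *: l p.
pose F2 := \sum_(p <- s) (sg x p * f p) *: ((l p)^T *m l p).
pose D2 := \sum_(p <- s) sg x p *: ((l p)^T *m l p).
exists (F1 - E f *: D1), (F2 - 2 *: (F1^T *m D1) - E f *: D2 + (2 * E f) *: (D1^T *m D1)) => y y1.
have aE p : 2 * k * inner p y = inner (l p) y by rewrite innerZl.
have F1E : inner F1 y = E (fun p => f p * (2 * k * inner p y)).
  by rewrite inner_suml; apply: eq_bigr => p _; rewrite innerZl aE mulrA.
have D1E : inner D1 y = E (fun p => 2 * k * inner p y).
  by rewrite inner_suml; apply: eq_bigr => p _; rewrite innerZl aE.
have F2E : qf F2 y = E (fun p => f p * (2 * k * inner p y) ^+ 2).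
  by rewrite qf_summ; apply: eq_bigr => p _; rewrite qfZm qf_outer aE; ring.
have D2E : qf D2 y = E (fun p => (2 * k * inner p y) ^+ 2).
  by rewrite qf_summ; apply: eq_bigr => p _; rewrite qfZm qf_outer aE expr2.
have := @exp_avg_taylor _ _ s (sg x) f (fun p => 2 * k * inner p y) M L (L * enorm y)
  (gauss_wt_ge0 x) (gauss_wt_sum x) M0 fM (mulr_ge0 L0 (enorm_ge0 y))
  (ler_piMr L0 y1).
have ar p : p \in s -> `|2 * k * inner p y| <= L * enorm y.
  move=> ps; rewrite normrM ger0_norm ?mulr_ge0// /L -[leRHS]mulrA ler_wpM2l ?mulr_ge0//.
  by rewrite (le_trans (norm_inner_le _ _))// ler_wpM2r ?enorm_ge0// pr.
move=> /(_ ar) /=; rewrite -/C exprMn -gauss_avg_shift => h.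
rewrite innerBl innerZl qfDm !qfBm !qfZm !qf_outer F1E D1E F2E D2E.
rewrite [X in _ - (X + _ + _)]/gauss_avg /E.
by rewrite -[leRHS]mulrA; apply: le_trans h; rewrite le_eqVlt; apply/orP; left; apply/eqP; congr `|_|; field.
Qed.

End GaussAvg.

Lemma finite_net {R : realType} {n : nat} (r e : R) : 0 < e ->
  exists s : seq 'rV[R]_n, (forall p, p \in s -> enorm p <= r) /\
    forall x, enorm x <= r -> exists2 p, p \in s & enorm (x - p) < e.
Proof.
move=> e0; pose B := [set y : 'rV[R]_n | enorm (y - 0) <= r].
have : compact B by exact: compact_eball.
rewrite compact_cover => /(_ _ B (fun p => interior [set y | enorm (y - p) < e])).
case=> [p _|x Bx|S SB cov].
- exact: open_interior.
- by exists x => //; apply/nbhs_enormP; exists e => // y.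
exists (finmap.enum_fset S); split=> [p pS|x xr].
  by have := SB _ pS; rewrite inE /B/= subr0.
have [|p /= pS px] := cov x; first by rewrite /B/= subr0.
by exists p => //; exact: (interior_subset px).
Qed.

(** The centres form an [h]-net of the ball. Those within [2h] of [x] contribute at most [e / 2] by
    the Lipschitz bound. The others have weight at most [expR (- 3 k h^2)], since some centre lies
    within [h] of [x]. *)
Lemma gauss_avg_approx {R : realType} {n : nat} (f : 'rV[R]_n -> R) (M L r e : R) :
  0 <= r -> 0 <= M -> 0 <= L -> 0 < e ->
  (forall x, enorm x <= r -> `|f x| <= M) ->
  (forall x y, enorm x <= r -> enorm y <= r -> `|f x - f y| <= L * enorm (x - y)) ->
  exists (C : R) w, [/\ 0 <= C, cubic_taylor C w, forall x, `|w x| <= M &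
    forall x, enorm x <= r -> `|w x - f x| <= e].
Proof.
move=> r0 M0 L0 e0 fM fL.
set h := e / (4 * (L + 1)).
have h0 : 0 < h by rewrite divr_gt0 ?mulr_gt0// ltr_wpDl.
have [s [sr snet]] := @finite_net R n r h h0.
have sn0 : s != [::].
  have [|p ps _] := snet 0; first by rewrite enorm0.
  by case: (s) ps.
set m := (size s)%:R : R.
(* Large enough for the far centres to contribute at most [e / 2] in total, by [expR t >= 1 + t]. *)
set k := 4 * M * m / (3 * h ^+ 2 * e) + 1.
have m0 : 0 <= m by [].
have k0 : 0 < k.
  apply: ltr_wpDl => //; apply: divr_ge0; first by rewrite !mulr_ge0.
  by rewrite (mulr_ge0 _ (ltW e0))// mulr_ge0// exprn_ge0// ltW.
have fsM p : p \in s -> `|f p| <= M by move=> /sr /fM.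
have [C C0 tC] := gauss_avg_taylor (ltW k0) sn0 M0 r0 fsM sr.
exists C, (gauss_avg k s f); split=> //; first exact: gauss_avg_bound.
move=> x xr.
have sg0 := gauss_wt_ge0 k sn0 x; have sg1 := gauss_wt_sum k sn0 x.
have D0 := gauss_den_gt0 k sn0 x.
set D := \sum_(p <- s) _ in D0.
rewrite -[X in _ - X]mul1r -sg1 mulr_suml /gauss_avg -sumrB.
have [p0 p0s xp0] := snet x xr.
have Dge : expR (- k * h ^+ 2) <= D.
  rewrite /D (big_rem p0)//= ler_wpDr//; first by apply: sumr_ge0 => q _; rewrite expR_ge0.
  by rewrite ler_expR !mulNr lerN2 ler_wpM2l ?(ltW k0)// lerXn2r ?nnegrE ?enorm_ge0 ?(ltW h0) ?(ltW xp0).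
have far : 2 * M * m * expR (- (3 * k * h ^+ 2)) <= e / 2.
  have h20 : 0 < 3 * h ^+ 2 by rewrite mulr_gt0// exprn_gt0.
  have t0 : 0 < 3 * k * h ^+ 2 by rewrite mulrAC mulr_gt0.
  rewrite expRN ler_pdivrMr ?expR_gt0//.
  apply: le_trans (_ : e / 2 * (3 * k * h ^+ 2) <= _); last first.
    have e20 : 0 <= e / 2 by rewrite divr_ge0// ltW.
    by apply: ler_wpM2l => //; apply: le_trans (expR_ge1Dx _); rewrite lerDr.
  rewrite /k; have -> : e / 2 * (3 * (4 * M * m / (3 * h ^+ 2 * e) + 1) * h ^+ 2) =
     2 * M * m + e / 2 * (3 * h ^+ 2).
    by field; rewrite !gt_eqF.
  by rewrite lerDl (mulr_ge0 _ (ltW h20))// divr_ge0// ltW.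
have term p : p \in s -> `|gauss_wt k s x p * f p - gauss_wt k s x p * f x| <=
    gauss_wt k s x p * (e / 2) + 2 * M * expR (- (3 * k * h ^+ 2)).
  move=> ps; rewrite -mulrBr normrM ger0_norm; last exact: sg0.
  have [near_|far_] := leP (enorm (x - p)) (2 * h).
    rewrite ler_wpDr ?mulr_ge0 ?expR_ge0// ler_wpM2l//.
    rewrite (le_trans (fL _ _ (sr _ ps) xr))// enormB.
    apply: le_trans (ler_wpM2l L0 near_) _; rewrite /h.
    have -> : L * (2 * (e / (4 * (L + 1)))) = (L / (L + 1)) * (e / 2).
      by field; rewrite gt_eqF// ltr_wpDl.
    have e20 : 0 <= e / 2 by rewrite divr_ge0// ltW.
    by rewrite ler_piMl// ler_pdivrMr ?ltr_wpDl// mul1r lerDl.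
  apply: ler_wpDl; first by rewrite mulr_ge0// divr_ge0// ltW.
  rewrite mulrC ler_pM//.
    by rewrite (le_trans (ler_normB _ _))//; have := fM x xr; have := fsM p ps; lra.
  rewrite /gauss_wt -/D ler_pdivrMr//; apply: le_trans (ler_wpM2l (expR_ge0 _) Dge).
  rewrite -expRD ler_expR !mulNr -opprD lerN2.
  have : (2 * h) ^+ 2 <= enorm (x - p) ^+ 2.
    have h2 := ltW h0.
    by apply: lerXn (ltW far_); rewrite mulr_ge0.
  by move=> /(ler_wpM2l (ltW k0)); rewrite exprMn; lra.
apply: le_trans (ler_norm_sum _ _ _) _; rewrite big_seq.
apply: le_trans (ler_sum _ term) _; rewrite -big_seq big_split/= -mulr_suml sg1 mul1r.
rewrite big_const_seq count_predT iter_addr_0 -mulr_natl -/m.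
by move: far; lra.
Qed.

(** * Sum rule for linear equations *)

Ltac nneg := repeat match goal with
  | H : ?P |- ?P => exact H
  | H : is_true (0 < ?x) |- is_true (0 <= ?x) => exact (ltW H)
  | |- is_true (0 <= _ + _) => apply: addr_ge0
  | |- is_true (0 <= _ * _) => apply: mulr_ge0
  | |- is_true (0 <= _ ^-1) => rewrite invr_ge0
  | |- is_true (0 <= _ ^+ _) => apply: exprn_ge0
  | |- is_true (0 <= enorm _) => exact: enorm_ge0
  | |- is_true (0 <= powR _ _) => exact: powR_ge0
  | |- is_true (0 <= `|_|) => exact: normr_ge0
  | |- is_true (0 <= bigop.body _ _ _) => apply: sumr_ge0 => ? _
  | |- is_true (0 <= _) => done
  end.

Section CompactBall.
Context {R : realType} {n : nat}.
Implicit Types (A : set 'rV[R]_n) (w : 'rV[R]_n -> R).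

(** A Lebesgue number argument: a property that passes to smaller radii and holds with a locally
    uniform radius holds with one radius on the whole ball. *)
Lemma eball_uniform (r : R) (P : R -> 'rV[R]_n -> Prop) :
  (forall d d' x, d' <= d -> P d x -> P d' x) ->
  (forall x, enorm x <= r -> exists2 d : R, 0 < d & forall x', enorm (x' - x) < d -> P d x') ->
  exists2 d : R, 0 < d & forall x, enorm x <= r -> P d x.
Proof.
move=> mP loc.
have /compact_near_coveringP cov := @compact_eball R n 0 r.
have [x /=|d /= d0 dP] := cov R (0^'+) P (at_right_proper_filter 0).
- rewrite subr0 => /loc[d d0 dP].
  exists ([set x' | enorm (x' - x) < d], [set t | 0 < t < d]) => /=.
    split; first by apply/nbhs_enormP; exists d.
    near=> t; rewrite /=; apply/andP; split; near: t.
      exact: nbhs_right_gt.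
    exact: nbhs_right_lt.
  move=> [x' t] /= [/dP + /andP[_ td]]; exact: mP (ltW td).
- exists (d / 2); first by rewrite divr_gt0.
  move=> x xr; apply: (dP (d / 2)); rewrite /= ?sub0r ?normrN ?subr0//.
  + by rewrite gtr0_norm ?divr_gt0// ltr_pdivrMr// ltr_pMr// ltr1n.
  + by rewrite divr_gt0.
Unshelve. all: by end_near. Qed.

(* Upper semicontinuity of the extension of [w] by [-oo] outside [A]. *)
Definition usc_ext (A : set 'rV[R]_n) (w : 'rV[R]_n -> R) : Prop :=
  forall z c, (A z -> w z < c) ->
    exists2 r : R, 0 < r & forall y, A y -> enorm (y - z) < r -> w y < c.

(** Without a maximum, each point of the ball has a neighbourhood on which [w] is below some value
    [w y]. Compactness along the filter of superlevel sets then gives one [i] in [A] with [w < w i]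
    on all of [A], which fails at [i]. The condition of [usc_ext] at points outside [A] takes the
    place of closedness of [A]. *)
Lemma usc_ext_attains (r : R) A w : A !=set0 -> (forall z, A z -> enorm z <= r) ->
  usc_ext A w -> exists2 z, A z & forall y, A y -> w y <= w z.
Proof.
move=> [a0 Aa0] Ar uw; apply: contrapT => nomax.
have up z : A z -> exists2 y, A y & w z < w y.
  move=> Az; apply: contrapT => h; apply: nomax; exists z => // y Ay.
  by rewrite leNgt; apply/negP => zy; apply: h; exists y.
have /compact_near_coveringP cov := @compact_eball R n 0 r.
pose F := filter_from A (fun i => [set j | A j /\ w i <= w j]).
have FF : Filter F.
  apply: filter_from_filter; first by exists a0.
  move=> i j Ai Aj; have [ij|/ltW ji] := leP (w i) (w j).
    by exists j => // k [Ak jk]; split; split=> //; apply: le_trans jk.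
  by exists i => // k [Ak ik]; split; split=> //; apply: le_trans ik.
have [x _|i Ai] := cov _ F (fun i x => A x -> w x < w i) FF.
- have [y Ay xy] : exists2 y, A y & (A x -> w x < w y).
    have [/up[y Ay xy]|nAx] := pselect (A x); first by exists y.
    by exists a0 => // /nAx.
  have [e e0 eP] := uw _ _ xy.
  exists ([set x' | enorm (x' - x) < e], [set j | A j /\ w y <= w j]) => /=.
    by split; [apply/nbhs_enormP; exists e|exists y].
  by move=> [x' j] /= [x'x [Aj yj]] Ax'; apply: lt_le_trans yj; apply: eP.
- move=> /(_ i (conj Ai (lexx _)) i) /= h.
  by have := h _ Ai; rewrite subr0 ltxx => /(_ (Ar _ Ai)).
Qed.

Lemma usc_ext_eball (r : R) w :
  (forall x e, enorm x <= r -> 0 < e -> exists2 d : R, 0 < d &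
     forall y, enorm y <= r -> enorm (y - x) < d -> w y < w x + e) ->
  usc_ext [set y | enorm y <= r] w.
Proof.
move=> cw z c /=; have [zr /(_ isT) wc|rz _] := leP (enorm z) r.
  have [|d d0 dP] := cw z (c - w z) zr; first by rewrite subr_gt0.
  by exists d => // y yr /(dP _ yr); rewrite addrC subrK.
exists (enorm z - r); first by rewrite subr_gt0.
move=> y yr; rewrite enormB ltrBDr => h.
have : enorm z <= enorm (z - y) + enorm y by rewrite -{1}[z](subrK y) ler_enormD.
by move: yr h; lra.
Qed.

End CompactBall.

(** The linear inequality with constant coefficients, in divided form: the coefficient matrix is the
    sum of the squares of the directions [d i]. The cubic error in the test lets functions with a
    [cubic_taylor] expansion serve as test functions directly. *)
Definition visc_sub {R : realType} {n : nat} {I : finType} (f : 'rV[R]_n -> R)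
    (d : I -> 'rV[R]_n) (c r : R) : Prop :=
  forall x G H C e, enorm x < r -> 0 < e ->
    (forall y, enorm y <= e ->
      f (x + y) <= f x + inner G y + qf H y / 2 + C * enorm y ^+ 3) ->
    c <= \sum_i qf H (d i).

Definition lipschitz_ball {R : realType} {n : nat} (L r : R) (f : 'rV[R]_n -> R) : Prop :=
  forall x y, enorm x <= r -> enorm y <= r -> `|f x - f y| <= L * enorm (x - y).

Definition discrete_lap {R : realType} {n : nat} {I : finType} (h : R)
    (d : I -> 'rV[R]_n) (w : 'rV[R]_n -> R) (x : 'rV[R]_n) : R :=
  (\sum_i (w (x + h *: d i) + w (x - h *: d i) - 2 * w x)) / h ^+ 2.

Lemma cubic_taylor_cont {R : realType} {n : nat} (C e : R) (w : 'rV[R]_n -> R) (x : 'rV[R]_n) :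
  0 <= C -> cubic_taylor C w -> 0 < e ->
  exists2 d : R, 0 < d & forall y, enorm (y - x) < d -> `|w y - w x| < e.
Proof.
move=> C0 tw e0; have [G [H h]] := tw x; have [CH CH0 qH] := qf_bound H.
set B := enorm G + CH + C + 1.
have B1 : 1 <= B by rewrite lerDr !addr_ge0 ?enorm_ge0.
have B0 : 0 < B by exact: lt_le_trans B1.
exists (Num.min 1 (e / (2 * B))); first by rewrite lt_min ltr01 divr_gt0// mulr_gt0.
move=> y; rewrite lt_min => /andP[/ltW y1 ye].
have := h _ y1; rewrite subrKC => {}h.
have yy := enorm_ge0 (y - x).
have hG := norm_inner_le G (y - x); have hH := qH (y - x).
have y2 : enorm (y - x) ^+ 2 <= enorm (y - x) by rewrite expr2 ler_piMr.
have y3 : enorm (y - x) ^+ 3 <= enorm (y - x).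
  by rewrite exprS ler_piMr// (le_trans y2).
have h1 := ler_wpM2l CH0 y2; have h2 := ler_wpM2l C0 y3.
have h3 : `|w y - w x| <= B * enorm (y - x).
  rewrite /B !mulrDl mul1r; move: h hG hH; rewrite !ler_norml => /andP[? ?] /andP[? ?] /andP[? ?].
  by apply/andP; split; nra.
apply: le_lt_trans h3 _; move: ye; rewrite ltr_pdivlMr ?mulr_gt0// => ye.
rewrite mulrC; apply: le_lt_trans ye; rewrite ler_wpM2l//.
by rewrite ler_peMl ?(ltW B0)// ler1n.
Qed.

(** First-order terms cancel between [h *: d i] and its opposite; the two cubic errors of size
    [C h^3 |d i|^3] are divided by [h^2]. *)
Lemma cubic_taylor_discrete_lap {R : realType} {n : nat} {I : finType} (C h : R)
    (w : 'rV[R]_n -> R) (d : I -> 'rV[R]_n) (x G : 'rV[R]_n) (H : 'M[R]_n) :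
  0 < h -> (forall i, h * enorm (d i) <= 1) ->
  (forall y, enorm y <= 1 ->
    `|w (x + y) - (w x + inner G y + qf H y / 2)| <= C * enorm y ^+ 3) ->
  \sum_i qf H (d i) - 2 * C * h * \sum_i enorm (d i) ^+ 3 <= discrete_lap h d w x.
Proof.
move=> h0 hd wx; rewrite /discrete_lap ler_pdivlMr ?exprn_gt0//.
rewrite mulr_sumr -sumrB mulr_suml; apply: ler_sum => i _.
have nE : enorm (h *: d i) = h * enorm (d i) by rewrite enormZ gtr0_norm.
have := wx (h *: d i); rewrite nE => /(_ (hd i)).
have := wx (- (h *: d i)); rewrite enormN nE => /(_ (hd i)).
rewrite qfN innerNr qfZ innerZr exprMn !ler_norml => /andP[a1 _] /andP[a2 _].
by move: a1 a2; lra.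
Qed.

(* The quartic polynomial [|x|^4 + A l |x|^2 + B l^2] is a supersolution of the
   resolvent equation, so adding a multiple of it localizes the comparison. *)
Lemma resolvent_upper {R : realType} {n : nat} {I : finType} (f : 'rV[R]_n -> R)
    (d : I -> 'rV[R]_n) (c r L M : R) : 0 < r -> 0 <= L -> 0 <= M ->
  lipschitz_ball L r f -> (forall x, enorm x <= r -> `|f x| <= M) ->
  visc_sub f d c r ->
  exists2 K : R, 0 <= K & forall (l e h C : R) (w : 'rV[R]_n -> R),
    0 < l -> l <= 1 -> 0 <= e -> 0 < h -> 0 <= C -> (forall i, h * enorm (d i) <= 1) ->
    cubic_taylor C w -> (forall x, `|w x| <= M) ->
    (forall x, enorm x <= r -> f x - e <= w x - l * discrete_lap h d w x) ->
    f 0 <= w 0 + K * l ^+ 2 - l * c + e + l * (2 * C * h * \sum_i enorm (d i) ^+ 3).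
Proof.
move=> r0 L0 M0 fL fM vf.
set S := \sum_i enorm (d i) ^+ 2.
have S0 : 0 <= S by apply: sumr_ge0 => i _; rewrite sqr_ge0.
(* On the sphere of radius [r] the quartic barrier then reaches [2 M + |c|], so a maximum point
   there already gives the claim. *)
set K := (2 * M + `|c|) / r ^+ 4.
have K0 : 0 <= K by rewrite divr_ge0 ?addr_ge0 ?mulr_ge0 ?exprn_ge0 ?(ltW r0).
(* The second derivatives of [|x|^4] along the [d i] add up to at most [12 S |x|^2], and those of
   [A l |x|^2] to [2 A l S]. Multiplied by [l] they are covered by the two lower terms of [V]. *)
set A := 12 * S; have A0 : 0 <= A by rewrite mulr_ge0.
exists (K * (2 * A * S)); first by rewrite (mulr_ge0 K0)// (mulr_ge0 _ S0)// (mulr_ge0 _ A0).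
move=> l e h C w l0 l1 e0 h0 C0 hd tw wM eqw.
set err := l * (2 * C * h * _).
have err0 : 0 <= err.
  rewrite !mulr_ge0 ?(ltW l0) ?(ltW h0)//.
  by apply: sumr_ge0 => i _; rewrite exprn_ge0 ?enorm_ge0.
pose V (x : 'rV[R]_n) := enorm x ^+ 4 + A * l * enorm x ^+ 2 + 2 * A * S * l ^+ 2 : R.
have Al : 0 <= A * l by rewrite mulr_ge0// ltW.
have [x1 /= x1r x1max] : exists2 x, enorm x <= r &
    forall y, enorm y <= r -> f y - w y - K * V y <= f x - w x - K * V x.
  apply: (@usc_ext_attains _ _ r [set y | enorm y <= r]) => //.
    by exists 0; rewrite /= enorm0 ltW.
  apply: usc_ext_eball => x t xr t0.
  have [d1 d10 wd] := cubic_taylor_cont x C0 tw (divr_gt0 t0 (ltr0n _ 3) : 0 < t / 3).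
  pose B := K * (4 * r ^+ 3 + A * l * (2 * r)).
  have B0 : 0 <= B by rewrite mulr_ge0// addr_ge0 ?(mulr_ge0 Al) ?mulr_ge0 ?exprn_ge0 ?(ltW r0).
  have d20 : 0 < t / (3 * (B + L + 1)) by rewrite divr_gt0// mulr_gt0// ltr_wpDl ?addr_ge0.
  exists (Num.min d1 (t / (3 * (B + L + 1)))); first by rewrite lt_min d10.
  move=> y yr; rewrite lt_min => /andP[/wd wyx].
  rewrite ltr_pdivlMr; last by rewrite mulr_gt0// ltr_wpDl ?addr_ge0.
  set u := enorm (y - x) => ut.
  have u0 : 0 <= u by exact: enorm_ge0.
  have fyx := fL _ _ yr xr.
  have xy : `|enorm x - enorm y| <= u.
    have h1 : enorm x <= enorm y + u.
      by rewrite /u (enormB y); have := ler_enormD y (x - y); rewrite subrKC.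
    have h2 : enorm y <= enorm x + u.
      by have := ler_enormD x (y - x); rewrite subrKC.
    by rewrite ler_norml; apply/andP; split; lra.
  have Vxy : K * V x - K * V y <= B * u.
    rewrite -mulrBr /B -mulrA ler_wpM2l//.
    have -> : V x - V y = (enorm x - enorm y) *
      ((enorm x + enorm y) * (enorm x ^+ 2 + enorm y ^+ 2) + A * l * (enorm x + enorm y)).
      by rewrite /V; ring.
    have s1 : enorm x + enorm y <= 2 * r by lra.
    have s0 : 0 <= enorm x + enorm y by rewrite addr_ge0 ?enorm_ge0.
    have s2 : enorm x ^+ 2 + enorm y ^+ 2 <= 2 * r ^+ 2.
      by have := lerXn 2 (enorm_ge0 x) xr; have := lerXn 2 (enorm_ge0 y) yr; lra.
    apply: le_trans (ler_norm _) _; rewrite normrM mulrC ler_pM//.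
    rewrite ger0_norm; last by nneg.
    apply: lerD; last by rewrite ler_wpM2l.
    have -> : 4 * r ^+ 3 = (2 * r) * (2 * r ^+ 2) by ring.
    by rewrite ler_pM ?addr_ge0 ?exprn_ge0 ?enorm_ge0.
  move: fyx wyx Vxy ut; rewrite -/u !ltr_norml !ler_norml => /andP[_ ?] /andP[? _] ? ?.
  by lra.
have f0le : f 0 - w 0 - K * (2 * A * S * l ^+ 2) <= f x1 - w x1 - K * V x1.
  have := x1max 0; rewrite enorm0 => /(_ (ltW r0)).
  by rewrite /V enorm0 !expr0n /= !mulr0 !add0r.
(* At an interior maximum [w + K V] touches [f] from above and the viscosity inequality applies; on
   the sphere the barrier decides. *)
have [x1r'|x1r'] := ltP (enorm x1) r; last first.
  have xr : enorm x1 = r by apply/eqP; rewrite eq_le x1r x1r'.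
  have KV : 2 * M + `|c| <= K * V x1.
    apply: le_trans (_ : K * enorm x1 ^+ 4 <= _).
      by rewrite /K xr divfK// gt_eqF// exprn_gt0.
    by rewrite ler_wpM2l// /V -addrA lerDl addr_ge0 ?mulr_ge0 ?exprn_ge0 ?enorm_ge0 ?(ltW l0).
  have fx := fM _ x1r; have wx := wM x1.
  have lc : l * c <= `|c|.
    apply: le_trans (ler_norm _) _; rewrite normrM (gtr0_norm l0).
    by rewrite ler_piMl.
  move: fx wx f0le KV lc; rewrite !ler_norml => /andP[_ ?] /andP[? _] ? ? ?.
  by lra.
have [G [H tx1]] := tw x1.
set rho := enorm x1 ^+ 2.
have rho0 : 0 <= rho by rewrite sqr_ge0.
pose e1 := Num.min 1 (r - enorm x1).
have e10 : 0 < e1 by rewrite lt_min ltr01 subr_gt0.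
have cle := vf x1 (G + (K * (4 * rho + 2 * A * l)) *: x1)
  (H + K *: ((4 * rho + 2 * A * l) *: 1%:M + 8 *: (x1^T *m x1)))
  (C + K * (4 * enorm x1 + 1)) e1 x1r' e10.
have {}cle : c <= \sum_i qf H (d i) + K * (S * (12 * rho + 2 * A * l)).
  apply: le_trans (cle _) _ => [y|].
    rewrite le_min => /andP[y1 yr].
    have xyr : enorm (x1 + y) <= r by rewrite (le_trans (ler_enormD _ _))// -lerBrDl.
    have := x1max _ xyr; have := tx1 _ y1.
    rewrite innerDl innerZl qfDm qfZm qfDm !qfZm qf1m qf_outer -enorm_sq.
    have -> : V (x1 + y) = V x1 + (4 * rho + 2 * A * l) * inner x1 y +
        ((4 * rho + 2 * A * l) * enorm y ^+ 2 + 8 * (inner x1 y * inner x1 y)) / 2 +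
        (4 * inner x1 y * enorm y ^+ 2 + enorm y ^+ 4).
      by rewrite /V (exprM _ 2 2 : enorm (x1 + y) ^+ 4 = _) enorm_sqD /rho; field.
    have k1 : 4 * inner x1 y * enorm y ^+ 2 + enorm y ^+ 4 <=
              (4 * enorm x1 + 1) * enorm y ^+ 3.
      have yy := enorm_ge0 y.
      have i1 := ler_wpM2r (sqr_ge0 (enorm y)) (inner_le_enorm x1 y).
      have i2 : enorm y ^+ 4 <= enorm y ^+ 3 by rewrite exprS ler_piMl// exprn_ge0.
      by move: i1 i2; lra.
    have := ler_wpM2l K0 k1; rewrite ler_norml => ? /andP[_ ?] ?.
    by lra.
  rewrite /S mulr_suml mulr_sumr -big_split; apply: ler_sum => i _ /=.
  rewrite qfDm qfZm qfDm !qfZm qf1m qf_outer -enorm_sq lerD2l ler_wpM2l//.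
  have := norm_inner_le x1 (d i); rewrite ler_norml => /andP[i1 i2].
  have : inner x1 (d i) * inner x1 (d i) <= rho * enorm (d i) ^+ 2.
    by rewrite /rho -expr2 -exprMn; move: i1 i2; nra.
  by lra.
have lap := cubic_taylor_discrete_lap h0 hd tx1.
have eq1 := eqw x1 x1r.
have l2 := ler_wpM2l (ltW l0) cle; have l3 := ler_wpM2l (ltW l0) lap.
have KV : l * (K * (S * (12 * rho + 2 * A * l))) <= K * V x1.
  rewrite mulrCA ler_wpM2l// /V (exprM _ 2 2 : enorm x1 ^+ 4 = _) -/rho /A.
  have : 0 <= rho ^+ 2 by rewrite sqr_ge0.
  by lra.
by move: f0le eq1 l2 l3 KV; rewrite /err; lra.
Qed.

(* Fixed-point iteration for [w - l * discrete_lap w = f], written with [nu = l / h^2]. *)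
Fixpoint resolvent_iter {R : realType} {n : nat} {I : finType} (nu h M : R)
    (d : I -> 'rV[R]_n) (f : 'rV[R]_n -> R) (k : nat) : 'rV[R]_n -> R :=
  if k is k'.+1 then
    let w := resolvent_iter nu h M d f k' in
    fun x => (f x + nu * \sum_i (w (x + h *: d i) + w (x - h *: d i))) /
             (1 + 2 * #|I|%:R * nu)
  else fun=> M.

Section ResolventIter.
Context {R : realType} {n : nat} {I : finType}.
Variables (nu h M C : R) (d : I -> 'rV[R]_n) (f : 'rV[R]_n -> R).
Hypotheses (nu0 : 0 <= nu) (M0 : 0 <= M) (C0 : 0 <= C).
Hypotheses (fM : forall x, `|f x| <= M) (tf : cubic_taylor C f).

Let w := resolvent_iter nu h M d f.
Let q := 1 + 2 * #|I|%:R * nu.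

Lemma resolvent_den_gt0 : 0 < q.
Proof. by rewrite ltr_pwDl// !mulr_ge0. Qed.
Let q0 := resolvent_den_gt0.

Lemma resolvent_iterS k x :
  w k.+1 x * q = f x + nu * \sum_i (w k (x + h *: d i) + w k (x - h *: d i)).
Proof. by rewrite /w /= divfK// gt_eqF// q0. Qed.

Lemma resolvent_iter_bound k x : `|w k x| <= M.
Proof.
elim: k x => [x|k IH x]; first by rewrite /w /= ger0_norm.
rewrite -(ler_pM2r q0) -{1}(gtr0_norm q0) -normrM resolvent_iterS.
apply: le_trans (ler_normD _ _) _; rewrite normrM (ger0_norm nu0) /q mulrDr mulr1.
apply: lerD => //; rewrite mulrC mulrA ler_wpM2r//.
apply: le_trans (ler_norm_sum _ _ _) _.
apply: le_trans (ler_sum _ (fun i _ => ler_normD _ _)) _.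
apply: le_trans (ler_sum _ (fun i _ => lerD (IH _) (IH _))) _.
by rewrite sumr_const -mulr_natr; lra.
Qed.

(** The starting constant [M] dominates every value of the first iterate, and the iteration map is
    monotone. *)
Lemma resolvent_iter_decr k x : w k.+1 x <= w k x.
Proof.
elim: k x => [x|k IH x].
  by apply: le_trans (ler_norm _) _; exact: resolvent_iter_bound.
rewrite -(ler_pM2r q0) !resolvent_iterS lerD2l ler_wpM2l//.
by apply: ler_sum => i _; rewrite lerD.
Qed.

(** Each iterate is a convex combination of [f] and of translates of the previous one, so the
    constant [C] is the same for every [k]. *)
Lemma resolvent_iter_taylor k : cubic_taylor C (w k).
Proof.
elim: k => [|k IH]; first exact: cubic_taylor_cst.
have := cubic_taylorZ q^-1 (cubic_taylorD tf (cubic_taylorZ nu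
  (cubic_taylor_sum (index_enum I) (fun i =>
    cubic_taylorD (cubic_taylor_shift (h *: d i) IH) (cubic_taylor_shift (- (h *: d i)) IH))))).
rewrite (_ : _ * (C + _) = C).
  move=> t x; have [G [H {}t]] := t x; exists G, H => y /t.
  by rewrite /w /= !(mulrC q^-1).
rewrite gtr0_norm ?invr_gt0 ?q0// ger0_norm// sumr_const -[(C + C) *+ _]mulr_natr.
by have q1 := q0; rewrite /q in q1 *; field; rewrite gt_eqF.
Qed.

(** [w k.+1 <= w k], multiplied by the denominator, is exactly this inequality: each finite iterate
    is a supersolution of the resolvent equation, and it stays smooth with the bounds of [f]. *)
Lemma resolvent_iter_super (l : R) : 0 < h -> nu = l / h ^+ 2 ->
  forall k x, f x <= w k x - l * discrete_lap h d (w k) x.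
Proof.
move=> h0 nuE k x; have := resolvent_iter_decr k x.
rewrite -(ler_pM2r q0) resolvent_iterS /discrete_lap mulrCA -nuE.
rewrite sumrB sumr_const -[(2 * w k x) *+ _]mulr_natr /q; move: (\sum_i _) => s.
by lra.
Qed.

End ResolventIter.

(* The iterations for [f] along [d] and for [g] along [e] add up to the iteration for
   [f y1 + g y2] along the coupled directions [(d i, e i)]. *)
Lemma resolvent_iter_coupled {R : realType} {n : nat} {I : finType} (nu h M E : R)
    (d e : I -> 'rV[R]_n) (f g : 'rV[R]_n -> R) (P : 'rV[R]_n -> 'rV[R]_n -> R) :
  0 <= nu -> 0 <= E ->
  (forall x y, f x + g y +
     nu * \sum_i (P (x + h *: d i) (y + h *: e i) + P (x - h *: d i) (y - h *: e i)) <=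
     P x y * (1 + 2 * #|I|%:R * nu)) ->
  (forall x y, 2 * M <= P x y + E) ->
  forall k x y, resolvent_iter nu h M d f k x + resolvent_iter nu h M e g k y <=
    P x y + (2 * #|I|%:R * nu / (1 + 2 * #|I|%:R * nu)) ^+ k * E.
Proof.
(* [E] is the excess of the starting value [2 M] over [P]. One iteration multiplies it by [t < 1],
   the total weight of the translates. *)
move=> nu0 E0 sP PE; set q := 1 + _; set t := _ / q.
have q0 : 0 < q by rewrite ltr_pwDl// !mulr_ge0.
have tq : t * q = 2 * #|I|%:R * nu by rewrite divfK// gt_eqF.
elim=> [x y|k IH x y]; first by rewrite expr0 mul1r /= -mulr2n -mulr_natl.
rewrite -(ler_pM2r q0) mulrDl resolvent_iterS// resolvent_iterS// (mulrDl _ _ q).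
have -> : t ^+ k.+1 * E * q = 2 * #|I|%:R * nu * (t ^+ k * E) by rewrite -tq exprS; ring.
have := sP x y; rewrite -/q.
set s1 := \sum_i _; set s2 := \sum_i _; set s3 := \sum_i _.
suff : s2 + s3 <= s1 + 2 * #|I|%:R * (t ^+ k * E).
  by move=> /(ler_wpM2l nu0); lra.
rewrite /s1 /s2 /s3 -big_split.
have -> : 2 * #|I|%:R * (t ^+ k * E) = \sum_(i : I) (2 * (t ^+ k * E)).
  by rewrite sumr_const -mulr_natr; ring.
rewrite -big_split; apply: ler_sum => i _ /=.
have := IH (x + h *: d i) (y + h *: e i); have := IH (x - h *: d i) (y - h *: e i).
by lra.
Qed.

Lemma small_geometric {R : realType} (t E e : R) : 0 <= t -> t < 1 -> 0 < e ->
  exists k, t ^+ k * E <= e.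
Proof.
move=> t0 t1 e0; have /cvgrPdist_lt : (fun k => t ^+ k) @ \oo --> (0 : R).
  by apply: cvg_expr; rewrite ger0_norm.
move=> /(_ (e / (`|E| + 1))) []; first by rewrite divr_gt0// ltr_wpDl.
move=> N _ /(_ N (leqnn N)); rewrite sub0r normrN ger0_norm ?exprn_ge0//.
rewrite ltr_pdivlMr ?ltr_wpDl// => h; exists N; apply: le_trans (ltW h).
by rewrite ler_wpM2l ?exprn_ge0// (le_trans (ler_norm _))// lerDl.
Qed.

Definition pair_sq {R : realType} {n : nat} (x y : 'rV[R]_n) : R :=
  enorm x ^+ 2 + enorm y ^+ 2.

Section CoupledBarrier.
Context {R : realType} {n : nat} {I : finType}.
Variables (d e : I -> 'rV[R]_n) (h : R).
Hypothesis h0 : 0 < h.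

Let tau i := pair_sq (d i) (e i).

Lemma coupled_sq_lap x y :
  \sum_i (pair_sq (x + h *: d i) (y + h *: e i) + pair_sq (x - h *: d i) (y - h *: e i) - 2 * pair_sq x y)
  = 2 * h ^+ 2 * \sum_i pair_sq (d i) (e i).
Proof.
rewrite mulr_sumr; apply: eq_bigr => i _.
by rewrite /tau /pair_sq !enorm_sqD !innerNr !enormN !enormZ !exprMn !innerZr real_normK ?num_real//; ring.
Qed.

(** For a quartic polynomial the second difference is explicit: [8 s^2 + 4 |z|^2 tau] at order [h^2]
    and [2 tau^2] at order [h^4], where [s^2 <= |z|^2 tau] by Cauchy-Schwarz. *)
Lemma coupled_quartic_lap x y :
  \sum_i (pair_sq (x + h *: d i) (y + h *: e i) ^+ 2 +
          pair_sq (x - h *: d i) (y - h *: e i) ^+ 2 - 2 * pair_sq x y ^+ 2)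
  <= h ^+ 2 * (12 * pair_sq x y * \sum_i pair_sq (d i) (e i) +
       2 * h ^+ 2 * \sum_i pair_sq (d i) (e i) ^+ 2).
Proof.
rewrite !mulr_sumr -big_split mulr_sumr; apply: ler_sum => i _ /=.
set s := inner x (d i) + inner y (e i).
have -> : pair_sq (x + h *: d i) (y + h *: e i) = pair_sq x y + 2 * h * s + h ^+ 2 * tau i.
  by rewrite /tau /pair_sq /s !enorm_sqD !enormZ !exprMn !innerZr real_normK ?num_real//; ring.
have -> : pair_sq (x - h *: d i) (y - h *: e i) = pair_sq x y - 2 * h * s + h ^+ 2 * tau i.
  by rewrite /tau /pair_sq /s !enorm_sqB !enormZ !exprMn !innerZr real_normK ?num_real//; ring.
have ss : s ^+ 2 <= pair_sq x y * tau i.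
  have hx := norm_inner_le x (d i); have hy := norm_inner_le y (e i).
  have hs : `|s| <= enorm x * enorm (d i) + enorm y * enorm (e i).
    by rewrite (le_trans (ler_normD _ _))// lerD.
  have := lerXn 2 (normr_ge0 _) hs; rewrite real_normK ?num_real// => /le_trans; apply.
  rewrite /tau /pair_sq; have := sqr_ge0 (enorm x * enorm (e i) - enorm y * enorm (d i)).
  by lra.
by have := ler_wpM2l (sqr_ge0 h) ss; rewrite /tau; lra.
Qed.

End CoupledBarrier.

(* The resolvents of [f] and [g] are smooth, so their sum is a classical subsolution along
   the coupled directions [(d i, e i)], and they dominate [f] and [g] up to [O(l^2)]. *)
Theorem visc_sub_coupled_sum {R : realType} {n : nat} {I : finType} (d e : I -> 'rV[R]_n)
    (f g : 'rV[R]_n -> R) (c1 c2 r L K0 : R) (G : 'rV[R]_n) (B : 'M[R]_n) :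
  0 < r -> 0 <= L -> 0 <= K0 -> lipschitz_ball L r f -> lipschitz_ball L r g ->
  visc_sub f d c1 r -> visc_sub g e c2 r ->
  (forall y1 y2, enorm y1 <= r -> enorm y2 <= r ->
     f y1 + g y2 <= f 0 + g 0 + inner G (y1 - y2) + qf B (y1 - y2) / 2 +
       K0 * (enorm y1 ^+ 4 + enorm y2 ^+ 4)) ->
  c1 + c2 <= \sum_i qf B (d i - e i).
Proof.
move=> r0 L0 K00 fL gL vf vg fg.
pose M : R := `|f 0| + `|g 0| + L * r.
have M0 : 0 <= M by rewrite /M; nneg.
have r0' := ltW r0.
have bnd (w : 'rV[R]_n -> R) x : lipschitz_ball L r w -> enorm x <= r ->
    `|w x| <= `|w 0| + L * r.
  move=> wL xr; have := wL x 0 xr; rewrite enorm0 subr0 => /(_ r0') h.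
  have := ler_normD (w x - w 0) (w 0); rewrite subrK => /le_trans; apply.
  by rewrite addrC lerD2l (le_trans h)// ler_wpM2l.
have fM x : enorm x <= r -> `|f x| <= M.
  by move=> /(bnd f x fL); have := normr_ge0 (g 0); rewrite /M; lra.
have gM x : enorm x <= r -> `|g x| <= M.
  by move=> /(bnd g x gL); have := normr_ge0 (f 0); rewrite /M; lra.
have [Kf Kf0 resf] := resolvent_upper r0 L0 M0 fL fM vf.
have [Kg Kg0 resg] := resolvent_upper r0 L0 M0 gL gM vg.
set ell := \sum_i _; rewrite leNgt; apply/negP => ellc.
pose kap := c1 + c2 - ell; have kap0 : 0 < kap by rewrite subr_gt0.
have [CB CB0 qB] := qf_bound B.
pose E0 := 2 * M + enorm G + CB.
have E00 : 0 <= E0 by rewrite /E0; nneg.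
pose p (x y : 'rV[R]_n) := f 0 + g 0 + inner G (x - y) + qf B (x - y) / 2.
have pE x y : `|p x y| <= E0 * (1 + pair_sq x y).
  have h1 := norm_inner_le G (x - y); have h2 := qB (x - y).
  have h3 : enorm (x - y) <= 1 + pair_sq x y.
    apply: le_trans (ler_enormB _ _) _; rewrite /pair_sq.
    by have := sqr_ge0 (enorm x - 1); have := sqr_ge0 (enorm y - 1); nra.
  have h4 : enorm (x - y) ^+ 2 <= 2 * pair_sq x y.
    rewrite enorm_sqB /pair_sq; have := sqr_ge0 (enorm x - enorm y).
    by have := norm_inner_le x y; rewrite ler_norml => /andP[? _] ?; lra.
  have f0 := fM 0; have g0 := gM 0; rewrite enorm0 in f0 g0.
  move: (f0 r0') (g0 r0') => {}f0 {}g0.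
  have h5 := ler_wpM2l (enorm_ge0 G) h3; have h6 := ler_wpM2l CB0 h4.
  have h7 : 0 <= pair_sq x y by rewrite /pair_sq; nneg.
  have h8 := mulr_ge0 M0 h7.
  rewrite /p /E0; move: f0 g0 h1 h2; rewrite !ler_norml => /andP[i1 i2] /andP[i3 i4] /andP[i5 i6] /andP[i7 i8].
  by apply/andP; split; move: i1 i2 i3 i4 i5 i6 i7 i8 h5 h6 h7 h8 M0 CB0 (enorm_ge0 G); clear; lra.
(* [K1 |z|^4] has to dominate the contact error [K0] near 0 and, at distance at least [r], the bound
   [2 M] of the two approximations minus the polynomial [p], which grows like [E0 (1 + |z|^2)]. *)
pose K1 : R := K0 + 2 * M / r ^+ 4 + E0 * (1 / r ^+ 4 + 1 / r ^+ 2) + E0.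
have K10 : 0 <= K1 by rewrite /K1; nneg.
pose S := \sum_i pair_sq (d i) (e i).
pose S2 := \sum_i pair_sq (d i) (e i) ^+ 2.
have S0 : 0 <= S by apply: sumr_ge0 => i _; rewrite /pair_sq; nneg.
have S20 : 0 <= S2 by apply: sumr_ge0 => i _; rewrite /pair_sq; nneg.
(* The barrier of [resolvent_upper] in the pair of variables. The term [2 S2] in [BB] covers the
   fourth-order part of the difference quotient, once [h^2 <= l]. *)
pose A := 12 * S; pose BB := 2 * S2 + 2 * A * S.
have A0 : 0 <= A by rewrite /A; nneg.
have BB0 : 0 <= BB by rewrite /BB; nneg.
pose Kt : R := Kf + Kg + K1 * BB.
have Kt0 : 0 <= Kt by rewrite /Kt; nneg.
(* All errors of order [l^2] carry the factor [Kt] and are thus at most [l kap / 8], while the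
   assumed gap contributes [l kap]. *)
pose l : R := Num.min 1 (kap / (8 * (Kt + 1))).
have l0 : 0 < l by rewrite lt_min ltr01 divr_gt0// mulr_gt0// ltr_wpDl.
have l1 : l <= 1 by rewrite ge_min lexx.
have lK : Kt * l <= kap / 8.
  have : l <= kap / (8 * (Kt + 1)) by rewrite ge_min lexx orbT.
  rewrite ler_pdivlMr ?mulr_gt0 ?ltr_wpDl// => h.
  by have := mulr_ge0 Kt0 (ltW l0); lra.
pose ep := l * kap / 32.
have ep0 : 0 < ep by rewrite divr_gt0// mulr_gt0.
have [Cf [f1 [Cf0 tf1 f1M f1f]]] := gauss_avg_approx r0' M0 L0 ep0 fM fL.
have [Cg [g1 [Cg0 tg1 g1M g1g]]] := gauss_avg_approx r0' M0 L0 ep0 gM gL.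
pose T := 2 * Cf * (\sum_i enorm (d i) ^+ 3) + 2 * Cg * (\sum_i enorm (e i) ^+ 3).
have T0 : 0 <= T by rewrite /T; nneg.
pose sd := \sum_i enorm (d i) + \sum_i enorm (e i).
have sd0 : 0 <= sd by rewrite /sd; nneg.
have t80 : 0 <= 8 * T / kap by nneg.
have il0 : 0 <= 1 / l by nneg.
(* The reciprocal of a sum of nonnegative terms, so that [h a <= 1] for every [a] below the sum: one
   choice meets all the smallness requirements. *)
pose h := (1 + sd + 8 * T / kap + 1 / l)^-1.
have hi0 : 0 < 1 + sd + 8 * T / kap + 1 / l.
  by rewrite !addrA -!addrA ltr_pwDl//; nneg.
have h0 : 0 < h by rewrite invr_gt0.
have hle a : 0 <= a -> a <= 1 + sd + 8 * T / kap + 1 / l -> h * a <= 1.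
  by move=> a0 al; rewrite mulrC /h ler_pdivrMr// (mul1r (1 + sd + _ + _)).
have hd i : h * enorm (d i) <= 1.
  apply: hle (enorm_ge0 _) _.
  have : enorm (d i) <= sd.
    by rewrite /sd (bigD1 i)//= -addrA lerDl; nneg.
  by move: t80 il0; clear; lra.
have he i : h * enorm (e i) <= 1.
  apply: hle (enorm_ge0 _) _.
  have : enorm (e i) <= sd.
    by rewrite /sd [X in _ + X](bigD1 i)//= addrCA lerDl; nneg.
  by move: t80 il0; clear; lra.
have h1 : h <= 1 by have := hle 1 ler01; rewrite mulr1; apply; move: sd0 t80 il0; clear; lra.
have hl : h ^+ 2 <= l.
  have : h * (1 / l) <= 1 by rewrite hle//; move: sd0 t80 il0; clear; lra.
  rewrite mulrA mulr1 ler_pdivrMr// mul1r => /(le_trans _); apply.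
  by rewrite expr2 ler_piMr// ltW.
have hT : h * T <= kap / 8.
  have : h * (8 * T / kap) <= 1 by rewrite hle//; move: sd0 t80 il0; clear; lra.
  by rewrite mulrA ler_pdivrMr//; clear; lra.
clearbody h.
pose nu := l / h ^+ 2.
have nu0 : 0 <= nu by rewrite /nu; nneg.
have nuh : nu * h ^+ 2 = l by rewrite /nu divfK// gt_eqF// exprn_gt0.
(* A supersolution of the resolvent equation along the coupled directions. On the quadratic [p] the
   difference quotient is exactly [ell], which the term [l ell] compensates; [2 ep] pays for the two
   smooth approximations. *)
pose P x y := p x y + l * ell + 2 * ep +
  K1 * (pair_sq x y ^+ 2 + A * l * pair_sq x y + BB * l ^+ 2).
pose E : R := 2 * M + 2 * E0 + `|ell|.
have E_0 : 0 <= E by rewrite /E; nneg.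
have sq0 (x y : 'rV[R]_n) : 0 <= pair_sq x y by rewrite /pair_sq; nneg.
have PE x y : 2 * M <= P x y + E.
  have := pE x y; rewrite ler_norml => /andP[hp _].
  have hl2 : - `|ell| <= l * ell.
    rewrite lerNl -mulrN; apply: le_trans (ler_norm _) _.
    by rewrite normrM normrN (gtr0_norm l0) ler_piMl.
  have k1 : E0 * pair_sq x y ^+ 2 <= K1 * pair_sq x y ^+ 2.
    by rewrite ler_wpM2r ?sqr_ge0// /K1 lerDr; nneg.
  have h7 := sq0 x y.
  have k2 : 0 <= K1 * (A * l * pair_sq x y + BB * l ^+ 2) by nneg.
  have k3 := mulr_ge0 E00 (sqr_ge0 (pair_sq x y - 1)).
  have k4 := mulr_ge0 E00 (sqr_ge0 (pair_sq x y)).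
  have k5 := mulr_ge0 E00 (sq0 x y).
  rewrite /P /E; move: hp hl2 k1 k2 k3 k4 k5 (ltW ep0); move: (pair_sq x y) => z.
  by clear; lra.
have sP x y : f1 x + g1 y +
     nu * \sum_i (P (x + h *: d i) (y + h *: e i) + P (x - h *: d i) (y - h *: e i)) <=
     P x y * (1 + 2 * #|I|%:R * nu).
  have far : r ^+ 2 <= pair_sq x y -> f1 x + g1 y <= p x y + 2 * ep + K1 * pair_sq x y ^+ 2.
    move=> rz; have := f1M x; have := g1M y; have := pE x y.
    rewrite !ler_norml => /andP[b1 _] /andP[_ b2] /andP[_ b3].
    have z1 : 1 <= 1 / r ^+ 2 * pair_sq x y.
      by rewrite mulrC mulrA mulr1 ler_pdivlMr ?exprn_gt0// mul1r.
    have z2 : 1 <= 1 / r ^+ 4 * pair_sq x y ^+ 2.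
      have -> : 1 / r ^+ 4 * pair_sq x y ^+ 2 = (1 / r ^+ 2 * pair_sq x y) ^+ 2.
        by field; rewrite gt_eqF.
      by rewrite exprn_ege1.
    have z3 : pair_sq x y <= 1 / r ^+ 2 * pair_sq x y ^+ 2.
      by rewrite expr2 mulrA ler_peMl// sq0.
    have a1 := ler_wpM2l M0 z2; have a2 := ler_wpM2l E00 z2; have a3 := ler_wpM2l E00 z3.
    have a4 := mulr_ge0 E00 (sqr_ge0 (pair_sq x y)).
    have a5 := mulr_ge0 K00 (sqr_ge0 (pair_sq x y)).
    have -> : K1 * pair_sq x y ^+ 2 = K0 * pair_sq x y ^+ 2 +
      2 * (M * (1 / r ^+ 4 * pair_sq x y ^+ 2)) + E0 * (1 / r ^+ 4 * pair_sq x y ^+ 2) +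
      E0 * (1 / r ^+ 2 * pair_sq x y ^+ 2) + E0 * pair_sq x y ^+ 2.
      by rewrite /K1; field; rewrite gt_eqF.
    by move: b1 b2 b3 a1 a2 a3 a4 a5 (ltW ep0); clear; lra.
  have lap : \sum_i (P (x + h *: d i) (y + h *: e i) + P (x - h *: d i) (y - h *: e i) - 2 * P x y) <=
      h ^+ 2 * (ell + K1 * (12 * pair_sq x y * S + 2 * h ^+ 2 * S2 + 2 * A * l * S)).
    have -> : \sum_i (P (x + h *: d i) (y + h *: e i) + P (x - h *: d i) (y - h *: e i) - 2 * P x y) =
        h ^+ 2 * ell + K1 * (\sum_i (pair_sq (x + h *: d i) (y + h *: e i) ^+ 2 +
          pair_sq (x - h *: d i) (y - h *: e i) ^+ 2 - 2 * pair_sq x y ^+ 2) +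
        A * l * \sum_i (pair_sq (x + h *: d i) (y + h *: e i) +
          pair_sq (x - h *: d i) (y - h *: e i) - 2 * pair_sq x y)).
      rewrite !mulr_sumr -big_split mulr_sumr -big_split; apply: eq_bigr => i _ /=.
      have -> : qf B (d i - e i) = (qf B (x + h *: d i - (y + h *: e i)) +
          qf B (x - h *: d i - (y - h *: e i)) - 2 * qf B (x - y)) / (2 * h ^+ 2).
        have -> : x + h *: d i - (y + h *: e i) = x - y + h *: (d i - e i).
          by apply/rowP => j; rewrite !mxE; ring.
        have -> : x - h *: d i - (y - h *: e i) = x - y - h *: (d i - e i).
          by apply/rowP => j; rewrite !mxE; ring.
        by rewrite qf_parallelogram qfZ; field; rewrite gt_eqF.
      rewrite /P /p !(innerBr, innerDr, innerNr); field.
      by rewrite gt_eqF.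
    rewrite [leRHS]mulrDr lerD2l [leRHS]mulrCA ler_wpM2l// (coupled_sq_lap d e h).
    by have := coupled_quartic_lap d e h x y; rewrite -/S -/S2; clear; lra.
  have step : f1 x + g1 y + l * (ell + K1 * (12 * pair_sq x y * S + 2 * h ^+ 2 * S2 + 2 * A * l * S)) <= P x y.
    have F1 : f1 x + g1 y <= p x y + 2 * ep + K1 * pair_sq x y ^+ 2.
      have z0 := sq0 x y; have := pE x y; rewrite ler_norml => /andP[hp _].
      have e2 : 0 <= E0 * (1 / r ^+ 4 + 1 / r ^+ 2) + E0 by nneg.
      have e3 : 0 <= 2 * M / r ^+ 4 by nneg.
      have [xr|rx] := leP (enorm x) r; have [yr|ry] := leP (enorm y) r; first last.
      - by apply: far; rewrite /pair_sq ler_wpDr ?sqr_ge0// lerXn// ltW.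
      - by apply: far; rewrite /pair_sq ler_wpDr ?sqr_ge0// lerXn// ltW.
      - by apply: far; rewrite /pair_sq ler_wpDl ?sqr_ge0// lerXn// ltW.
      have := fg x y xr yr; have := f1f x xr; have := g1g y yr.
      rewrite -/(p x y) !ler_norml => /andP[_ i1] /andP[_ i2] i3.
      have q4 : K0 * (enorm x ^+ 4 + enorm y ^+ 4) <= K1 * pair_sq x y ^+ 2.
        apply: ler_pM => //; first by nneg.
          by rewrite /K1 -!addrA lerDl; move: e2 e3; clear; lra.
        rewrite /pair_sq; have := mulr_ge0 (sqr_ge0 (enorm x)) (sqr_ge0 (enorm y)).
        by clear; lra.
      by move: i1 i2 i3 q4; clear; lra.
    have z0 := sq0 x y.
    have j1 := ler_wpM2r S20 hl; have j2 := ler_wpM2l K10 (ler_wpM2l (ltW l0) j1).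
    by rewrite /P /BB /A; move: F1 j2; clear; lra.
  have := ler_wpM2l nu0 lap; rewrite mulrA nuh sumrB sumr_const -[(2 * P x y) *+ _]mulr_natr.
  by move: step; move: (\sum_i _) => s; clear; lra.
have super_le (w : R) z1 z2 : `|z1 - z2| <= ep -> z1 <= w -> z2 - ep <= w.
  by rewrite ler_norml; clear => /andP[? ?] ?; lra.
have [k kE] : exists k, (2 * #|I|%:R * nu / (1 + 2 * #|I|%:R * nu)) ^+ k * E <= l * kap / 8.
  have q0 : 0 < 1 + 2 * #|I|%:R * nu by rewrite ltr_pwDl//; nneg.
  apply: small_geometric; first by nneg.
    by rewrite ltr_pdivrMr// mul1r ltrDr.
  by rewrite divr_gt0// mulr_gt0.
have := resolvent_iter_coupled nu0 E_0 sP PE k 0 0.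
have := resf l ep h Cf (resolvent_iter nu h M d f1 k) l0 l1 (ltW ep0) h0 Cf0 hd
  (resolvent_iter_taylor h M d nu0 Cf0 tf1 k) (resolvent_iter_bound h d nu0 M0 f1M k).
have := resg l ep h Cg (resolvent_iter nu h M e g1 k) l0 l1 (ltW ep0) h0 Cg0 he
  (resolvent_iter_taylor h M e nu0 Cg0 tg1 k) (resolvent_iter_bound h e nu0 M0 g1M k).
move=> rg rf coup.
have {}rg := rg (fun x xr => super_le _ _ _ (g1g x xr) (resolvent_iter_super e nu0 M0 g1M h0 (erefl nu) k x)).
have {}rf := rf (fun x xr => super_le _ _ _ (f1f x xr) (resolvent_iter_super d nu0 M0 f1M h0 (erefl nu) k x)).
(* At the origin [p] equals [f 0 + g 0]. Adding the three inequalities leaves [l kap] below four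
   errors of at most [l kap / 8] each: the [l^2] terms, [4 ep], the finite differences and the
   iteration. *)
move: coup; rewrite /P /p /pair_sq subrr inner0r qf0r enorm0 !expr0n /= => coup.
have lT := ler_wpM2l (ltW l0) hT; have lKl := ler_wpM2l (ltW l0) lK.
have lk0 : 0 < l * kap by rewrite mulr_gt0.
move: lk0 lT lKl coup rg rf kE; rewrite /T /Kt /ep /kap.
by clear; lra.
Qed.

(** * Test functions and contact *)

Section SmoothFunctions.
Context {R : realType} {n : nat}.
Local Notation pt := ('rV[R]_n * R)%type.
Implicit Types (z v : pt) (f g : pt -> R).

(** An affine function of a single coordinate, with [None] standing for time. *)
Definition affine_fun f : Prop :=
  exists (i : option 'I_n) (a b : R), f = fun z => a * (if i is Some j then z.1 0 j else z.2) + b.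

(** A concrete algebra closed under directional derivatives, so that [class_C k] follows by
    induction on [k]. Sines and cosines are there for the saturated coordinates of
    [quadratic_test]. *)
Inductive smooth : (pt -> R) -> Prop :=
| smooth_affine f : affine_fun f -> smooth f
| smooth_sin f : affine_fun f -> smooth (fun z => sin (f z))
| smooth_cos f : affine_fun f -> smooth (fun z => cos (f z))
| smoothD f g : smooth f -> smooth g -> smooth (fun z => f z + g z)
| smoothM f g : smooth f -> smooth g -> smooth (fun z => f z * g z).

Lemma is_derive_affine (i : option 'I_n) (a b : R) z v :
  is_derive z v (fun z : pt => a * (if i is Some j then z.1 0 j else z.2) + b)
    (a * (if i is Some j then v.1 0 j else v.2)).
Proof.
set l := fun z : pt => if i is Some j then z.1 0 j else z.2.
have E (h : R) : h != 0 -> h^-1 *: ((fun z => a * l z + b) (h *: v + z) - (a * l z + b)) = a * l v.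
  move=> h0; rewrite /l /GRing.scale/=; clear l.
  by case: i => [j|] /=; rewrite ?mxE /GRing.scale/=; field.
have C : (fun h : R => h^-1 *: ((fun z => a * l z + b) (h *: v + z) - (a * l z + b))) @ 0^' --> a * l v.
  apply: cvg_near_cst; near=> h; apply: E; near: h; exact: nbhs_dnbhs_neq.
by apply: DeriveDef; [apply/cvg_ex; exists (a * l v)|exact: cvg_lim C].
Unshelve. all: by end_near. Qed.

Lemma derive_affine f v : affine_fun f -> exists c, forall z, is_derive z v f c.
Proof.
move=> [i [a [b ->]]]; exists (a * (if i is Some j then v.1 0 j else v.2)) => z.
exact: is_derive_affine.
Qed.

Lemma affine_shift f (h : R) z v c : affine_fun f -> is_derive z v f c ->
  f (h *: v + z) = h * c + f z.
Proof.
move=> [i [a [b ->]]] D.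
have -> : c = a * (if i is Some j then v.1 0 j else v.2).
  by rewrite -(@derive_val _ _ _ _ _ _ _ D) (@derive_val _ _ _ _ _ _ _ (is_derive_affine i a b z v)).
by case: i D => [j|] D /=; rewrite ?mxE /GRing.scale/=; ring.
Qed.

(** Along a line [f] is affine in the parameter, so the difference quotient is that of a function of
    one real variable, to which the ordinary chain rule applies. *)
Lemma is_derive_comp_affine (F : R -> R) f z v c (dF : R) : affine_fun f ->
  is_derive z v f c -> is_derive (f z) (1 : R) F dF ->
  is_derive z v (fun z => F (f z)) (c * dF).
Proof.
move=> af D DF.
have DG : is_derive (0 : R) (1 : R) (fun h => F (h * c + f z)) (c * dF).
  have DF' : is_derive ((fun h : R => h * c + f z) 0) (1 : R) F dF by rewrite mul0r add0r.
  have Dh : is_derive (0 : R) (1 : R) (fun h => h * c + f z) c.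
    by apply: is_derive_eq; rewrite addr0 scaler0 add0r; exact: mulr1.
  rewrite [c * dF]mulrC.
  exact: (@is_derive1_comp R F (fun h => h * c + f z) 0 dF c DF' Dh).
have E : (fun h : R => h^-1 *: (F (f (h *: v + z)) - F (f z))) =
    (fun h : R => h^-1 *: (F ((h *: 1 + 0) * c + f z) - F (0 * c + f z))).
  apply/funext => h; rewrite (affine_shift h af D) mul0r add0r addr0.
  by rewrite /GRing.scale/= mulr1.
case: DG => DG1 DG2; apply: DeriveDef.
  by rewrite /derivable /shift /= E.
by rewrite /derive /shift /= E.
Qed.

Lemma continuous_affine f : affine_fun f -> continuous f.
Proof.
move=> [i [a [b ->]]] z.
apply: cvgD; last exact: cvg_cst.
apply: cvgM; first exact: cvg_cst.
case: i => [j|]; last exact: cvg_snd.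
apply: (@cvg_comp _ _ _ fst (fun M : 'rV[R]_n => M 0 j)); first exact: cvg_fst.
exact: coord_continuous.
Qed.

Lemma smooth_continuous f : smooth f -> continuous f.
Proof.
elim=> {f} [f af|f af|f af|f g _ cf _ cg|f g _ cf _ cg] z.
- exact: continuous_affine.
- apply: (@cvg_comp _ _ _ f sin); first exact: continuous_affine.
  exact: continuous_sin.
- apply: (@cvg_comp _ _ _ f cos); first exact: continuous_affine.
  exact: continuous_cos.
- by apply: cvgD; [exact: cf|exact: cg].
- by apply: cvgM; [exact: cf|exact: cg].
Qed.
Lemma smooth_cst (c : R) : smooth (fun=> c).
Proof.
by apply: smooth_affine; exists None, 0, c; apply/funext => z; rewrite mul0r add0r.
Qed.

Lemma smooth_is_derive f v : smooth f ->
  exists2 df, smooth df & forall z, is_derive z v f (df z).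
Proof.
elim=> {f} [f af|f af|f af|f g _ [df sdf fE] _ [dg sdg gE]|f g sf [df sdf fE] sg [dg sdg gE]].
- by have [c fc] := derive_affine v af; exists (fun=> c) => //; exact: smooth_cst.
- have [c fc] := derive_affine v af; exists (fun z => c * cos (f z)).
    by apply: smoothM; [exact: smooth_cst|exact: smooth_cos].
  by move=> z; exact: is_derive_comp_affine.
- have [c fc] := derive_affine v af; exists (fun z => c * ((-1) * sin (f z))).
    apply: smoothM; [exact: smooth_cst|apply: smoothM; [exact: smooth_cst|exact: smooth_sin]].
  move=> z; rewrite mulN1r; exact: is_derive_comp_affine.
- by exists (fun z => df z + dg z) => [|z]; [exact: smoothD|exact: is_deriveD].
- exists (fun z => f z * dg z + g z * df z) => [|z]; first by apply: smoothD; exact: smoothM.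
  exact: is_deriveM.
Qed.

Lemma smooth_derive f v : smooth f -> smooth ('D_v f).
Proof.
move=> /(smooth_is_derive v)[df sdf fE].
by rewrite (_ : 'D_v f = df)//; apply/funext => z; rewrite (@derive_val _ _ _ _ _ _ _ (fE z)).
Qed.

Lemma smooth_derivable f z v : smooth f -> derivable f z v.
Proof. by move=> /(smooth_is_derive v)[df _ fE]; exact: (@ex_derive _ _ _ _ _ _ _ (fE z)). Qed.

Lemma smooth_class_C k f : smooth f -> class_C k setT f.
Proof.
elim: k f => [|k IH] f sf; split=> //; try by move=> z _; exact: smooth_continuous.
move=> v; split=> [z _|]; first exact: smooth_derivable.
by apply: IH; exact: smooth_derive.
Qed.

Lemma smooth_C2 f : smooth f -> C2_Q1 f.
Proof. by move=> sf; exists setT; split=> //; [exact: openT|exact: smooth_class_C]. Qed.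

Lemma smooth_sum (I : Type) (s : seq I) (F : I -> pt -> R) :
  (forall i, smooth (F i)) -> smooth (fun z => \sum_(i <- s) F i z).
Proof.
move=> sF; elim: s => [|i s IH].
  by under eq_fun do rewrite big_nil; exact: smooth_cst.
by under eq_fun do rewrite big_cons; exact: smoothD.
Qed.

Lemma smoothX f k : smooth f -> smooth (fun z => f z ^+ k).
Proof.
move=> sf; elim: k => [|k IH]; first by under eq_fun do rewrite expr0; exact: smooth_cst.
by under eq_fun do rewrite exprS; exact: smoothM.
Qed.

Lemma smoothN f : smooth f -> smooth (fun z => - f z).
Proof.
move=> sf; rewrite (_ : (fun z => _) = (fun z => (-1) * f z)).
  by apply: smoothM => //; exact: smooth_cst.
by apply/funext => z; rewrite mulN1r.
Qed.

Lemma smooth_coord (i : 'I_n) (c : R) : smooth (fun z => z.1 0 i - c).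
Proof.
by apply: smooth_affine; exists (Some i), 1, (- c); apply/funext => z; rewrite mul1r.
Qed.

Lemma smooth_time (c : R) : smooth (fun z => z.2 - c).
Proof.
by apply: smooth_affine; exists None, 1, (- c); apply/funext => z; rewrite mul1r.
Qed.

Lemma derive_coord (i : 'I_n) (c : R) z v : 'D_v (fun z : pt => z.1 0 i - c) z = v.1 0 i.
Proof.
have := is_derive_affine (Some i) 1 (- c) z v; under eq_fun do rewrite mul1r.
by rewrite mul1r => D; rewrite (@derive_val _ _ _ _ _ _ _ D).
Qed.

Lemma derive_time (c : R) z v : 'D_v (fun z : pt => z.2 - c) z = v.2.
Proof.
have := is_derive_affine None 1 (- c) z v; under eq_fun do rewrite mul1r.
by rewrite mul1r => D; rewrite (@derive_val _ _ _ _ _ _ _ D).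
Qed.

Lemma derive_smoothD f g z v : smooth f -> smooth g ->
  'D_v (fun z => f z + g z) z = 'D_v f z + 'D_v g z.
Proof. by move=> sf sg; rewrite -deriveD//; exact: smooth_derivable. Qed.

Lemma derive_smoothM f g z v : smooth f -> smooth g ->
  'D_v (fun z => f z * g z) z = f z * 'D_v g z + g z * 'D_v f z.
Proof.
move=> sf sg; have := @deriveM _ _ f g z v (smooth_derivable sf) (smooth_derivable sg).
by move=> <-.
Qed.

Lemma derive_smoothN f z v : smooth f -> 'D_v (fun z => - f z) z = - 'D_v f z.
Proof. by move=> sf; rewrite -deriveN//; exact: smooth_derivable. Qed.

Lemma derive_smoothZ (c : R) f z v : smooth f -> 'D_v (fun z => c * f z) z = c * 'D_v f z.
Proof.
move=> sf; rewrite derive_smoothM//; last exact: smooth_cst.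
by rewrite (derive_cst c) mulr0 addr0.
Qed.

Lemma derive_smooth_sum (I : Type) (s : seq I) (F : I -> pt -> R) z v :
  (forall i, smooth (F i)) ->
  'D_v (fun z => \sum_(i <- s) F i z) z = \sum_(i <- s) 'D_v (F i) z.
Proof.
move=> sF; elim: s => [|i s IH].
  by under eq_fun do rewrite big_nil; rewrite big_nil derive_cst.
under eq_fun do rewrite big_cons.
by rewrite big_cons derive_smoothD ?IH//; exact: smooth_sum.
Qed.

Lemma derive_smoothX f k z v : smooth f ->
  'D_v (fun z => f z ^+ k) z = k%:R * f z ^+ k.-1 * 'D_v f z.
Proof.
move=> sf; case: k => [|k].
  by under eq_fun do rewrite expr0; rewrite derive_cst !mul0r.
elim: k => [|k IH]; first by under eq_fun do rewrite expr1; rewrite expr0 !mul1r.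
under eq_fun do rewrite exprS.
rewrite derive_smoothM ?IH//; last exact: smoothX.
by rewrite /= -[k.+2]addn1 natrD exprS; ring.
Qed.

(** For [rho > 0] this agrees with the coordinate minus [c] to second order at [c], and it is
    bounded by [rho] everywhere. *)
Definition sat (rho : R) (i : option 'I_n) (c : R) (z : pt) : R :=
  rho * sin (rho^-1 * ((if i is Some j then z.1 0 j else z.2) - c)).

Lemma affine_scaled (rho : R) (i : option 'I_n) (c : R) :
  affine_fun (fun z => rho^-1 * ((if i is Some j then z.1 0 j else z.2) - c)).
Proof. by exists i, rho^-1, (- (rho^-1 * c)); apply/funext => z; rewrite mulrBr. Qed.

Lemma smooth_sat (rho : R) i (c : R) : smooth (sat rho i c).
Proof. by apply: smoothM; [exact: smooth_cst|apply: smooth_sin; exact: affine_scaled]. Qed.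

Lemma derive_sat (rho : R) i (c : R) z v : rho != 0 -> 'D_v (sat rho i c) z =
  (if i is Some j then v.1 0 j else v.2) * cos (rho^-1 * ((if i is Some j then z.1 0 j else z.2) - c)).
Proof.
move=> rho0; rewrite /sat derive_smoothZ; last by apply: smooth_sin; exact: affine_scaled.
set f := fun z : pt => rho^-1 * ((if i is Some j then z.1 0 j else z.2) - c).
have D : is_derive z v f (rho^-1 * (if i is Some j then v.1 0 j else v.2)).
  rewrite (_ : f = fun z : pt => rho^-1 * (if i is Some j then z.1 0 j else z.2) + - (rho^-1 * c)).
    exact: is_derive_affine.
  by apply/funext => y; rewrite /f mulrBr.
have D2 := is_derive_comp_affine (affine_scaled rho i c) D (is_derive_sin (f z)).
rewrite (@derive_val _ _ _ _ _ _ _ D2) -/(f z).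
by rewrite !mulrA divff// mul1r.
Qed.

End SmoothFunctions.

Section Operator.
Context {R : realType} {n : nat}.
Local Notation pt := ('rV[R]_n * R)%type.
Implicit Types (z : pt) (xi : 'rV[R]_n) (X : 'M[R]_n).

Definition speed (q s al : R) xi : R := enorm xi `^ q + al * enorm xi `^ s.

Definition acoef (p q s al : R) xi (i j : 'I_n) : R :=
  speed q s al xi * ((i == j)%:R + (p - 2) * (xi 0 i * xi 0 j) / enorm xi ^+ 2).

Definition oper (p q s al : R) xi X : R := \sum_i \sum_j acoef p q s al xi i j * X i j.

(** The diffusion becomes a contraction of the Hessian with [acoef], linear in the Hessian.
    Continuity and freezing then concern the coefficients alone. *)
Lemma residualE p q s (a w : pt -> R) z :
  residual p q s a w z = dt w z - oper p q s (a z) (grad w z) (hess w z).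
Proof.
rewrite /residual /normalized_p_laplacian /laplacian; congr (_ - _).
move: (grad w z) (hess w z) => xi H.
rewrite /oper; have -> : \sum_i \sum_j acoef p q s (a z) xi i j * H i j =
  speed q s (a z) xi * (\sum_i \sum_j ((i == j)%:R + (p - 2) * (xi 0 i * xi 0 j) / enorm xi ^+ 2) * H i j).
  rewrite mulr_sumr; apply: eq_bigr => i _; rewrite mulr_sumr; apply: eq_bigr => j _.
  by rewrite /acoef -(mulrA (speed _ _ _ _)).
congr (_ * _); rewrite /mxtrace /inner [X in _ + X]mulr_sumr -big_split; apply: eq_bigr => i _ /=.
have -> : \sum_(j < n) ((i == j)%:R + (p - 2) * (xi 0 i * xi 0 j) / enorm xi ^+ 2) * H i j =
  \sum_(j < n) (i == j)%:R * H i j + \sum_(j < n) (p - 2) * (xi 0 i * xi 0 j) / enorm xi ^+ 2 * H i j.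
  by rewrite -big_split; apply: eq_bigr => j _ /=; rewrite -mulrDl.
rewrite [X in _ = X + _](bigD1 i)//= eqxx mul1r [X in _ = _ + X + _]big1 ?addr0; last first.
  by move=> j ji; rewrite eq_sym (negbTE ji) mul0r.
congr (_ + _); rewrite !mxE mulr_suml mulr_sumr; apply: eq_bigr => j _.
by rewrite !mxE expr2 invfM; ring.
Qed.

Lemma operD p q s al xi X Y : oper p q s al xi (X + Y) = oper p q s al xi X + oper p q s al xi Y.
Proof.
rewrite /oper -big_split; apply: eq_bigr => i _; rewrite -big_split; apply: eq_bigr => j _ /=.
by rewrite mxE mulrDr.
Qed.

Lemma operZ p q s al xi (c : R) X : oper p q s al xi (c *: X) = c * oper p q s al xi X.
Proof.
rewrite /oper mulr_sumr; apply: eq_bigr => i _; rewrite mulr_sumr; apply: eq_bigr => j _ /=.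
by rewrite mxE mulrCA.
Qed.

Lemma acoefC p q s al xi i j : acoef p q s al xi i j = acoef p q s al xi j i.
Proof. by rewrite /acoef eq_sym (mulrC (xi 0 i)). Qed.

Lemma oper_tr p q s al xi X : oper p q s al xi X^T = oper p q s al xi X.
Proof.
rewrite /oper exchange_big; apply: eq_bigr => i _; apply: eq_bigr => j _.
by rewrite mxE acoefC.
Qed.

Lemma powR_continuous (r x : R) : 0 < x -> {for x, continuous (fun y : R => y `^ r)}.
Proof.
move=> x0; apply: differentiable_continuous; apply/derivable1_diffP.
by apply: derivable_powR; rewrite in_itv/= x0.
Qed.

Lemma cvg_bigsum (T I : Type) (F : set_system T) (FF : Filter F) (r : seq I) (f : I -> T -> R) (l : I -> R) :
  (forall i, f i t @[t --> F] --> l i) -> \sum_(i <- r) f i t @[t --> F] --> \sum_(i <- r) l i.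
Proof.
move=> fl; elim: r => [|i r IH].
  by under eq_fun do rewrite big_nil; rewrite big_nil; exact: cvg_cst.
under eq_fun do rewrite big_cons; rewrite big_cons.
by apply: cvgD; [exact: fl|exact: IH].
Qed.

Section OperCvg.
Context (T : Type) (F : set_system T) (FF : Filter F).
Variables (al : T -> R) (X : T -> 'rV[R]_n) (H : T -> 'M[R]_n) (al0 : R) (xi : 'rV[R]_n) (H0 : 'M[R]_n).
Hypotheses (xi0 : xi != 0) (alF : al t @[t --> F] --> al0).
Hypothesis XF : forall i, X t 0 i @[t --> F] --> xi 0 i.

Lemma enorm_cvg : enorm (X t) @[t --> F] --> enorm xi.
Proof.
apply: (@cvg_comp _ _ _ (fun t => inner (X t) (X t)) Num.sqrt _ (nbhs (inner xi xi))).
  by apply: cvg_bigsum => i; exact: cvgM.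
exact: sqrt_continuous.
Qed.

Lemma acoef_cvg p q s i j : acoef p q s (al t) (X t) i j @[t --> F] --> acoef p q s al0 xi i j.
Proof.
have e0 : 0 < enorm xi by rewrite enorm_gt0.
have pw (r : R) : enorm (X t) `^ r @[t --> F] --> enorm xi `^ r.
  apply: (@cvg_comp _ _ _ (fun t => enorm (X t)) (fun y => y `^ r)); first exact: enorm_cvg.
  exact: powR_continuous.
apply: cvgM; first by apply: cvgD => //; apply: cvgM.
apply: cvgD; first exact: cvg_cst.
apply: cvgM; first by apply: cvgM; [exact: cvg_cst|exact: cvgM].
apply: cvgV; first by rewrite expf_neq0// gt_eqF.
by apply: cvgM; exact: enorm_cvg.
Qed.

Hypothesis HF : forall i j, H t i j @[t --> F] --> H0 i j.

Lemma oper_cvg p q s : oper p q s (al t) (X t) (H t) @[t --> F] --> oper p q s al0 xi H0.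
Proof.
apply: cvg_bigsum => i; apply: cvg_bigsum => j.
by apply: cvgM => //; exact: acoef_cvg.
Qed.

End OperCvg.

End Operator.

Section Contact.
Context {R : realType} {n : nat}.
Local Notation pt := ('rV[R]_n * R)%type.

Lemma nbhs_ptP (z0 : pt) (P : set pt) : nbhs z0 P <->
  exists2 r : R, 0 < r & forall z, enorm (z.1 - z0.1) < r -> `|z.2 - z0.2| < r -> P z.
Proof.
split=> [[[A B] /= [/nbhs_enormP[r1 r10 A1] /nbhs_ballP[r2 /= r20 B2]] AB]|[r r0 rP]].
  exists (Num.min r1 r2); first by rewrite lt_min r10.
  move=> z; rewrite !lt_min => /andP[h1 _] /andP[_ h2]; apply: AB; split=> /=; first exact: A1.
  by apply: B2; rewrite -ball_normE /= distrC.
exists ([set x | enorm (x - z0.1) < r], [set t | `|t - z0.2| < r]) => /=.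
  split; first by apply/nbhs_enormP; exists r.
  by apply/nbhs_ballP; exists r => // t; rewrite -ball_normE /= distrC.
by move=> z [/= h1 h2]; exact: rP.
Qed.

Definition sub_contact (A : set pt) (w : pt -> R) (z0 : pt) (phi : pt -> R) : Prop :=
  exists2 r : R, 0 < r & forall z, A z -> Q1 R n z ->
    enorm (z.1 - z0.1) < r -> `|z.2 - z0.2| < r -> w z - phi z <= w z0 - phi z0.

(* The subsolution property for smooth test functions of a function with finite values
   [w] on [A] and [-oo] elsewhere; [0 < e] bounding the residual from below near [z0]
   is the negation of [liminf <= 0]. *)
Definition sub_visc (p q s : R) (a : pt -> R) (A : set pt) (w : pt -> R) : Prop :=
  forall z0 phi e, Q1 R n z0 -> A z0 -> smooth phi ->
    (forall z, Q1 R n z -> z.1 != z0.1 -> grad phi z != 0) ->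
    sub_contact A w z0 phi -> 0 < e ->
    ~ (\forall z \near approach z0, e <= residual p q s a phi z).

End Contact.

Section DegenerateContact.
Context {R : realType} {n : nat}.
Local Notation pt := ('rV[R]_n * R)%type.
Variables (b : nat) (C tau C' : R) (z0 : pt).

Let sqd (z : pt) : R := \sum_(i < n) (z.1 0 i - z0.1 0 i) ^+ 2.

Definition radial_test (z : pt) : R :=
  C * enorm (z.1 - z0.1) ^+ (2 * b) + tau * (z.2 - z0.2) + C' * (z.2 - z0.2) ^+ 2.

Lemma sqdE z : sqd z = enorm (z.1 - z0.1) ^+ 2.
Proof. by rewrite enorm_sq; apply: eq_bigr => i _; rewrite !mxE expr2. Qed.

Lemma radial_testE : radial_test =
  (fun z => C * sqd z ^+ b + tau * (z.2 - z0.2) + C' * (z.2 - z0.2) ^+ 2).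
Proof. by apply/funext => z; rewrite /radial_test sqdE exprM. Qed.

Lemma smooth_sqd : smooth sqd.
Proof. by apply: smooth_sum => i; apply: smoothX; exact: smooth_coord. Qed.

Lemma smooth_radial_test : smooth radial_test.
Proof.
rewrite radial_testE; apply: smoothD; first apply: smoothD.
- by apply: smoothM; [exact: smooth_cst|apply: smoothX; exact: smooth_sqd].
- by apply: smoothM; [exact: smooth_cst|exact: smooth_time].
- by apply: smoothM; [exact: smooth_cst|apply: smoothX; exact: smooth_time].
Qed.

Lemma derive_sqd z v : 'D_v sqd z = 2 * inner (z.1 - z0.1) v.1.
Proof.
rewrite derive_smooth_sum; last by move=> i; apply: smoothX; exact: smooth_coord.
rewrite /inner mulr_sumr; apply: eq_bigr => i _.
by rewrite derive_smoothX ?derive_coord ?expr1 ?mxE ?mulrA//; exact: smooth_coord.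
Qed.

Lemma derive_radial_test z v : 'D_v radial_test z =
  C * (b%:R * sqd z ^+ b.-1 * (2 * inner (z.1 - z0.1) v.1)) + tau * v.2 +
  C' * (2 * (z.2 - z0.2) * v.2).
Proof.
have st : smooth (fun z : pt => z.2 - z0.2) by exact: smooth_time.
have sq := smooth_sqd.
have s2 := smoothX 2 st; have sb := smoothX b sq.
have s3 := smoothM (smooth_cst C) sb; have s4 := smoothM (smooth_cst tau) st.
rewrite radial_testE (derive_smoothD _ _ (smoothD s3 s4) (smoothM (smooth_cst C') s2)).
rewrite (derive_smoothD _ _ s3 s4) !derive_smoothZ// !derive_smoothX// derive_sqd derive_time.
by rewrite expr1.
Qed.

Lemma inner_delta (y : 'rV[R]_n) i : inner y (delta_mx 0 i) = y 0 i.
Proof.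
rewrite /inner (bigD1 i)//= big1 ?addr0; first by rewrite mxE !eqxx mulr1.
by move=> j ji; rewrite mxE (negbTE ji) andbF mulr0.
Qed.

Lemma grad_radial_test z :
  grad radial_test z = (2 * b%:R * C * enorm (z.1 - z0.1) ^+ (2 * b.-1)) *: (z.1 - z0.1).
Proof.
apply/rowP => i; rewrite !mxE derive_radial_test /= inner_delta sqdE -exprM !mxE.
by rewrite !mulr0 !addr0; ring.
Qed.

Lemma dt_radial_test z : dt radial_test z = tau + 2 * C' * (z.2 - z0.2).
Proof. by rewrite /dt derive_radial_test /= inner0r !mulr0 add0r !mulr1; ring. Qed.

Lemma hess_radial_test z i j : hess radial_test z i j = 2 * b%:R * C *
  (enorm (z.1 - z0.1) ^+ (2 * b.-1) * (i == j)%:R +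
   2 * b.-1%:R * enorm (z.1 - z0.1) ^+ (2 * b.-2) * ((z.1 - z0.1) 0 i * (z.1 - z0.1) 0 j)).
Proof.
rewrite mxE (_ : 'D_(dir_x j) radial_test = fun z => (2 * b%:R * C) * (sqd z ^+ b.-1 * (z.1 0 j - z0.1 0 j))); last first.
  apply/funext => y; rewrite derive_radial_test /= inner_delta !mxE !mulr0 !addr0; ring.
have sb := smoothX b.-1 smooth_sqd.
have sc : smooth (fun z : pt => z.1 0 j - z0.1 0 j) by exact: smooth_coord.
rewrite (derive_smoothZ _ _ _ (smoothM sb sc)) (derive_smoothM _ _ sb sc) derive_coord.
rewrite (derive_smoothX _ _ _ smooth_sqd) derive_sqd /= inner_delta sqdE -!exprM !mxE eqxx /=.
by rewrite eq_sym; ring.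
Qed.

End DegenerateContact.

Lemma powR_expn {R : realType} (r t : R) (k : nat) : 0 < r -> (r ^+ k) `^ t = r `^ (k%:R * t).
Proof. by move=> r0; rewrite powRrM powR_mulrn// ltW. Qed.

Lemma norm_oper_le {R : realType} {n : nat} (p q s al c : R) (xi y : 'rV[R]_n) (X : 'M[R]_n) :
  0 <= al -> (forall i j, `|X i j| <= c) ->
  `|oper p q s al xi X| <= n%:R ^+ 2 * (speed q s al xi * (1 + `|p - 2|) * c).
Proof.
move=> al0 Xc.
have sp0 : 0 <= speed q s al xi by rewrite /speed; nneg.
have -> : n%:R ^+ 2 * (speed q s al xi * (1 + `|p - 2|) * c) =
    \sum_(i < n) \sum_(j < n) (speed q s al xi * (1 + `|p - 2|) * c).
  by rewrite !sumr_const card_ord -mulrnA -[RHS]mulr_natr natrM; ring.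
apply: le_trans (ler_norm_sum _ _ _) _; apply: ler_sum => i _.
apply: le_trans (ler_norm_sum _ _ _) _; apply: ler_sum => j _.
rewrite normrM ler_pM// /acoef normrM (ger0_norm sp0) ler_wpM2l//.
apply: le_trans (ler_normD _ _) _; apply: lerD.
  by case: (i == j); rewrite ?normr1 ?normr0.
rewrite -mulrA normrM -[leRHS]mulr1 ler_wpM2l//.
have [->|x0] := eqVneq xi 0; first by rewrite !mxE !mul0r normr0.
have e0 : 0 < enorm xi by rewrite enorm_gt0.
rewrite normrM normfV normrM (ger0_norm (exprn_ge0 2 (enorm_ge0 xi))).
rewrite ler_pdivrMr ?exprn_gt0// mul1r expr2.
by rewrite ler_pM ?norm_coord_le.
Qed.

(* At a point where the test function is [C |x - x0|^(2b) + ...] with [b] large, the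
   diffusion term vanishes in the limit even in the singular range [q < 0]. *)
Lemma degenerate_contact {R : realType} {n : nat} (p q s : R) (a : 'rV[R]_n * R -> R) (am : R)
    (A : set ('rV[R]_n * R)) (w : 'rV[R]_n * R -> R) (b : nat) (C tau C' : R) z0 :
  q <= s -> (2 <= b)%N -> 1 < (2 * b%:R - 1) * (q + 1) -> 0 < C ->
  (forall z, Q1 R n z -> 0 <= a z <= am) ->
  sub_visc p q s a A w -> Q1 R n z0 -> A z0 ->
  sub_contact A w z0 (radial_test b C tau C' z0) -> tau <= 0.
Proof.
move=> qs b2 bq C0 aam sv Qz0 Az0 ct; rewrite leNgt; apply/negP => tau0.
have am0 : 0 <= am by have /andP[h1 h2] := aam _ Qz0; exact: le_trans h2.
have b0 : 0 < b%:R :> R by rewrite ltr0n (leq_trans _ b2).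
have mS : (2 * b - 1 = (2 * b.-1).+1)%N by case: (b) b2 => // k _; clear; lia.
have m2 : (2 * b.-1 = 2 * b.-2 + 2)%N by case: (b) b2 => [//|[//|k]] _ /=; clear; lia.
have tau2 : 0 < tau / 2 by rewrite divr_gt0.
apply: (sv z0 _ (tau / 2) Qz0 Az0 (smooth_radial_test b C tau C' z0) _ ct tau2).
  move=> z _ zx; rewrite grad_radial_test scaler_eq0 subr_eq0 negb_or zx andbT.
  by rewrite !mulf_neq0 ?gt_eqF ?exprn_gt0// enorm_gt0 subr_eq0.
pose K := 2 * b%:R * C; have K0 : 0 < K by rewrite !mulr_gt0.
have KE : 2 * b%:R * C = K by []; clearbody K.
pose m := (2 * b - 1)%N.
have mE : m%:R = 2 * b%:R - 1 :> R.
  by rewrite natrB ?natrM// muln_gt0 (leq_trans _ b2).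
(* The gradient has order [r^m] with [m = 2b - 1] and the Hessian order [r^(m - 1)], so the [q]-part
   of the diffusion has order [r^th]. The [s]-part is no larger for [r <= 1] because [q <= s], and
   the hypothesis on [b] says exactly that [th > 0]. *)
pose th := m%:R * q + (m%:R - 1).
have th0 : 0 < th by move: bq; rewrite /th mE; lra.
pose K1 := n%:R ^+ 2 * ((K `^ q + am * K `^ s) * (1 + `|p - 2|) * (K * (1 + 2 * b.-1%:R))).
have K10 : 0 <= K1.
  by rewrite /K1; nneg.
have [d1 d10 d1P] : exists2 d : R, 0 < d & forall r, 0 < r -> r < d -> K1 * r `^ th <= tau / 4.
  have := @powR_cvg0 R th th0; move=> /cvgrPdist_lt /(_ (tau / (4 * (K1 + 1)))).
  case; first by rewrite divr_gt0// mulr_gt0// ltr_wpDl.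
  move=> d /= d0 dP; exists d => // r r0 rd.
  have := dP r; rewrite /= sub0r normrN gtr0_norm// => /(_ rd r0).
  rewrite sub0r normrN ger0_norm ?powR_ge0// ltr_pdivlMr ?mulr_gt0 ?ltr_wpDl// => h.
  by have := powR_ge0 r th; lra.
pose d2 := tau / (8 * (`|C'| + 1)).
have d20 : 0 < d2 by rewrite divr_gt0// mulr_gt0// ltr_wpDl.
rewrite /approach; apply/nbhs_ptP; exists (Num.min 1 (Num.min d1 d2)).
  by rewrite !lt_min ltr01 d10.
move=> z; rewrite !lt_min => /and3P[r1 rd1 _] /and3P[_ _ td2] [Qz zx].
set r := enorm (z.1 - z0.1) in r1 rd1 *.
have r0 : 0 < r by rewrite enorm_gt0 subr_eq0.
rewrite residualE dt_radial_test.
have /andP[az0 azm] := aam _ Qz.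
set G := grad _ z; set H := hess _ z.
have Ge : enorm G = K * r ^+ m.
  rewrite /G grad_radial_test -/r enormZ -/r ger0_norm; last first.
    by nneg.
  have -> : m = (2 * b.-1).+1 by exact: mS.
  by rewrite exprSr KE mulrA.
have Hb i j : `|H i j| <= K * (1 + 2 * b.-1%:R) * r ^+ (m - 1)%N.
  have m1 : (m - 1 = 2 * b.-1)%N by rewrite /m mS subn1.
  rewrite /H hess_radial_test KE -/r m1 normrM (gtr0_norm K0) -[leRHS]mulrA ler_wpM2l ?(ltW K0)//.
  apply: le_trans (ler_normD _ _) _; rewrite [leRHS]mulrDl mul1r; apply: lerD.
    rewrite normrM (ger0_norm (exprn_ge0 _ (ltW r0))) ler_piMr ?exprn_ge0 ?(ltW r0)//.
    by case: (i == j); rewrite ?normr1 ?normr0.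
  have c0 : 0 <= 2 * b.-1%:R * r ^+ (2 * b.-2) by nneg.
  rewrite [in leRHS]m2 exprD normrM (ger0_norm c0) [leRHS]mulrA ler_wpM2l// normrM expr2.
  by rewrite ler_pM ?norm_coord_le.
have := norm_oper_le p q s G G az0 Hb.
have spd : speed q s (a z) G * r ^+ (m - 1)%N <= (K `^ q + am * K `^ s) * r `^ th.
  have rm : r ^+ (m - 1)%N = r `^ (m%:R - 1).
    by rewrite -powR_mulrn ?(ltW r0)// natrB// /m mS.
  have pw (t : R) : (K * r ^+ m) `^ t * r ^+ (m - 1)%N = K `^ t * r `^ (m%:R * t + (m%:R - 1)).
    rewrite powRM ?(ltW K0) ?exprn_ge0 ?(ltW r0)// powR_expn// -mulrA rm -powRD//.
    by rewrite (gt_eqF r0) implybT.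
  rewrite /speed Ge mulrDl -(mulrA (a z)) !pw mulrDl; apply: lerD; first by [].
  rewrite -mulrA ler_pM ?mulr_ge0 ?powR_ge0// ler_wpM2l ?powR_ge0//.
  apply: ger_powR; first by rewrite r0 ltW.
  by rewrite /th lerD2r ler_wpM2l.
have k2 : 0 <= n%:R ^+ 2 * ((1 + `|p - 2|) * (K * (1 + 2 * b.-1%:R))) :> R by nneg.
have d1z := d1P r r0 rd1.
have tz : `|2 * C' * (z.2 - z0.2)| <= tau / 4.
  rewrite !normrM (ger0_norm (ler0n _ 2)); move: td2.
  rewrite ltr_pdivlMr ?mulr_gt0 ?ltr_wpDl// => h.
  by have := normr_ge0 (z.2 - z0.2); lra.
move=> ob.
have {}ob : `|oper p q s (a z) G H| <= tau / 4.
  apply: le_trans ob _; apply: le_trans d1z.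
  have := ler_wpM2l k2 spd.
  by rewrite /K1; lra.
by move: tz ob; rewrite !ler_norml => /andP[? ?] /andP[? ?]; lra.
Qed.

Section SpaceTime.
Context {R : realType} {n : nat}.
Local Notation pt := ('rV[R]_n * R)%type.
Implicit Types (z v : pt).

(** Space-time is identified with a Euclidean space of dimension [n + 1], so that sup-convolution
    and the sum rule treat space and time together. *)
Definition pt_vec z : 'rV[R]_(n + 1) := row_mx z.1 (z.2)%:M.
Definition vec_pt (w : 'rV[R]_(n + 1)) : pt := (lsubmx w, rsubmx w 0 0).

Lemma pt_vecK : cancel pt_vec vec_pt.
Proof. by case=> x t; rewrite /vec_pt /pt_vec row_mxKl row_mxKr mxE eqxx mulr1n. Qed.

Lemma vec_ptK : cancel vec_pt pt_vec.
Proof.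
move=> w; rewrite /pt_vec /vec_pt /= -[RHS]hsubmxK; congr row_mx.
by apply/rowP => i; rewrite ord1 !mxE eqxx mulr1n.
Qed.

Lemma enorm_row (x : 'rV[R]_n) (t : 'rV[R]_1) :
  enorm (row_mx x t) ^+ 2 = enorm x ^+ 2 + t 0 0 ^+ 2.
Proof.
rewrite !enorm_sq /inner big_split_ord /= big_ord1; congr (_ + _).
  by apply: eq_bigr => i _; rewrite row_mxEl.
by rewrite row_mxEr expr2.
Qed.

Lemma pt_vecB z v : pt_vec z - pt_vec v = row_mx (z.1 - v.1) (z.2 - v.2)%:M.
Proof. by rewrite /pt_vec opp_row_mx add_row_mx raddfB. Qed.

Lemma enorm_pt_vecB z v :
  enorm (pt_vec z - pt_vec v) ^+ 2 = enorm (z.1 - v.1) ^+ 2 + (z.2 - v.2) ^+ 2.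
Proof. by rewrite pt_vecB enorm_row mxE eqxx mulr1n. Qed.

Definition coord_index (k : 'I_(n + 1)) : option 'I_n :=
  if fintype.split k is inl i then Some i else None.

Lemma pt_vecE z k : pt_vec z 0 k = if coord_index k is Some i then z.1 0 i else z.2.
Proof.
rewrite /coord_index -[in LHS](fintype.splitK k).
by case: (fintype.split k) => [i|i] /=; rewrite ?row_mxEl// row_mxEr ord1 mxE eqxx mulr1n.
Qed.

Lemma pt_vec_dir_x i : pt_vec (dir_x i) = delta_mx 0 (lshift 1 i) :> 'rV[R]_(n + 1).
Proof.
apply/rowP => k; rewrite -(fintype.splitK k); case: (fintype.split k) => [j|j] /=.
  by rewrite row_mxEl !mxE (inj_eq (@lshift_inj _ _)).
by rewrite row_mxEr !mxE eq_rlshift andbF mul0rn.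
Qed.

Lemma pt_vec_dir_t : pt_vec (dir_t : pt) = delta_mx 0 (rshift n 0) :> 'rV[R]_(n + 1).
Proof.
apply/rowP => k; rewrite -(fintype.splitK k); case: (fintype.split k) => [j|j] /=.
  by rewrite row_mxEl !mxE eq_lrshift andbF.
by rewrite row_mxEr !mxE !ord1 !eqxx.
Qed.

Section QuadraticTest.
Variables (G : 'rV[R]_(n + 1)) (B : 'M[R]_(n + 1)) (rho : R) (z0 : pt).
Hypothesis rho0 : 0 < rho.

Let sg k : pt -> R := sat rho (coord_index k) (pt_vec z0 0 k).

(* The saturation [rho sin(. / rho)] of the coordinates keeps the gradient close to [G]
   on the whole cylinder. *)
Definition quadratic_test z : R :=
  inner G (pt_vec z - pt_vec z0) + qf B (\row_k sg k z) / 2.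

Let lin z : R := \sum_k (pt_vec z 0 k - pt_vec z0 0 k) * G 0 k.
Let quad z : R := \sum_k \sum_l B k l * (sg k z * sg l z).

Lemma quadratic_testE : quadratic_test = (fun z => lin z + quad z * 2^-1).
Proof.
apply/funext => z; rewrite /quadratic_test; congr (_ + _ * _).
  by rewrite innerC; apply: eq_bigr => k _; rewrite !mxE.
by rewrite qfE; apply: eq_bigr => k _; apply: eq_bigr => l _; rewrite !mxE mulrA.
Qed.

Lemma smooth_coordk k : smooth (fun z => pt_vec z 0 k - pt_vec z0 0 k).
Proof.
rewrite (_ : (fun z => _) = fun z => (if coord_index k is Some i then z.1 0 i else z.2) - pt_vec z0 0 k).
  by case: (coord_index k) => [i|]; [exact: smooth_coord|exact: smooth_time].
by apply/funext => z; rewrite pt_vecE.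
Qed.

Lemma derive_coordk k z v : 'D_v (fun z => pt_vec z 0 k - pt_vec z0 0 k) z = pt_vec v 0 k.
Proof.
rewrite (_ : (fun z => _) = fun z => (if coord_index k is Some i then z.1 0 i else z.2) - pt_vec z0 0 k).
  by rewrite (pt_vecE v); case: (coord_index k) => [i|]; [exact: derive_coord|exact: derive_time].
by apply/funext => y; rewrite pt_vecE.
Qed.

Let smooth_sg k : smooth (sg k). Proof. exact: smooth_sat. Qed.
Let cs k z := cos (rho^-1 * (pt_vec z 0 k - pt_vec z0 0 k)).

Let derive_sg k z v : 'D_v (sg k) z = pt_vec v 0 k * cs k z.
Proof. by rewrite derive_sat ?gt_eqF// /cs -!pt_vecE. Qed.

Let smooth_cs k : smooth (cs k).
Proof.
rewrite /cs; apply: (@smooth_cos _ _ (fun z => rho^-1 * (pt_vec z 0 k - pt_vec z0 0 k))).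
have := affine_scaled rho (coord_index k) (pt_vec z0 0 k).
by under eq_fun do rewrite -pt_vecE.
Qed.

Lemma smooth_lin : smooth lin.
Proof. by apply: smooth_sum => k; apply: smoothM; [exact: smooth_coordk|exact: smooth_cst]. Qed.

Lemma smooth_quad : smooth quad.
Proof.
apply: smooth_sum => k; apply: smooth_sum => l; apply: smoothM; first exact: smooth_cst.
exact: smoothM.
Qed.

Lemma smooth_quadratic_test : smooth quadratic_test.
Proof.
rewrite quadratic_testE; apply: smoothD; first exact: smooth_lin.
by apply: smoothM; [exact: smooth_quad|exact: smooth_cst].
Qed.

Lemma derive_quadratic_test z v : 'D_v quadratic_test z = inner G (pt_vec v) +
  (\sum_k \sum_l B k l * (sg k z * (pt_vec v 0 l * cs l z) + sg l z * (pt_vec v 0 k * cs k z))) * 2^-1.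
Proof.
rewrite quadratic_testE.
have sq := smooth_quad.
rewrite (derive_smoothD _ _ smooth_lin (smoothM sq (smooth_cst 2^-1))); congr (_ + _).
  rewrite derive_smooth_sum; last by move=> k; apply: smoothM; [exact: smooth_coordk|exact: smooth_cst].
  rewrite innerC; apply: eq_bigr => k _.
  rewrite (derive_smoothM _ _ (smooth_coordk k) (smooth_cst _)) derive_coordk.
  by rewrite (derive_cst (G 0 k)) mulr0 add0r mulrC.
rewrite (derive_smoothM _ _ sq (smooth_cst _)) (derive_cst (2^-1 : R)) mulr0 add0r mulrC.
congr (_ * _); rewrite derive_smooth_sum; last first.
  move=> k; apply: smooth_sum => l; apply: smoothM; [exact: smooth_cst|exact: smoothM].
apply: eq_bigr => k _; rewrite derive_smooth_sum; last first.
  by move=> l; apply: smoothM; [exact: smooth_cst|exact: smoothM].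
apply: eq_bigr => l _; rewrite (derive_smoothZ _ _ _ (smoothM (smooth_sg k) (smooth_sg l))).
by rewrite (derive_smoothM _ _ (smooth_sg k) (smooth_sg l)) !derive_sg.
Qed.

Lemma sat_center k : sg k z0 = 0.
Proof. by rewrite /sg /sat -pt_vecE subrr mulr0 sin0 mulr0. Qed.

Lemma quadratic_test_center : quadratic_test z0 = 0.
Proof.
rewrite /quadratic_test subrr inner0r add0r (_ : \row_k sg k z0 = 0) ?qf0r ?mul0r//.
by apply/rowP => k; rewrite !mxE sat_center.
Qed.

Lemma derive_quadratic_test_center v : 'D_v quadratic_test z0 = inner G (pt_vec v).
Proof.
rewrite derive_quadratic_test big1 ?mul0r ?addr0// => k _; rewrite big1// => l _.
by rewrite !sat_center !mul0r addr0 mulr0.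
Qed.

(** Derivatives of the cosine factors come multiplied by saturations, which vanish at the centre.
    What is left is the symmetrization of [B]. *)
Lemma derive2_quadratic_test_center u v : 'D_u ('D_v quadratic_test) z0 =
  (\sum_k \sum_l B k l * (pt_vec u 0 k * pt_vec v 0 l + pt_vec u 0 l * pt_vec v 0 k)) * 2^-1.
Proof.
have E := funext (fun z => derive_quadratic_test z v); rewrite E {E}.
pose t k l z := sg k z * (pt_vec v 0 l * cs l z).
have st k l : smooth (t k l).
  by apply: smoothM => //; apply: smoothM => //; exact: smooth_cst.
have s1 k l : smooth (fun z => B k l * (t k l z + t l k z)).
  by apply: smoothM; [exact: smooth_cst|exact: smoothD].
have s2 k : smooth (fun z => \sum_l B k l * (t k l z + t l k z)) by exact: smooth_sum.
have s3 : smooth (fun z => \sum_k \sum_l B k l * (t k l z + t l k z)) by exact: smooth_sum.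
rewrite (derive_smoothD _ _ (smooth_cst (inner G (pt_vec v))) (smoothM s3 (smooth_cst 2^-1))).
rewrite (derive_cst (inner G (pt_vec v))) add0r (derive_smoothM _ _ s3 (smooth_cst _)).
rewrite (derive_cst (2^-1 : R)) mulr0 add0r mulrC; congr (_ * _).
rewrite derive_smooth_sum//; apply: eq_bigr => k _.
rewrite derive_smooth_sum//; apply: eq_bigr => l _.
rewrite (derive_smoothZ _ _ _ (smoothD (st k l) (st l k))) (derive_smoothD _ _ (st k l) (st l k)).
have dt k' l' : 'D_u (t k' l') z0 = pt_vec u 0 k' * pt_vec v 0 l'.
  have sl : smooth (fun z => pt_vec v 0 l' * cs l' z).
    by apply: smoothM => //; exact: smooth_cst.
  rewrite (derive_smoothM _ _ (smooth_sg k') sl) sat_center mul0r add0r derive_sg.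
  by rewrite /cs !subrr !mulr0 !cos0 !mulr1 mulrC.
by rewrite !dt.
Qed.

(** [test_function] asks for a nonzero gradient at every point of [Q1] off the line [x = x0], not
    only near the contact point; a small [rho] provides it. *)
Lemma derive_quadratic_test_bound i z : `|'D_(dir_x i) quadratic_test z - G 0 (lshift 1 i)| <=
  rho * \sum_k \sum_l `|B k l|.
Proof.
rewrite derive_quadratic_test pt_vec_dir_x inner_delta addrC addKr.
have sgb k : `|sg k z| <= rho.
  rewrite /sg /sat normrM (gtr0_norm rho0) ler_piMr ?(ltW rho0)//.
  by rewrite ler_norml sin_geN1 sin_le1.
have db k : `|(delta_mx 0 (lshift 1 i) : 'rV[R]_(n + 1)) 0 k * cs k z| <= 1.
  rewrite normrM -[leRHS]mulr1 ler_pM//.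
    by rewrite mxE; case: (_ && _); rewrite ?normr1 ?normr0.
  by rewrite ler_norml cos_geN1 cos_le1.
rewrite normrM (ger0_norm (_ : 0 <= 2^-1)) ?invr_ge0// ler_pdivrMr//.
apply: le_trans (ler_norm_sum _ _ _) _; rewrite mulr_sumr mulr_suml.
apply: ler_sum => k _; apply: le_trans (ler_norm_sum _ _ _) _; rewrite mulr_sumr mulr_suml.
apply: ler_sum => l _; rewrite normrM [leRHS]mulrAC [leRHS]mulrC ler_wpM2l//.
apply: le_trans (ler_normD _ _) _.
have h1 := ler_pM (normr_ge0 _) (normr_ge0 _) (sgb k) (db l).
have h2 := ler_pM (normr_ge0 _) (normr_ge0 _) (sgb l) (db k).
by rewrite !normrM in h1 h2 *; move: h1 h2; lra.
Qed.

End QuadraticTest.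

End SpaceTime.

Lemma bilin_bound {R : realType} {n : nat} (H : 'M[R]_n) :
  exists2 C : R, 0 <= C & forall x y, `|inner (x *m H) y| <= C * enorm x * enorm y.
Proof.
exists (\sum_(i < n) \sum_(j < n) `|H i j|).
  by apply: sumr_ge0 => i _; apply: sumr_ge0 => j _.
move=> x y; have -> : inner (x *m H) y = \sum_(i < n) \sum_(j < n) H i j * x 0 i * y 0 j.
  rewrite exchange_big; apply: eq_bigr => j _ /=.
  by rewrite mxE big_distrl; apply: eq_bigr => i _ /=; rewrite (mulrC (x 0 i)).
rewrite -mulrA mulr_suml (le_trans (ler_norm_sum _ _ _))//.
apply: ler_sum => i _; rewrite mulr_suml (le_trans (ler_norm_sum _ _ _))//.
apply: ler_sum => j _; rewrite -mulrA normrM ler_wpM2l// normrM.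
by rewrite ler_pM// norm_coord_le.
Qed.

Lemma sin_taylor1 {R : realType} (x : R) : `|sin x - x| <= x ^+ 2.
Proof.
have c1 (y : R) : `|cos y - 1| <= `|y|.
  have := @mvt0_bound _ cos (fun z => - sin z) y 1 (fun z => is_derive_cos z).
  rewrite cos0 mul1r; apply => z _.
  by rewrite normrN ler_norml sin_geN1 sin_le1.
have := @mvt0_bound _ (fun z => sin z - z) (fun z => cos z - 1) x `|x|.
rewrite sin0 !subr0 -expr2 real_normK ?num_real//; apply.
by move=> z zx; rewrite (le_trans (c1 z)).
Qed.

(** Replacing [y] by its saturation changes it by [O(|y|^2)], hence a quadratic form by [O(|y|^3)],
    and the margin [d |y|^2] survives to absorb cubic errors. *)
Lemma qf_perturb {R : realType} {n : nat} (H : 'M[R]_n) (d c : R) : 0 <= d -> 0 <= c ->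
  exists2 K : R, 0 <= K & forall y e, enorm y <= 1 -> enorm e <= c * enorm y ^+ 2 ->
    qf H y + d * enorm y ^+ 2 - K * enorm y ^+ 3 <= qf (H + d *: 1%:M) (y + e).
Proof.
move=> d0 c0; have [C C0 HC] := bilin_bound H.
exists ((C + d) * (2 * c + c ^+ 2)); first by nneg.
move=> y e y1 ec; rewrite qfDm qfZm qf1m -enorm_sq.
have -> : qf H (y + e) = qf H y + inner (y *m H) e + inner (e *m H) y + qf H e.
  by rewrite /qf mulmxDl innerDl !innerDr; ring.
rewrite enorm_sqD; set Y := enorm y in y1 ec *; set E := enorm e in ec *.
have Y0 : 0 <= Y by exact: enorm_ge0.
have E0 : 0 <= E by exact: enorm_ge0.
have YE : Y * E <= c * Y ^+ 3.
  by rewrite (_ : c * Y ^+ 3 = Y * (c * Y ^+ 2)) ?ler_wpM2l//; ring.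
have E2 : E ^+ 2 <= c ^+ 2 * Y ^+ 3.
  apply: le_trans (lerXn 2 E0 ec) _; rewrite exprMn ler_wpM2l ?sqr_ge0// -exprM.
  by rewrite (exprD _ 3 1 : Y ^+ (2 * 2) = _) ler_piMr ?exprn_ge0.
have h1 := HC y e; have h2 := HC e y; have h3 := HC e e; have h4 := norm_inner_le y e.
rewrite -/Y -/E in h1 h2 h3 h4; rewrite -/(qf H e) in h3.
have k1 := ler_wpM2l C0 YE; have k2 := ler_wpM2l C0 E2; have k3 := ler_wpM2l d0 YE.
have k4 : 0 <= d * E ^+ 2 by nneg.
have k5 : 0 <= d * (c ^+ 2 * Y ^+ 3) by nneg.
have k6 : - (d * (Y * E)) <= d * inner y e.
  by rewrite -mulrN ler_wpM2l//; move: h4; rewrite ler_norml => /andP[].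
move: h1 h2 h3 k1 k2 k3 k4 k5 k6; rewrite !ler_norml => /andP[+ _] /andP[+ _] /andP[+ _].
by clear; lra.
Qed.

Lemma sum_delta2 {R : realType} {n : nat} (B : 'M[R]_n) (i j : 'I_n) :
  \sum_k \sum_l B k l * ((k == i)%:R * (l == j)%:R) = B i j.
Proof.
rewrite (bigD1 i)//= [X in _ + X]big1 ?addr0; last first.
  by move=> k ki; rewrite big1// => l _; rewrite (negbTE ki) mul0r mulr0.
rewrite (bigD1 j)//= [X in _ + X]big1 ?addr0; first by rewrite !eqxx !mulr1.
by move=> l lj; rewrite (negbTE lj) !mulr0.
Qed.

Section NondegenerateContact.
Context {R : realType} {n : nat}.
Local Notation pt := ('rV[R]_n * R)%type.

(** The passage from test functions to second-order jets. If the inequality failed by a gap [g], the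
    saturated polynomial with Hessian [H + d I] would be an admissible test function still touching
    [w] from above, with residual near [z0] bounded below by a positive constant. *)
Lemma nondegenerate_contact (p q s : R) (a : pt -> R) (A : set pt) (w : pt -> R) (z0 : pt)
    (G : 'rV[R]_(n + 1)) (H : 'M[R]_(n + 1)) (C r : R) :
  sub_visc p q s a A w ->
  a z @[z --> within (Q1 R n) (nbhs z0)] --> a z0 -> Q1 R n z0 -> A z0 -> 0 < r ->
  (forall z, A z -> Q1 R n z -> enorm (pt_vec z - pt_vec z0) <= r ->
     w z <= w z0 + inner G (pt_vec z - pt_vec z0) + qf H (pt_vec z - pt_vec z0) / 2 +
            C * enorm (pt_vec z - pt_vec z0) ^+ 3) ->
  lsubmx G != 0 ->
  rsubmx G 0 0 <= oper p q s (a z0) (lsubmx G) (ulsubmx H).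
Proof.
move=> sv ca Qz0 Az0 r0 ct G0; rewrite leNgt; apply/negP => gap.
pose Gt := rsubmx G 0 0; pose xi := lsubmx G; pose al := a z0.
pose T1 := oper p q s al xi 1%:M.
pose g := Gt - oper p q s al xi (ulsubmx H); have g0 : 0 < g by rewrite subr_gt0.
(* Adding [d I] to the Hessian changes the operator by at most [g / 4]. *)
pose d := g / (4 * (`|T1| + 1)).
have d0 : 0 < d by rewrite divr_gt0// mulr_gt0// ltr_wpDl.
have dT : `|d * T1| <= g / 4.
  rewrite normrM (gtr0_norm d0) /d; have := normr_ge0 T1; set t := `|T1| => t0.
  rewrite mulrAC ler_pdivrMr ?mulr_gt0 ?ltr_wpDl//.
  by have := mulr_ge0 (ltW g0) t0; lra.
pose B := H + d *: 1%:M.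
have [i0 xi0] : exists i, xi 0 i != 0.
  apply/existsP; rewrite -negb_forall; apply: contra G0 => /forallP h.
  by apply/eqP/rowP => i; rewrite [RHS]mxE; exact/eqP.
pose SB := \sum_k \sum_l `|B k l|.
have SB0 : 0 <= SB by apply: sumr_ge0 => k _; apply: sumr_ge0.
(* The deviation [rho SB] of each spatial derivative stays below [|xi 0 i0|], so the component [i0]
   of the gradient never vanishes. *)
pose rho := `|xi 0 i0| / (2 * (SB + 1)).
have rho0 : 0 < rho by rewrite divr_gt0 ?normr_gt0// mulr_gt0// ltr_wpDl.
pose phi := quadratic_test G B rho z0.
have sphi : smooth phi by exact: smooth_quadratic_test.
have gphi z : grad phi z != 0.
  apply/eqP => /rowP/(_ i0); rewrite !mxE => D0.
  have := derive_quadratic_test_bound G B z0 rho0 i0 z; rewrite -/phi D0 sub0r normrN -/SB.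
  have -> : G 0 (lshift 1 i0) = xi 0 i0 by rewrite mxE.
  rewrite leNgt => /negP; apply; rewrite /rho mulrAC ltr_pdivrMr ?mulr_gt0 ?ltr_wpDl//.
  by have := normr_gt0 (xi 0 i0); rewrite xi0 => x0; have := mulr_ge0 (ltW x0) SB0; lra.
have c0 : 0 <= (n + 1)%:R / rho by rewrite divr_ge0// ltW.
have [K K0 HK] := qf_perturb H (ltW d0) c0.
(* Within this radius the cubic terms, with constants [C] and [K / 2], are absorbed by
   [d |y|^2 / 2]. *)
pose r1 := Num.min r (Num.min 1 (d / (2 * `|C| + K + 1))).
have r10 : 0 < r1 by rewrite !lt_min r0 ltr01 divr_gt0// ltr_wpDl//; nneg.
have touch : sub_contact A w z0 phi.
  exists (r1 / 2); first by rewrite divr_gt0.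
  move=> z Az Qz h1 h2; rewrite [phi z0]quadratic_test_center subr0.
  set y := pt_vec z - pt_vec z0.
  have yr : enorm y <= r1.
    rewrite -(@ler_pXn2r _ 2) ?nnegrE ?enorm_ge0 ?(ltW r10)//.
    rewrite enorm_pt_vecB.
    have e1 := lerXn 2 (enorm_ge0 _) (ltW h1); have e2 := lerXn 2 (normr_ge0 _) (ltW h2).
    move: e1 e2; rewrite (real_normK (num_real _)).
    by have := sqr_ge0 r1; lra.
  move: yr; rewrite !le_min => /and3P[yr y1 yd].
  have yy := enorm_ge0 y.
  have := ct z Az Qz yr; rewrite -/y => wz.
  pose sv' := \row_k sat rho (coord_index k) (pt_vec z0 0 k) z.
  have phiE : phi z = inner G y + qf B sv' / 2 by [].
  have eE : enorm (sv' - y) <= (n + 1)%:R / rho * enorm y ^+ 2.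
    apply: le_trans (enorm_le_norm _) _; rewrite -mulrA ler_wpM2l//.
    have rn0 : 0 <= rho^-1 * enorm y ^+ 2 by nneg.
    rewrite [leLHS]/Num.norm/= mx_normrE; apply: bigmax_le => //.
    case=> i k _ /=; rewrite ord1.
    have yk : y 0 k = pt_vec z 0 k - pt_vec z0 0 k by rewrite [LHS]mxE [X in _ + X]mxE.
    have -> : (sv' - y) 0 k = rho * sin (rho^-1 * y 0 k) - y 0 k.
      by rewrite [LHS]mxE [X in X + _]mxE [X in _ + X]mxE /sat -pt_vecE -yk.
    have -> : rho * sin (rho^-1 * y 0 k) - y 0 k = rho * (sin (rho^-1 * y 0 k) - rho^-1 * y 0 k).
      by field; rewrite gt_eqF.
    rewrite normrM (gtr0_norm rho0).
    apply: le_trans (ler_wpM2l (ltW rho0) (sin_taylor1 _)) _.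
    have -> : rho * (rho^-1 * y 0 k) ^+ 2 = rho^-1 * y 0 k ^+ 2 by field; rewrite gt_eqF.
    rewrite ler_wpM2l ?invr_ge0 ?(ltW rho0)//.
    by rewrite -[leLHS]real_normK ?num_real// lerXn// norm_coord_le.
  have := HK y (sv' - y) y1 eE; rewrite subrKC -/B => hq.
  have fin : C * enorm y ^+ 3 <= (d * enorm y ^+ 2 - K * enorm y ^+ 3) / 2.
    move: yd; rewrite ler_pdivlMr ?ltr_wpDl//; last by nneg.
    move=> yd; have := ler_wpM2l (sqr_ge0 (enorm y)) yd.
    have := ler_wpM2r (exprn_ge0 3 yy) (ler_norm C).
    by have := exprn_ge0 3 yy; lra.
  by rewrite phiE; move: wz hq fin; clear; lra.
apply: (sv z0 phi (g / 4) Qz0 Az0 sphi _ touch); first by move=> z _ _; exact: gphi.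
  by rewrite divr_gt0.
(* The gradient at [z0] is nonzero, so the residual is continuous there and its limit can be taken
   without excluding [x = x0]. *)
pose F := within (Q1 R n) (nbhs z0).
have FF : Filter F by exact: within_filter.
have sub : (\forall z \near F, g / 4 <= residual p q s a phi z) ->
    \forall z \near approach z0, g / 4 <= residual p q s a phi z.
  by rewrite /F /approach !near_withinE; apply: filterS => z h [Qz _]; exact: h.
apply: sub.
have cs (f : pt -> R) : smooth f -> f z @[z --> F] --> f z0.
  by move=> sf; apply: cvg_within_filter; exact: smooth_continuous.
pose S : 'M[R]_n := \matrix_(i, j) (hess phi z0 i j).
have lim : residual p q s a phi z @[z --> F] --> Gt - oper p q s al xi S.
  under eq_fun do rewrite residualE.
  apply: cvgB.
    have -> : Gt = dt phi z0.
      rewrite /dt derive_quadratic_test_center//.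
      rewrite (_ : pt_vec dir_t = delta_mx 0 (rshift n 0)); last exact: pt_vec_dir_t.
      rewrite inner_delta /Gt mxE.
      by congr (G 0 _).
    by apply: (cs (dt phi)); exact: (smooth_derive dir_t sphi).
  apply: oper_cvg => //.
    move=> i; have -> : xi 0 i = grad phi z0 0 i.
      by rewrite [RHS]mxE derive_quadratic_test_center// pt_vec_dir_x inner_delta mxE.
    under eq_fun do rewrite mxE; rewrite mxE.
    by apply: (cs ('D_(dir_x i) phi)); exact: smooth_derive.
  move=> i j; rewrite mxE; under eq_fun do rewrite mxE; rewrite mxE.
  by apply: (cs ('D_(dir_x i) ('D_(dir_x j) phi))); do 2 apply: smooth_derive.
have SE : oper p q s al xi S = oper p q s al xi (ulsubmx H) + d * T1.
  (* [acoef] is symmetric, so the operator does not distinguish [B] from its symmetrization. *)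
  have -> : S = (2^-1 : R) *: (ulsubmx B + (ulsubmx B)^T).
    apply/matrixP => i j.
    have Bu k l : ulsubmx B k l = B (lshift 1 k) (lshift 1 l) by rewrite !mxE.
    rewrite [LHS]mxE [LHS]mxE [RHS]mxE [X in _ * X]mxE [X in _ * (_ + X)]mxE !Bu.
    rewrite derive2_quadratic_test_center// !pt_vec_dir_x.
    rewrite [RHS]mulrC; congr (_ * _).
    rewrite -(sum_delta2 B (lshift 1 i)) -(sum_delta2 B (lshift 1 j)) -big_split.
    apply: eq_bigr => k _; rewrite -big_split; apply: eq_bigr => l _ /=.
    by rewrite !mxE /= mulrDr (mulrC (l == _)%:R).
  rewrite operZ operD oper_tr.
  have -> : ulsubmx B = ulsubmx H + d *: 1%:M.
    by apply/matrixP => i j; rewrite !mxE (inj_eq (@lshift_inj _ _)).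
  by rewrite operD operZ -/T1; clear; lra.
move/cvgrPdist_le : lim => /(_ (g / 4) (divr_gt0 g0 (ltr0n _ 4))).
rewrite /F; apply: filterS => z; rewrite SE.
have gE : g = Gt - oper p q s al xi (ulsubmx H) by [].
by move: dT gE; clear; rewrite !ler_norml => /andP[? ?] ? /andP[? ?]; lra.
Qed.

End NondegenerateContact.

(** * Sup-convolution *)

Lemma dist_sq_diff {R : realType} {n : nat} (x y z : 'rV[R]_n) (r s : R) :
  enorm x <= r -> enorm y <= r -> enorm z <= s ->
  `|enorm (y - z) ^+ 2 - enorm (x - z) ^+ 2| <= 2 * (r + s) * enorm (x - y).
Proof.
move=> xr yr zr.
have -> : enorm (y - z) ^+ 2 - enorm (x - z) ^+ 2 = inner (y - x) (y + x - 2 *: z).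
  by rewrite !enorm_sqB !(innerBl, innerDr, innerNr, innerZr) !enorm_sq (innerC x y); ring.
apply: le_trans (norm_inner_le _ _) _; rewrite mulrC enormB ler_wpM2r ?enorm_ge0//.
apply: le_trans (ler_enormB _ _) _; rewrite enormZ ger0_norm//.
by have := ler_enormD y x; lra.
Qed.

Lemma dist_sq_cont {R : realType} {n : nat} (c t : R) (z x : 'rV[R]_n) : 0 < t ->
  exists2 d : R, 0 < d & forall y, enorm (y - x) < d ->
    `|enorm (z - y) ^+ 2 * c - enorm (z - x) ^+ 2 * c| < t.
Proof.
move=> t0; pose B := 2 * (enorm x + 1 + enorm z) * `|c|.
have B0 : 0 <= B by rewrite /B; nneg.
exists (Num.min 1 (t / (B + 1))); first by rewrite lt_min ltr01 divr_gt0// ltr_wpDl.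
move=> y; rewrite lt_min => /andP[y1]; rewrite ltr_pdivlMr ?ltr_wpDl// => yt.
have yx : enorm y <= enorm x + 1.
  by have := ler_enormD x (y - x); rewrite subrKC; lra.
have xx : enorm x <= enorm x + 1 by lra.
have := dist_sq_diff xx yx (lexx (enorm z)).
rewrite -mulrBl normrM !(enormB z) (enormB x y) => h.
apply: le_lt_trans (ler_wpM2r (normr_ge0 c) h) _.
apply: le_lt_trans yt; rewrite [leRHS]mulrDr mulr1 /B.
by have := enorm_ge0 (y - x); lra.
Qed.

Lemma usc_ext_sub {R : realType} {n : nat} (A : set 'rV[R]_n) (u psi : 'rV[R]_n -> R) :
  (forall x t, 0 < t -> exists2 d : R, 0 < d &
     forall y, enorm (y - x) < d -> `|psi y - psi x| < t) ->
  usc_ext A u -> usc_ext A (fun z => u z - psi z).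
Proof.
move=> cpsi uA x c Ac.
have [t t0 ut] : exists2 t : R, 0 < t & A x -> u x < c + psi x - t.
  have [/Ac h|nA] := pselect (A x); last by exists 1.
  by exists ((c - (u x - psi x)) / 2) => [|_]; lra.
have [r1 r10 h1] := uA x _ ut; have [r2 r20 h2] := cpsi x t t0.
exists (Num.min r1 r2) => [|y Ay]; first by rewrite lt_min r10.
rewrite lt_min => /andP[/(h1 _ Ay) ? /h2]; rewrite ltr_norml => /andP[? _].
by lra.
Qed.

Section SupConvolution.
Context {R : realType} {n : nat}.
Variables (A : set 'rV[R]_n) (u : 'rV[R]_n -> R) (e rho : R).
Hypotheses (e0 : 0 < e) (rho0 : 0 <= rho) (A0 : A !=set0).
Hypotheses (Arho : forall z, A z -> enorm z <= rho) (uA : usc_ext A u).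

Definition supconv (z : 'rV[R]_n) : R :=
  sup [set u z' - enorm (z - z') ^+ 2 / (2 * e) | z' in A].

Definition supconv_at (z z' : 'rV[R]_n) : Prop :=
  A z' /\ supconv z = u z' - enorm (z - z') ^+ 2 / (2 * e).

Lemma supconv_max z : exists2 z', A z' &
  forall y, A y -> u y - enorm (z - y) ^+ 2 / (2 * e) <= u z' - enorm (z - z') ^+ 2 / (2 * e).
Proof.
apply: (usc_ext_attains A0 Arho); apply: usc_ext_sub => // x t t0.
exact: dist_sq_cont.
Qed.

Lemma supconv_ge z y : A y -> u y - enorm (z - y) ^+ 2 / (2 * e) <= supconv z.
Proof.
move=> Ay; have [z' Az' z'max] := supconv_max z.
apply: ub_le_sup; last by exists y.
by exists (u z' - enorm (z - z') ^+ 2 / (2 * e)) => _ [x Ax <-]; exact: z'max.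
Qed.

Lemma supconv_ex z : exists z', supconv_at z z'.
Proof.
have [z' Az' z'max] := supconv_max z; exists z'; split => //.
apply/eqP; rewrite eq_le supconv_ge// andbT; apply: ge_sup.
  by exists (u z' - enorm (z - z') ^+ 2 / (2 * e)); exists z'.
by move=> _ [x Ax <-]; exact: z'max.
Qed.

Lemma supconv_lipschitz (r : R) x y : enorm x <= r -> enorm y <= r ->
  `|supconv x - supconv y| <= (r + rho) / e * enorm (x - y).
Proof.
have half x' y' : enorm x' <= r -> enorm y' <= r ->
    supconv x' - supconv y' <= (r + rho) / e * enorm (x' - y').
  move=> xr yr; have [z' [Az' ->]] := supconv_ex x'.
  have := supconv_ge y' Az'; have := dist_sq_diff xr yr (Arho Az').
  rewrite ler_norml => /andP[_ h] h'.
  have i0 : 0 <= (2 * e)^-1 by nneg.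
  have := ler_wpM2r i0 h.
  rewrite (_ : 2 * (r + rho) * enorm (x' - y') / (2 * e) = (r + rho) / e * enorm (x' - y')).
    by rewrite mulrBl; lra.
  by field; rewrite gt_eqF.
move=> xr yr; rewrite ler_norml half// andbT.
by have := half y x yr xr; rewrite enormB; lra.
Qed.

(** Keeping the maximizer [z'] as a competitor at [z + y] places a paraboloid of opening [1 / e]
    below the sup-convolution: this is its semiconvexity. *)
Lemma supconv_lower z z' y : supconv_at z z' ->
  supconv z + inner (e^-1 *: (z' - z)) y - enorm y ^+ 2 / (2 * e) <= supconv (z + y).
Proof.
move=> [Az' ->]; apply: le_trans (supconv_ge (z + y) Az').
have -> : z + y - z' = (z - z') + y by rewrite addrAC.
rewrite (enorm_sqD (z - z')) innerZl -(opprB z z') innerNl.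
by rewrite le_eqVlt; apply/orP; left; apply/eqP; field; rewrite gt_eqF.
Qed.

(** Moving [z] and [z'] by the same vector leaves the quadratic penalty unchanged. Through this,
    contact from above is transferred from the sup-convolution to [u] at the shifted point. *)
Lemma supconv_shift_ge z z' y : supconv_at z z' -> A (z' + y) ->
  u (z' + y) - u z' <= supconv (z + y) - supconv z.
Proof.
move=> [Az' ->] Ay; have := supconv_ge (z + y) Ay.
by rewrite opprD addrACA subrr addr0; lra.
Qed.

Lemma inner_le_quad_eq0 (p : 'rV[R]_n) (K r : R) : 0 < r ->
  (forall y, enorm y <= r -> inner p y <= K * enorm y ^+ 2) -> p = 0.
Proof.
move=> r0 h; apply/eqP; rewrite -enorm_eq0; apply: contraT => p0.
have {}p0 : 0 < enorm p by rewrite lt_def p0 enorm_ge0.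
pose t := Num.min (r / enorm p) (1 / (2 * (`|K| + 1))).
have t0 : 0 < t by rewrite lt_min !divr_gt0// mulr_gt0// ltr_wpDl.
have tp : t * enorm p <= r by rewrite -ler_pdivlMr// ge_min lexx.
have := h (t *: p); rewrite enormZ (gtr0_norm t0) => /(_ tp).
rewrite innerZr -enorm_sq exprMn => k.
have tK : t * (2 * (`|K| + 1)) <= 1.
  by rewrite -ler_pdivlMr ?ge_min ?lexx ?orbT// mulr_gt0// ltr_wpDl.
have P0 : 0 < t * enorm p ^+ 2 by rewrite mulr_gt0// exprn_gt0.
have := ler_wpM2r (ltW P0) tK.
have := ler_wpM2r (mulr_ge0 (ltW t0) (ltW P0)) (ler_norm K).
by move: k P0 (mulr_gt0 t0 P0); lra.
Qed.

(** The touching function from above is compared with the paraboloid of [supconv_lower] from below: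
    the gradients agree, which determines [z'], and the Hessian is at least [- I / e]. *)
Lemma supconv_touch z z' (G : 'rV[R]_n) (H : 'M[R]_n) (C r : R) : 0 < r -> supconv_at z z' ->
  (forall y, enorm y <= r ->
     supconv (z + y) <= supconv z + inner G y + qf H y / 2 + C * enorm y ^+ 3) ->
  [/\ G = e^-1 *: (z' - z), forall y, - enorm y ^+ 2 / e <= qf H y &
      forall y, A (z' + y) -> enorm y <= r ->
        u (z' + y) <= u z' + inner G y + qf H y / 2 + C * enorm y ^+ 3].
Proof.
move=> r0 at_z touch; have [CH CH0 qH] := qf_bound H.
have ine : 0 <= (2 * e)^-1 by nneg.
have GE : G = e^-1 *: (z' - z).
  apply/eqP; rewrite eq_sym -subr_eq0; apply/eqP.
  apply: (@inner_le_quad_eq0 _ ((2 * e)^-1 + CH / 2 + `|C| * r) r r0) => y yr.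
  have := supconv_lower y at_z; have := touch y yr; have := qH y.
  rewrite innerBl ler_norml => /andP[_ h1] h2 h3.
  have y0 := enorm_ge0 y.
  have h4 : C * enorm y ^+ 3 <= `|C| * r * enorm y ^+ 2.
    rewrite exprS mulrA ler_wpM2r ?sqr_ge0//.
    apply: le_trans (ler_norm _) _; rewrite normrM (ger0_norm y0).
    by rewrite ler_wpM2l.
  by move: h1 h2 h3 h4; lra.
split=> // y; last first.
  move=> Ay yr; have := supconv_shift_ge at_z Ay; have := touch y yr; lra.
rewrite leNgt; apply/negP => neg.
pose a := - (qf H y + enorm y ^+ 2 / e) / 2.
have a0 : 0 < a by rewrite /a; move: neg; rewrite mulNr; lra.
(* Along [t *: y] the defect of order [t^2] exceeds the cubic error. *)
pose t := Num.min (r / (enorm y + 1)) (a / (2 * (`|C| * enorm y ^+ 3 + 1))).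
have y10 : 0 < enorm y + 1 by rewrite ltr_wpDl// enorm_ge0.
have c0 : 0 <= `|C| * enorm y ^+ 3 by nneg.
have c1 : 0 < 2 * (`|C| * enorm y ^+ 3 + 1) by rewrite mulr_gt0// ltr_wpDl.
have t0 : 0 < t by rewrite lt_min; apply/andP; split; apply: divr_gt0.
have ty : enorm (t *: y) <= r.
  rewrite enormZ (gtr0_norm t0); have : t * (enorm y + 1) <= r.
    by rewrite -ler_pdivlMr// ge_min lexx.
  by lra.
have ta : t * (2 * (`|C| * enorm y ^+ 3 + 1)) <= a.
  by rewrite -ler_pdivlMr// ge_min lexx orbT.
have := supconv_lower (t *: y) at_z; have := touch _ ty.
rewrite -GE qfZ !innerZr enormZ (gtr0_norm t0) !exprMn => h1 h2.
have t2 : 0 < t ^+ 2 by rewrite exprn_gt0.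
have h3 : t ^+ 2 * a <= t ^+ 2 * (t * (`|C| * enorm y ^+ 3)).
  have := ler_wpM2r (exprn_ge0 3 (mulr_ge0 (ltW t0) (enorm_ge0 y))) (ler_norm C).
  rewrite exprMn => h4; rewrite /a.
  have -> : t ^+ 2 * (- (qf H y + enorm y ^+ 2 / e) / 2) =
     - (t ^+ 2 * qf H y / 2 + t ^+ 2 * enorm y ^+ 2 / (2 * e)).
    by field; rewrite gt_eqF.
  by move: h1 h2 h4; lra.
move: h3; rewrite ler_pM2l// => h3.
by move: h3 ta t0 a0 (mulr_ge0 (ltW t0) c0); lra.
Qed.

(** Competitors at distance at least [dl] from the unique maximizer fall short by a positive amount,
    uniformly by compactness, and keep falling short for nearby [z]. Near [z0] all contacts with [u]
    thus take place close to [z0'], where the coefficients are to be frozen. *)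
Lemma supconv_near z0 z0' (dl : R) : 0 < dl ->
  (forall z', supconv_at z0 z' -> z' = z0') ->
  exists2 r : R, 0 < r & forall z z', enorm (z - z0) < r -> supconv_at z z' -> enorm (z' - z0') < dl.
Proof.
move=> dl0 uniq.
pose P (d : R) (z' : 'rV[R]_n) := forall z, enorm (z - z0) < d -> A z' ->
  dl <= enorm (z' - z0') -> u z' - enorm (z - z') ^+ 2 / (2 * e) < supconv z.
have [|x xr|d d0 dP] := @eball_uniform _ _ rho P.
- by move=> d d' x dd h z zd; apply: h; exact: lt_le_trans dd.
- have [xz|xz] := ltP (enorm (x - z0')) dl.
    exists (dl - enorm (x - z0')); first by rewrite subr_gt0.
    move=> x' x'x z _ _; have := ler_enorm_dist x' x z0'.
    by move: x'x => + h1; rewrite leNgt => h2 /negP[]; move: h1 h2; lra.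
  have [t t0 ut] : exists2 t : R, 0 < t &
      A x -> u x - enorm (z0 - x) ^+ 2 / (2 * e) < supconv z0 - t.
    have [Ax|nA] := pselect (A x); last by exists 1.
    have : u x - enorm (z0 - x) ^+ 2 / (2 * e) < supconv z0.
      rewrite lt_neqAle supconv_ge// andbT; apply/eqP => E.
      have xE : x = z0' by apply: uniq; split.
      by move: xz; rewrite xE subrr enorm0 leNgt dl0.
    move=> h; exists ((supconv z0 - (u x - enorm (z0 - x) ^+ 2 / (2 * e))) / 2) => [|_]; lra.
  have us := usc_ext_sub (fun x t t0 => dist_sq_cont (2 * e)^-1 z0 x t0) uA.
  have [d1 d10 h1] := us x _ ut.
  pose Lp := (enorm z0 + 1 + rho) / e.
  have Lp0 : 0 <= Lp by rewrite /Lp; nneg.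
  exists (Num.min d1 (Num.min 1 (t / (2 * (Lp + 1))))).
    by rewrite !lt_min d10 ltr01 divr_gt0// mulr_gt0// ltr_wpDl.
  move=> x'; rewrite !lt_min => /and3P[x'1 _ _] z; rewrite !lt_min => /and3P[_ z1 z2] Ax' _.
  have zr : enorm z <= enorm z0 + 1 by have := ler_enormD z0 (z - z0); rewrite subrKC; lra.
  have z0r : enorm z0 <= enorm z0 + 1 by lra.
  have k1 := supconv_lipschitz zr z0r.
  have k2 := dist_sq_diff zr z0r (Arho Ax').
  have k3 := h1 _ Ax' x'1.
  have k4 : Lp * enorm (z - z0) <= t / 2.
    move: z2; rewrite ltr_pdivlMr; last by rewrite mulr_gt0// ltr_wpDl.
    by have := enorm_ge0 (z - z0); lra.
  have k5 : (enorm (z0 - x') ^+ 2 - enorm (z - x') ^+ 2) / (2 * e) <= Lp * enorm (z - z0).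
    have i0 : 0 <= (2 * e)^-1 by nneg.
    move: k2; rewrite ler_norml => /andP[_ /(ler_wpM2r i0)] /le_trans; apply.
    rewrite /Lp le_eqVlt; apply/orP; left; apply/eqP; field; by rewrite gt_eqF.
  move: k1 k3 k4 k5; rewrite -/Lp ler_norml mulrBl => /andP[+ _]; lra.
- exists d => // z z' zd [Az' zE]; rewrite ltNge; apply/negP => h.
  by have := dP _ (Arho Az') z zd Az' h; rewrite zE ltxx.
Qed.

End SupConvolution.

(** * Freezing the coefficients *)

Lemma bilin_delta {R : realType} {n : nat} (Y : 'M[R]_n) i j :
  inner (delta_mx 0 i *m Y) (delta_mx 0 j) = Y i j.
Proof. by rewrite inner_delta -rowE mxE. Qed.

Lemma psd_entry {R : realType} {n : nat} (Y : 'M[R]_n) i j : (forall y, 0 <= qf Y y) ->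
  `|Y i j + Y j i| <= Y i i + Y j j.
Proof.
move=> Y0; have h1 := Y0 (delta_mx 0 i + delta_mx 0 j); have h2 := Y0 (delta_mx 0 i - delta_mx 0 j).
move: h1 h2; rewrite /qf !mulmxDl !mulNmx !(innerDl, innerDr, innerNl, innerNr) !bilin_delta.
by rewrite ler_norml; lra.
Qed.

(** Semidefiniteness bounds the symmetrized off-diagonal entries by the diagonal ones, and [D] sees
    only these symmetrized entries. *)
Lemma psd_contract {R : realType} {n : nat} (D Y : 'M[R]_n) (c : R) :
  (forall i j, D i j = D j i) -> (forall i j, `|D i j| <= c) -> (forall y, 0 <= qf Y y) ->
  \sum_i \sum_j D i j * Y i j <= c * n%:R * \tr Y.
Proof.
move=> Ds Dc Y0.
have -> : \sum_i \sum_j D i j * Y i j = \sum_i \sum_j D i j * ((Y i j + Y j i) / 2).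
  have h : \sum_i \sum_j D i j * Y i j = \sum_i \sum_j D i j * Y j i.
    by rewrite exchange_big; apply: eq_bigr => i _; apply: eq_bigr => j _; rewrite Ds.
  have -> : \sum_i \sum_j D i j * ((Y i j + Y j i) / 2) =
      (\sum_i \sum_j D i j * Y i j + \sum_i \sum_j D i j * Y j i) / 2.
    rewrite -big_split mulr_suml; apply: eq_bigr => i _.
    rewrite -big_split mulr_suml; apply: eq_bigr => j _ /=.
    by rewrite mulrA mulrDr.
  by rewrite -h; lra.
have -> : c * n%:R * \tr Y = \sum_i \sum_j c * ((Y i i + Y j j) / 2).
  rewrite (eq_bigr (fun i => c * ((Y i i *+ n + \tr Y) / 2))); last first.
    by move=> i _; rewrite -mulr_sumr -mulr_suml big_split /= sumr_const card_ord.
  rewrite -mulr_sumr -mulr_suml big_split /= sumrMnl sumr_const card_ord -/(\tr Y).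
  by rewrite -!(mulr_natr (\tr Y)); lra.
apply: ler_sum => i _; apply: ler_sum => j _.
apply: le_trans (ler_norm _) _; rewrite normrM.
apply: ler_pM => //; have := psd_entry i j Y0.
by rewrite normrM [`|2^-1|]ger0_norm// => h; exact: ler_wpM2r.
Qed.

(** [X + I / e] is nonnegative by semiconvexity, so [psd_contract] applies to it. The cost of
    changing the coefficients is then controlled by the trace of [X], although [X] has no bound from
    above. *)
Lemma oper_perturb {R : realType} {n : nat} (p q s al al' e c : R) (xi xi' : 'rV[R]_n) (X : 'M[R]_n) :
  0 < e -> (forall i j, `|acoef p q s al' xi' i j - acoef p q s al xi i j| <= c) ->
  (forall y, - enorm y ^+ 2 / e <= qf X y) ->
  oper p q s al' xi' X <= oper p q s al xi X + c * n%:R * (\tr X + (n%:R + 1) / e).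
Proof.
move=> e0 Dc Xe.
pose D : 'M[R]_n := \matrix_(i, j) (acoef p q s al' xi' i j - acoef p q s al xi i j).
have Y0 y : 0 <= qf (X + e^-1 *: 1%:M) y.
  by rewrite qfDm qfZm qf1m -enorm_sq; have := Xe y; lra.
have Dc' i j : `|D i j| <= c by rewrite mxE.
have Ds i j : D i j = D j i by rewrite !mxE acoefC (acoefC _ _ _ _ xi).
have := psd_contract Ds Dc' Y0.
have -> : \sum_i \sum_j D i j * (X + e^-1 *: 1%:M) i j =
    oper p q s al' xi' X - oper p q s al xi X + e^-1 * \tr D.
  rewrite /oper -sumrB /mxtrace mulr_sumr -big_split; apply: eq_bigr => i _ /=.
  have -> : e^-1 * D i i = \sum_j D i j * (e^-1 * (i == j)%:R).
    rewrite (bigD1 i)//= big1 ?addr0 ?eqxx ?mulr1 1?[RHS]mulrC// => j ji.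
    by rewrite eq_sym (negbTE ji) !mulr0.
  rewrite -sumrB -big_split; apply: eq_bigr => j _ /=.
  by rewrite !mxE; ring.
have : `|\tr D| <= n%:R * c.
  apply: le_trans (ler_norm_sum _ _ _) _; rewrite mulr_natl -[n in leRHS]card_ord -sumr_const.
  by apply: ler_sum => i _.
rewrite ler_norml mxtraceD mxtraceZ mxtrace1 => /andP[h _] h2.
have i0 : 0 <= e^-1 by rewrite invr_ge0 ltW.
by have := ler_wpM2l i0 h; move: h2; clear; lra.
Qed.

Lemma acoef_near {R : realType} {n : nat} (p q s al c : R) (xi : 'rV[R]_n) : xi != 0 -> 0 < c ->
  exists2 r : R, 0 < r & forall x t i j, enorm (x - xi) < r -> `|t - al| < r ->
    `|acoef p q s t x i j - acoef p q s al xi i j| <= c.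
Proof.
move=> xi0 c0.
have cv i j : \forall z \near (xi, al), `|acoef p q s al xi i j - acoef p q s z.2 z.1 i j| <= c.
  have : acoef p q s z.2 z.1 i j @[z --> (xi, al)] --> acoef p q s al xi i j.
    apply: acoef_cvg => // [|k]; first exact: cvg_snd.
    by apply: (@cvg_comp _ _ _ fst (fun x : 'rV[R]_n => x 0 k)); [exact: cvg_fst|exact: coord_continuous].
  by move=> /cvgrPdist_le; apply.
have : \forall z \near (xi, al), forall ij : 'I_n * 'I_n,
    `|acoef p q s al xi ij.1 ij.2 - acoef p q s z.2 z.1 ij.1 ij.2| <= c.
  apply: (@filter_forall _ _ (fun (ij : 'I_n * 'I_n) (z : 'rV[R]_n * R) => _) _ (nbhs_filter (xi, al))).
  by move=> ij; exact: cv.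
case/nbhs_ptP => r r0 h; exists r => // x t i j xr tr.
by rewrite distrC; exact: (h (x, t) xr tr (i, j)).
Qed.

(* [\sum_i b_i^T b_i = I + (p - 2) xi^T xi / |xi|^2] for [b_i := p_direction p xi i]: the
   square root of the coefficient matrix. *)
Definition p_direction {R : realType} {n : nat} (p : R) (xi : 'rV[R]_n) (i : 'I_n) : 'rV[R]_n :=
  delta_mx 0 i + ((Num.sqrt (p - 1) - 1) / enorm xi ^+ 2 * xi 0 i) *: xi.

Lemma sum_qf_p_direction {R : realType} {n : nat} (p : R) (xi : 'rV[R]_n) (X : 'M[R]_n) :
  1 < p -> xi != 0 ->
  \sum_i qf X (p_direction p xi i) = \tr X + (p - 2) / enorm xi ^+ 2 * qf X xi.
Proof.
move=> p1 xi0; set c := (Num.sqrt (p - 1) - 1) / enorm xi ^+ 2.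
have qd i : qf X (p_direction p xi i) = X i i + c * (xi 0 i * (xi *m X^T) 0 i + xi 0 i * (xi *m X) 0 i)
    + c ^+ 2 * xi 0 i ^+ 2 * qf X xi.
  rewrite /p_direction -/c /qf mulmxDl !(innerDl, innerDr) bilin_delta -!scalemxAl !(innerZl, innerZr).
  rewrite inner_delta -(inner_delta (xi *m X^T)) (_ : inner (_ *m X^T) _ = inner (delta_mx 0 i *m X) xi).
    by ring.
  by rewrite inner_delta -rowE mxE; apply: eq_bigr => k _; rewrite !mxE mulrC.
have sT : \sum_i xi 0 i * (xi *m X^T) 0 i = qf X xi.
  rewrite qfE; apply: eq_bigr => i _; rewrite mxE mulr_sumr; apply: eq_bigr => j _.
  by rewrite mxE; ring.
have sX : \sum_i xi 0 i * (xi *m X) 0 i = qf X xi by rewrite /qf innerC.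
rewrite (eq_bigr _ (fun i _ => qd i)) !big_split /= -mulr_sumr big_split /= sT sX.
rewrite -mulr_suml -mulr_sumr -/(\tr X) -addrA; congr (_ + _).
have -> : \sum_i xi 0 i ^+ 2 = enorm xi ^+ 2 by rewrite enorm_sq; apply: eq_bigr => i _.
have sq : Num.sqrt (p - 1) ^+ 2 = p - 1 by rewrite sqr_sqrtr//; lra.
have -> : p - 2 = Num.sqrt (p - 1) ^+ 2 - 1 by rewrite sq; ring.
by rewrite /c; field; rewrite enorm_eq0.
Qed.

Lemma oper_p_direction {R : realType} {n : nat} (p q s al : R) (xi : 'rV[R]_n) (X : 'M[R]_n) :
  1 < p -> xi != 0 -> oper p q s al xi X = speed q s al xi * \sum_i qf X (p_direction p xi i).
Proof.
move=> p1 xi0; rewrite sum_qf_p_direction//.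
rewrite /oper qfE mulrDr mulr_sumr mulrA mulr_sumr -big_split; apply: eq_bigr => i _ /=.
rewrite mulr_sumr [X in X + _](_ : _ = \sum_j speed q s al xi * ((i == j)%:R * X i j)); last first.
  by rewrite (bigD1 i)//= big1 ?addr0 ?eqxx ?mul1r// => j ji; rewrite eq_sym (negbTE ji) mul0r mulr0.
rewrite -big_split; apply: eq_bigr => j _ /=.
by rewrite /acoef; field; rewrite enorm_eq0.
Qed.

Lemma qf_row {R : realType} {n : nat} (H : 'M[R]_(n + 1)) (y : 'rV[R]_n) :
  qf H (row_mx y 0) = qf (ulsubmx H) y.
Proof.
rewrite /qf -[in LHS](submxK H) mul_row_block !mul0mx !addr0.
rewrite /inner big_split_ord /= big_ord1 !row_mxEr [X in _ * X]mxE mulr0 addr0.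
by apply: eq_bigr => i _; rewrite !row_mxEl.
Qed.

(** [u] will be a subsolution minus [gam (t + 1)]; adding this term back raises the time slope of a
    touching function by [gam]. *)
Definition contact_visc {R : realType} {n : nat} (p q s : R) (a : 'rV[R]_n * R -> R)
    (A : set 'rV[R]_(n + 1)) (u : 'rV[R]_(n + 1) -> R) (gam : R) : Prop :=
  forall z G H C r, A z -> Q1 R n (vec_pt z) -> 0 < r ->
    (forall y, A (z + y) -> enorm y <= r ->
       u (z + y) <= u z + inner G y + qf H y / 2 + C * enorm y ^+ 3) ->
    lsubmx G != 0 ->
    rsubmx G 0 0 + gam <= oper p q s (a (vec_pt z)) (lsubmx G) (ulsubmx H).

Definition freeze_dir {R : realType} {n : nat} (p kap dl : R) (xi : 'rV[R]_n) (i : 'I_n + 'I_n) :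
    'rV[R]_(n + 1) :=
  match i with
  | inl i => Num.sqrt kap *: row_mx (p_direction p xi i) 0
  | inr k => Num.sqrt dl *: row_mx (delta_mx 0 k) 0
  end.

Lemma enorm_sub_row {R : realType} {n : nat} (y : 'rV[R]_(n + 1)) :
  enorm (lsubmx y) <= enorm y /\ `|rsubmx y 0 0| <= enorm y.
Proof.
have := enorm_row (lsubmx y) (rsubmx y); rewrite hsubmxK => E.
split; rewrite -(@ler_pXn2r _ 2) ?nnegrE ?enorm_ge0// E.
  by rewrite lerDl sqr_ge0.
by rewrite real_normK ?num_real// lerDr sqr_ge0.
Qed.

Lemma supconv_visc_sub {R : realType} {n : nat} (p q s : R) (a : 'rV[R]_n * R -> R)
    (A : set 'rV[R]_(n + 1)) (u : 'rV[R]_(n + 1) -> R) (gam e rho dl : R) (z0 z0' : 'rV[R]_(n + 1)) :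
  1 < p -> 0 < e -> 0 <= rho -> A !=set0 -> (forall z, A z -> enorm z <= rho) -> usc_ext A u ->
  contact_visc p q s a A u gam ->
  (forall z', supconv_at A u e z0 z' -> z' = z0') ->
  0 <= speed q s (a (vec_pt z0')) (lsubmx (e^-1 *: (z0' - z0))) ->
  (forall t : R, 0 < t -> exists2 r : R, 0 < r & forall z, A z -> enorm (z - z0') < r ->
     Q1 R n (vec_pt z) /\ `|a (vec_pt z) - a (vec_pt z0')| < t) ->
  let G0 := e^-1 *: (z0' - z0) in let xi := lsubmx G0 in
  xi != 0 -> 0 < dl ->
  exists2 r : R, 0 < r & visc_sub (fun y => supconv A u e (z0 + y))
    (freeze_dir p (speed q s (a (vec_pt z0')) xi) dl xi) (rsubmx G0 0 0 + gam - (1 + (n%:R + 1) / e) * dl) r.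
Proof.
move=> p1 e0 rho0 A0 Ar uA cu uniq kap0 near G0 xi xi0 dl0.
pose N : R := n%:R + 1; have N0 : 0 < N by rewrite /N ltr_wpDl.
pose c := dl / N; have c0 : 0 < c by rewrite divr_gt0.
have [r1' r10' h1'] := acoef_near p q s (a (vec_pt z0')) xi0 c0.
have nxi : 0 < enorm xi by rewrite enorm_gt0.
(* [r1 <= |xi|] keeps the spatial gradient of the touching function away from 0. *)
have [r1 [r10 r11 r1x]] : exists r1 : R, [/\ 0 < r1, r1 <= r1' & r1 <= enorm xi].
  by exists (Num.min r1' (enorm xi)); rewrite lt_min r10' !ge_min !lexx orbT.
have [r2 r20 h2] := near r1 r10.
(* The gradient at a contact is the displacement [z' - z] divided by [e]. Moving both points by less
   than [t] changes it by less than [2 t / e], hence by less than [r1] and than [dl]. *)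
pose t := Num.min (r1 * e / 3) (Num.min r2 (dl * e / 3)).
have t0 : 0 < t by rewrite !lt_min r20 !divr_gt0 ?mulr_gt0.
have [r3 r30 h3] := supconv_near e0 rho0 A0 Ar uA t0 uniq.
exists (Num.min r3 t); first by rewrite lt_min r30.
move=> y G H C r; rewrite !lt_min => /and4P[yr3 y1 _ y2] r0 touch.
have [z' atz] := supconv_ex e A0 Ar uA (z0 + y).
have {}touch v : enorm v <= r -> supconv A u e (z0 + y + v) <=
    supconv A u e (z0 + y) + inner G v + qf H v / 2 + C * enorm v ^+ 3.
  by move=> /touch; rewrite addrA.
have [GE He contact] := supconv_touch e0 A0 Ar uA r0 atz touch.
have := h3 _ _ _ atz; rewrite addrAC subrr add0r => /(_ yr3).
rewrite !lt_min => /and3P[z1 z2 z3].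
have [Q1z az] := h2 _ (proj1 atz) z2.
have GG : enorm (G - G0) <= (enorm (z' - z0') + enorm y) / e.
  rewrite GE /G0 -scalerBr enormZ ger0_norm ?invr_ge0 ?(ltW e0)// mulrC ler_wpM2r ?invr_ge0 ?(ltW e0)//.
  suff -> : z' - (z0 + y) - (z0' - z0) = (z' - z0') - y by exact: ler_enormB.
  by apply/rowP => i; rewrite !mxE; ring.
have Gr1 : enorm (G - G0) < r1.
  by apply: le_lt_trans GG _; rewrite ltr_pdivrMr//; move: y1 z1 (mulr_gt0 r10 e0); clear; lra.
have Gdl : enorm (G - G0) <= dl.
  by apply: le_trans GG _; rewrite ler_pdivrMr//; move: y2 z3 (mulr_gt0 dl0 e0); clear; lra.
have [k1 k2] := enorm_sub_row (G - G0).
have xir : enorm (lsubmx G - xi) < r1.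
  by apply: le_lt_trans Gr1; rewrite /xi -linearB.
have rG : rsubmx G0 0 0 - dl <= rsubmx G 0 0.
  move: k2; rewrite linearB /= !mxE ler_norml => /andP[k2 _].
  by move: k2 Gdl; clear; lra.
have X1 i j : `|acoef p q s (a (vec_pt z')) (lsubmx G) i j - acoef p q s (a (vec_pt z0')) xi i j| <= c.
  by apply: h1'; exact: lt_le_trans r11.
have Xe v : - enorm v ^+ 2 / e <= qf (ulsubmx H) v.
  by have := He (row_mx v 0); rewrite qf_row enorm_row mxE expr0n addr0.
have trE : \sum_i qf H (freeze_dir p (speed q s (a (vec_pt z0')) xi) dl xi i) =
    oper p q s (a (vec_pt z0')) xi (ulsubmx H) + dl * \tr (ulsubmx H).
  rewrite big_sumType /= oper_p_direction// !mulr_sumr; congr (_ + _); apply: eq_bigr => i _.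
    by rewrite qfZ sqr_sqrtr// qf_row.
  by rewrite qfZ sqr_sqrtr ?(ltW dl0)// qf_row /qf bilin_delta.
have trn : - (n%:R / e) <= \tr (ulsubmx H).
  have -> : - (n%:R / e) = \sum_(i < n) (- 1 / e) by rewrite sumr_const card_ord -[RHS]mulr_natl mulNr mul1r mulrN.
  apply: ler_sum => i _; have := Xe (delta_mx 0 i).
  by rewrite /qf bilin_delta enorm_sq inner_delta mxE !eqxx.
rewrite trE.
have G0' : lsubmx G != 0.
  by apply/eqP => G0'; move: xir; rewrite G0' sub0r enormN ltNge r1x.
have := cu _ _ _ _ _ (proj1 atz) Q1z r0 contact G0'.
have := oper_perturb e0 X1 Xe.
have T0 : 0 <= \tr (ulsubmx H) + n%:R / e by move: trn; clear; lra.
have cN : c * N = dl by rewrite /c divfK// gt_eqF.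
have cn : c * n%:R <= dl by rewrite -cN ler_wpM2l ?(ltW c0)// /N lerDl.
have := ler_wpM2r T0 cn.
have : c * n%:R / e <= dl / e by rewrite ler_wpM2r// invr_ge0 ltW.
by move: rG; clear; lra.
Qed.

(** * Doubling of variables *)

Lemma pow_taylor {R : realType} (k : nat) (r D : R) : 0 <= D ->
  exists2 K : R, 0 <= K & forall x : R, `|x| <= D ->
    `|(r + x) ^+ k.+2 - (r ^+ k.+2 + k.+2%:R * r ^+ k.+1 * x + k.+2%:R * k.+1%:R / 2 * r ^+ k * x ^+ 2)|
      <= K * `|x| ^+ 3.
Proof.
move=> D0; elim: k => [|k [K K0 IH]].
  exists 0 => // x _; rewrite mul0r (_ : _ - _ = 0) ?normr0//.
  by rewrite expr0; field.
exists ((`|r| + D) * K + `|k.+2%:R * k.+1%:R / 2 * r ^+ k|) => [|x xD]; first by nneg.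
pose S := r ^+ k.+2 + k.+2%:R * r ^+ k.+1 * x + k.+2%:R * k.+1%:R / 2 * r ^+ k * x ^+ 2.
have -> : (r + x) ^+ k.+3 - (r ^+ k.+3 + k.+3%:R * r ^+ k.+2 * x + k.+3%:R * k.+2%:R / 2 * r ^+ k.+1 * x ^+ 2)
   = (r + x) * ((r + x) ^+ k.+2 - S) + k.+2%:R * k.+1%:R / 2 * r ^+ k * x ^+ 3.
  by rewrite /S exprS -(@natr1 _ k.+2) -(@natr1 _ k.+1) -(@natr1 _ k) !(exprS r) !(exprS x); field.
apply: le_trans (ler_normD _ _) _; rewrite [leRHS]mulrDl lerD// normrM; last by rewrite normrX.
rewrite -mulrA ler_pM ?IH//.
by apply: le_trans (ler_normD _ _) _; rewrite lerD2l.
Qed.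

Section Penalty.
Context {R : realType} {n : nat}.
Variables (k : nat) (j J : R).

(** The exponent [b] of the spatial part is [k.+2], so the power [2b] is at least 4; [J] will be
    [1 / e]. *)
Definition penalty (w : 'rV[R]_(n + 1)) : R :=
  j / (2 * k.+2%:R) * enorm (lsubmx w) ^+ (2 * k.+2) + J / 2 * (rsubmx w 0 0) ^+ 2.

Definition penalty_grad_x (d : 'rV[R]_n) : 'rV[R]_n := (j * enorm d ^+ (2 * k.+1)) *: d.

Definition penalty_hess_x (d : 'rV[R]_n) : 'M[R]_n :=
  (j * enorm d ^+ (2 * k.+1)) *: 1%:M + (2 * k.+1%:R * j * enorm d ^+ (2 * k)) *: (d^T *m d).

(** With [x = |d + h|^2 - |d|^2] the function is a power of [|d|^2 + x]. The expansion in one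
    variable then covers [d = 0] as well, where the norm itself is not differentiable. *)
Lemma radial_taylor (d : 'rV[R]_n) : 0 <= j -> exists2 K : R, 0 <= K & forall h, enorm h <= 1 ->
  j / (2 * k.+2%:R) * enorm (d + h) ^+ (2 * k.+2) <=
  j / (2 * k.+2%:R) * enorm d ^+ (2 * k.+2) + inner (penalty_grad_x d) h +
    qf (penalty_hess_x d) h / 2 + K * enorm h ^+ 3.
Proof.
move=> j0; set c := enorm d; have c0 : 0 <= c by exact: enorm_ge0.
have D0 : 0 <= 2 * c + 1 by nneg.
have [K K0 HK] := pow_taylor k (c ^+ 2) D0.
set P : R := k.+2%:R; have P0 : 0 < P by rewrite ltr0n.
set Q : R := k.+1%:R; have Q0 : 0 < Q by rewrite ltr0n.
exists (j / (2 * P) * (K * (2 * c + 1) ^+ 3) + j * Q / 4 * (c ^+ 2) ^+ k * (4 * c + 1)); first by nneg.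
move=> h h1; set H := enorm h in h1 *; set x := 2 * inner d h + H ^+ 2.
have H0 : 0 <= H by exact: enorm_ge0.
have H2 : H ^+ 2 <= H by rewrite expr2 ler_piMl.
have xH : `|x| <= (2 * c + 1) * H.
  have := norm_inner_le d h; rewrite -/c -/H !ler_norml => /andP[i1 i2].
  by have := sqr_ge0 H; rewrite /x; move: H2 i1 i2; clear; lra.
have xD : `|x| <= 2 * c + 1 by apply: le_trans xH _; rewrite ler_piMr.
have := HK x xD; rewrite ler_norml => /andP[_].
have -> : (c ^+ 2 + x) ^+ k.+2 = enorm (d + h) ^+ (2 * k.+2).
  by rewrite exprM enorm_sqD addrA.
rewrite -exprM; set E := enorm (d + h) ^+ _ => h2.
have h3 : K * `|x| ^+ 3 <= K * (2 * c + 1) ^+ 3 * H ^+ 3.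
  by rewrite -mulrA ler_wpM2l// -exprMn lerXn.
have h4 : x ^+ 2 <= 4 * inner d h ^+ 2 + (4 * c + 1) * H ^+ 3.
  have := norm_inner_le d h; rewrite -/c -/H ler_norml => /andP[_ i].
  have := ler_wpM2r (sqr_ge0 H) i; have : H ^+ 2 * H ^+ 2 <= H * H ^+ 2 by rewrite ler_wpM2r ?sqr_ge0.
  by rewrite /x; clear; lra.
have b1 : 0 <= j / (2 * P) by nneg.
have b2 : 0 <= P * Q / 2 * (c ^+ 2) ^+ k by nneg.
have := ler_wpM2l b2 h4.
move: h2; rewrite -/P -/Q => h2 h4'.
have {h2 h3 h4'} := ler_wpM2l b1 (lerD (le_trans h2 h3) h4').
rewrite /penalty_grad_x /penalty_hess_x qfDm !qfZm qf1m qf_outer innerZl -enorm_sq -/c -/H -/P -/Q.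
rewrite !exprM (exprS (c ^+ 2) k.+1) (exprS (c ^+ 2) k); move: ((c ^+ 2) ^+ k) => V.
rewrite /x; set W := K * _; set I := inner d h => hh.
rewrite -subr_ge0; move: hh; rewrite -subr_ge0.
move=> /le_trans; apply; rewrite le_eqVlt; apply/orP; left; apply/eqP.
by field; rewrite gt_eqF.
Qed.

Definition penalty_grad (w : 'rV[R]_(n + 1)) : 'rV[R]_(n + 1) :=
  row_mx (penalty_grad_x (lsubmx w)) (J * rsubmx w 0 0)%:M.

Definition penalty_hess (w : 'rV[R]_(n + 1)) : 'M[R]_(n + 1) :=
  block_mx (penalty_hess_x (lsubmx w)) 0 0 J%:M.

(** The sum rule admits a remainder of fourth order only. Young's inequality trades the cubic
    remainder for a quartic one and the enlargement [dl I] of the Hessian. *)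
Lemma penalty_taylor (w : 'rV[R]_(n + 1)) (dl : R) : 0 <= j -> 0 < dl ->
  exists2 K : R, 0 <= K & forall y, enorm y <= 1 ->
    penalty (w + y) <= penalty w + inner (penalty_grad w) y +
      qf (penalty_hess w + dl *: 1%:M) y / 2 + K * enorm y ^+ 4.
Proof.
move=> j0 dl0; have [K K0 HK] := radial_taylor (lsubmx w) j0.
exists (K ^+ 2 / (2 * dl)) => [|y y1]; first by rewrite divr_ge0 ?sqr_ge0// mulr_ge0// ltW.
have [y2 _] := enorm_sub_row y; have := HK _ (le_trans y2 y1).
have : K * enorm (lsubmx y) ^+ 3 <= dl * enorm y ^+ 2 / 2 + K ^+ 2 / (2 * dl) * enorm y ^+ 4.
  apply: (@le_trans _ _ (K * enorm y ^+ 3)); first by rewrite ler_wpM2l// lerXn ?enorm_ge0.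
  rewrite -subr_ge0 (_ : _ - _ = (dl * enorm y - K * enorm y ^+ 2) ^+ 2 / (2 * dl)).
    by rewrite divr_ge0 ?sqr_ge0// mulr_ge0// ltW.
  by field; rewrite gt_eqF.
have -> : qf (penalty_hess w + dl *: 1%:M) y = qf (penalty_hess_x (lsubmx w)) (lsubmx y) +
    J * (rsubmx y 0 0) ^+ 2 + dl * enorm y ^+ 2.
  rewrite qfDm qfZm qf1m -enorm_sq; congr (_ + _).
  rewrite /qf /penalty_hess -[in LHS](hsubmxK y) mul_row_block !mulmx0 addr0 add0r.
  rewrite /inner big_split_ord /= big_ord1 !row_mxEr mul_mx_scalar mxE; congr (_ + _); last by ring.
  by apply: eq_bigr => i _; rewrite !row_mxEl.
have -> : inner (penalty_grad w) y = inner (penalty_grad_x (lsubmx w)) (lsubmx y) +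
    J * rsubmx w 0 0 * rsubmx y 0 0.
  rewrite /penalty_grad -[in LHS](hsubmxK y) /inner big_split_ord /= big_ord1 !row_mxEr [_%:M _ _]mxE eqxx mulr1n.
  by congr (_ + _); apply: eq_bigr => i _; rewrite !row_mxEl.
rewrite /penalty !linearD /= mxE; move: (j / (2 * k.+2%:R)) => c.
move: (enorm _ ^+ (2 * k.+2)) (enorm _ ^+ (2 * k.+2)) => E1 E2.
by move: (K ^+ 2 / _) => c' h1 h2; move: h1 h2; clear; lra.
Qed.

End Penalty.

Lemma penalty_cvg {R : realType} {n : nat} (k : nat) (j J : R) (T : Type) (F : set_system T)
    (FF : Filter F) (w : T -> 'rV[R]_(n + 1)) (w0 : 'rV[R]_(n + 1)) :
  (forall i, w t 0 i @[t --> F] --> w0 0 i) ->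
  penalty k j J (w t) @[t --> F] --> penalty k j J w0.
Proof.
move=> wF; have we : enorm (lsubmx (w t)) @[t --> F] --> enorm (lsubmx w0).
  apply: enorm_cvg => i; under eq_fun do rewrite mxE.
  by rewrite mxE; exact: wF.
have wt : rsubmx (w t) 0 0 @[t --> F] --> rsubmx w0 0 0.
  by under eq_fun do rewrite mxE; rewrite mxE; exact: wF.
apply: cvgD; apply: cvgM; [exact: cvg_cst| |exact: cvg_cst|].
  by apply: (@cvg_comp _ _ _ (fun t => enorm (lsubmx (w t))) (fun y : R => y ^+ _) _ _ _ we); exact: exprn_continuous.
by apply: (@cvg_comp _ _ _ (fun t => rsubmx (w t) 0 0) (fun y : R => y ^+ 2) _ _ _ wt); exact: exprn_continuous.
Qed.

Lemma supconv_continuous {R : realType} {n : nat} (A : set 'rV[R]_n) (u : 'rV[R]_n -> R) (e rho : R) :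
  0 < e -> 0 <= rho -> A !=set0 -> (forall z, A z -> enorm z <= rho) -> usc_ext A u ->
  continuous (supconv A u e).
Proof.
move=> e0 rho0 A0 Ar uA z; apply/(@cvgrPdist_lt _ _ _ _ (nbhs_filter z)) => t t0; apply/nbhs_enormP.
pose L := (enorm z + 1 + rho) / e + 1.
have L0 : 0 < L by rewrite /L ltr_wpDl//; nneg.
exists (Num.min 1 (t / L)); first by rewrite lt_min ltr01 divr_gt0.
move=> y; rewrite lt_min => /andP[y1]; rewrite ltr_pdivlMr// => yt.
have yz : enorm y <= enorm z + 1 by have := ler_enormD z (y - z); rewrite subrKC; lra.
have zz : enorm z <= enorm z + 1 by lra.
apply: le_lt_trans (supconv_lipschitz e0 A0 Ar uA zz yz) _.
apply: le_lt_trans yt; rewrite enormB mulrC ler_wpM2l ?enorm_ge0// /L; lra.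
Qed.

Definition closed_cylinder {R : realType} {n : nat} (z : 'rV[R]_(n + 1)) : Prop :=
  enorm (lsubmx z) <= 1 /\ -1 <= rsubmx z 0 0 <= 0.

(** A margin [c] is kept from the lateral and bottom boundary, none from the top [t = 0], which
    belongs to [Q1]. *)
Definition inner_cylinder {R : realType} {n : nat} (c : R) (z : 'rV[R]_(n + 1)) : Prop :=
  enorm (lsubmx z) <= 1 - c /\ -1 + c <= rsubmx z 0 0 <= 0.

Lemma closed_cylinder_enorm {R : realType} {n : nat} (z : 'rV[R]_(n + 1)) :
  closed_cylinder z -> enorm z <= 2.
Proof.
move=> [z1 /andP[z2 z3]]; rewrite -(@ler_pXn2r _ 2) ?nnegrE ?enorm_ge0// -(hsubmxK z) enorm_row.
have := lerXn 2 (enorm_ge0 _) z1; rewrite expr1n.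
have : 0 <= (1 + rsubmx z 0 0) * (1 - rsubmx z 0 0) by apply: mulr_ge0; lra.
by lra.
Qed.

Section Localization.
Context {R : realType} {n : nat}.
Variables (A B : set 'rV[R]_(n + 1)) (u g : 'rV[R]_(n + 1) -> R) (th : R).
Hypotheses (A0 : A !=set0) (B0 : B !=set0).
Hypotheses (Acyl : forall z, A z -> closed_cylinder z) (Bcyl : forall z, B z -> closed_cylinder z).
Hypotheses (uA : usc_ext A u) (gB : usc_ext B g) (th0 : 0 < th).
Hypothesis bd : forall z, A z -> B z -> ~ Q1 R n (vec_pt z) -> u z + g z <= 0.

(** Near a point where neither function is [-oo] and which lies outside [Q1], semicontinuity keeps
    the sum below [th]. Where one of them is [-oo], it is small nearby compared with the maximum of
    the other. Compactness makes the distance uniform. *)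
Lemma localize : exists2 c : R, 0 < c & forall z1 z2, A z1 -> B z2 -> th <= u z1 + g z2 ->
  enorm (z2 - z1) < c -> inner_cylinder c z1 /\ inner_cylinder c z2.
Proof.
have A2 z : A z -> enorm z <= 2 by move=> /Acyl/closed_cylinder_enorm.
have B2 z : B z -> enorm z <= 2 by move=> /Bcyl/closed_cylinder_enorm.
have [zu Azu umax] := usc_ext_attains A0 A2 uA.
have [zg Bzg gmax] := usc_ext_attains B0 B2 gB.
pose P (d : R) z := forall z1 z2, A z1 -> B z2 -> th <= u z1 + g z2 ->
  enorm (z1 - z) < d -> enorm (z2 - z) < d -> inner_cylinder d z1 /\ inner_cylinder d z2.
have [|x _|d d0 dP] := @eball_uniform _ _ 2 P.
- move=> d d' x dd h z1 z2 Az1 Bz2 uz1 zx1 zx2.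
  have [] := h z1 z2 Az1 Bz2 uz1 (lt_le_trans zx1 dd) (lt_le_trans zx2 dd).
  rewrite /inner_cylinder => -[h1 /andP[h2 h3]] [h4 /andP[h5 h6]].
  by rewrite h3 h6 !andbT; split; split; lra.
(* [m > 0] says that [|x| < 1] and [t > -1]; the constraint [t <= 0] comes with the closed
   cylinder. *)
- pose m := Num.min (1 - enorm (lsubmx x)) (rsubmx x 0 0 + 1).
  have [m0|m0] := ltP 0 m.
    have [m1 m2] : m <= 1 - enorm (lsubmx x) /\ m <= rsubmx x 0 0 + 1.
      by rewrite !ge_min !lexx orbT.
    exists (m / 4); first by rewrite divr_gt0.
    move=> x' xx'.
    suff h z : closed_cylinder z -> enorm (z - x') < m / 4 -> inner_cylinder (m / 4) z.
      by move=> z1 z2 /Acyl k1 /Bcyl k2 _ /(h _ k1) ? /(h _ k2).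
    move=> [_ /andP[_ k0]] zx'; rewrite /inner_cylinder k0 andbT.
    have zx : enorm (z - x) < m / 2 by have := ler_enorm_dist z x' x; lra.
    have [k1 k2] := enorm_sub_row (z - x).
    have k3 : enorm (lsubmx z) <= enorm (lsubmx x) + enorm (lsubmx (z - x)).
      by rewrite linearB -[in leLHS](subrKC (lsubmx x) (lsubmx z)) ler_enormD.
    move: k2; rewrite linearB /= !mxE ler_norml => /andP[k2 _].
    by move: m1 m2; rewrite !mxE; split; lra.
  have [d d0 dP] : exists2 d : R, 0 < d & forall z1 z2, A z1 -> B z2 ->
      enorm (z1 - x) < d -> enorm (z2 - x) < d -> u z1 + g z2 < th.
    have [Ax|nA] := pselect (A x); last first.
      have [d d0 h] := uA (z := x) (c := th - g zg) (fun a => False_ind _ (nA a)).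
      by exists d => // z1 z2 Az1 /gmax ? /(h _ Az1) ? _; lra.
    have [Bx|nB] := pselect (B x); last first.
      have [d d0 h] := gB (z := x) (c := th - u zu) (fun a => False_ind _ (nB a)).
      by exists d => // z1 z2 /umax ? Bz2 _ /(h _ Bz2) ?; lra.
    have ugx : u x + g x <= 0.
      apply: bd => //; rewrite /Q1 /vec_pt /= => -[q1 /andP[q2 _]].
      by move: m0; rewrite leNgt lt_min subr_gt0 q1 /= => /negP[]; lra.
    have [|d1 d10 h1] := uA (z := x) (c := u x + th / 2); first by move=> _; have := th0; lra.
    have [|d2 d20 h2] := gB (z := x) (c := g x + th / 2); first by move=> _; have := th0; lra.
    exists (Num.min d1 d2); first by rewrite lt_min d10.
    move=> z1 z2 Az1 Bz2; rewrite !lt_min => /andP[/(h1 _ Az1) ? _] /andP[_ /(h2 _ Bz2) ?].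
    by lra.
  exists (d / 2) => [|x' x'd z1 z2 Az1 Bz2 le zx1 zx2]; first by rewrite divr_gt0.
  have k1 := ler_enorm_dist z1 x' x; have k2 := ler_enorm_dist z2 x' x.
  by have := dP z1 z2 Az1 Bz2; move: le; rewrite leNgt => /negP le h; case: le; apply: h; lra.
exists d => // z1 z2 Az1 Bz2 le zz; apply: (dP z1 (A2 _ Az1)) => //.
by rewrite subrr enorm0.
Qed.

End Localization.

Section Doubling.
Context {R : realType} {n : nat}.
Variables (A B : set 'rV[R]_n) (u g : 'rV[R]_n -> R) (e rho : R) (phi : 'rV[R]_n -> R).
Hypotheses (e0 : 0 < e) (rho0 : 0 <= rho).
Hypotheses (A0 : A !=set0) (B0 : B !=set0).
Hypotheses (Ar : forall z, A z -> enorm z <= rho) (Br : forall z, B z -> enorm z <= rho).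
Hypotheses (uA : usc_ext A u) (gB : usc_ext B g).
Hypothesis phi_cvg : forall z1 z2 : 'rV[R]_n, phi (z.1 - z.2) @[z --> (z1, z2)] --> phi (z1 - z2).
Hypotheses (phi_ge0 : forall w, 0 <= phi w) (phi0 : phi 0 = 0).

Definition doubled (z : 'rV[R]_n * 'rV[R]_n) : R :=
  supconv A u e z.1 + supconv B g e z.2 - phi (z.1 - z.2).

Lemma doubled_max z0 : A z0 -> B z0 -> 0 < u z0 + g z0 ->
  exists z : 'rV[R]_n * 'rV[R]_n, u z0 + g z0 <= doubled z /\ forall y, doubled y <= doubled z.
Proof.
move=> Az0 Bz0 ug0.
have [zu Azu umax] := usc_ext_attains A0 Ar uA.
have [zg Bzg gmax] := usc_ext_attains B0 Br gB.
have fmax (C : set 'rV[R]_n) w z y (m : R) : C !=set0 -> (forall z, C z -> enorm z <= rho) ->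
    usc_ext C w -> (forall y, C y -> w y <= m) ->
    rho + y <= enorm z -> 0 <= y -> supconv C w e z <= m - y ^+ 2 / (2 * e).
  move=> C0 Cr wC wm zy y0; have [z' [Cz' ->]] := supconv_ex e C0 Cr wC z.
  apply: lerB; first exact: wm.
  rewrite ler_wpM2r ?invr_ge0 ?mulr_ge0 ?(ltW e0)// lerXn//.
  by have := ler_enormD z' (z - z'); rewrite subrKC; have := Cr _ Cz'; lra.
have sup_le (C : set 'rV[R]_n) w z (m : R) : C !=set0 -> (forall z, C z -> enorm z <= rho) ->
    usc_ext C w -> (forall y, C y -> w y <= m) -> supconv C w e z <= m.
  move=> C0 Cr wC wm; have [z' [Cz' ->]] := supconv_ex e C0 Cr wC z.
  have : 0 <= enorm (z - z') ^+ 2 / (2 * e) by nneg.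
  by have := wm _ Cz'; lra.
pose M := u zu + g zg.
have M0 : 0 < M by have := umax _ Az0; have := gmax _ Bz0; rewrite /M; lra.
(* Beyond this radius a sup-convolution pays at least [(1 + 2 e M)^2 / (2 e) > M], which makes
   [doubled] negative; the maximum can be sought on a product of balls. *)
pose r := rho + (1 + 2 * e * M).
pose S : set 'rV[R]_n := [set y | enorm (y - 0) <= r].
have r0 : 0 <= r by rewrite /r; nneg.
have S0 z : S z <-> enorm z <= r by rewrite /S /= subr0.
have P : 0 < 1 + 2 * e * M by rewrite ltr_wpDr// !mulr_ge0// ltW.
have z0S : S z0 by apply/S0; have := Ar Az0; rewrite /r; lra.
have cS : compact (S `*` S) by apply: compact_setX; exact: compact_eball.
have cD : continuous doubled.
  move=> [z1 z2]; apply: cvgB; last exact: phi_cvg.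
  apply: cvgD.
    apply: (@cvg_comp _ _ _ fst (supconv A u e) _ (nbhs z1)); first exact: cvg_fst.
    exact: (supconv_continuous e0 rho0 A0 Ar uA).
  apply: (@cvg_comp _ _ _ snd (supconv B g e) _ (nbhs z2)); first exact: cvg_snd.
  exact: (supconv_continuous e0 rho0 B0 Br gB).
have [|z zS zmax] := compact_EVT_max _ cS (continuous_subspaceT cD).
  by exists (z0, z0).
have zz0 : u z0 + g z0 <= doubled z.
  apply: le_trans (zmax (z0, z0) _); last by rewrite inE.
  rewrite /doubled /= subrr phi0 subr0.
  have := supconv_ge e A0 Ar uA z0 Az0; have := supconv_ge e B0 Br gB z0 Bz0.
  by rewrite subrr enorm0 expr0n mul0r !subr0; lra.
exists z; split=> // y.
have far : M - (1 + 2 * e * M) ^+ 2 / (2 * e) < 0.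
  rewrite subr_lt0 ltr_pdivlMr ?mulr_gt0//.
  have : 0 < 2 * e * M by rewrite !mulr_gt0.
  by have := sqr_ge0 (2 * e * M); lra.
have phiy := phi_ge0 (y.1 - y.2).
have [y1|y1] := leP (enorm y.1) r; last first.
  have h1 := fmax A u y.1 (1 + 2 * e * M) (u zu) A0 Ar uA umax (ltW y1) (ltW P).
  have h2 := sup_le B g y.2 (g zg) B0 Br gB gmax.
  by rewrite /doubled in zz0 *; move: h1 h2 zz0 ug0 far phiy; rewrite /M; lra.
have [y2|y2] := leP (enorm y.2) r; last first.
  have h1 := fmax B g y.2 (1 + 2 * e * M) (g zg) B0 Br gB gmax (ltW y2) (ltW P).
  have h2 := sup_le A u y.1 (u zu) A0 Ar uA umax.
  by rewrite /doubled in zz0 *; move: h1 h2 zz0 ug0 far phiy; rewrite /M; lra.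
by apply: zmax; rewrite inE; split; apply/S0.
Qed.

End Doubling.

Section Maximizer.
Context {R : realType} {n : nat}.
Variables (A B : set 'rV[R]_n) (u g : 'rV[R]_n -> R) (e : R) (phi : 'rV[R]_n -> R) (z1 z2 : 'rV[R]_n).
Hypothesis zmax : forall y, doubled A B u g e phi y <= doubled A B u g e phi (z1, z2).

Lemma doubled_touchl y :
  supconv A u e (z1 + y) <= supconv A u e z1 + (phi (z1 - z2 + y) - phi (z1 - z2)).
Proof. by have := zmax (z1 + y, z2); rewrite /doubled /= (addrAC z1); lra. Qed.

Lemma doubled_touchr y :
  supconv B g e (z2 + y) <= supconv B g e z2 + (phi (z1 - z2 - y) - phi (z1 - z2)).
Proof. by have := zmax (z1, z2 + y); rewrite /doubled /= (opprD z2) (addrA z1); lra. Qed.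

End Maximizer.

Lemma visc_sub_le {R : realType} {n : nat} {I : finType} (f : 'rV[R]_n -> R) (d : I -> 'rV[R]_n) (c r r' : R) :
  r' <= r -> visc_sub f d c r -> visc_sub f d c r'.
Proof. by move=> rr vf x G H C t xr; apply: vf; exact: lt_le_trans rr. Qed.

Lemma p_directionN {R : realType} {n : nat} (p : R) (xi : 'rV[R]_n) i :
  p_direction p (- xi) i = p_direction p xi i.
Proof. by rewrite /p_direction enormN mxE mulrN scaleNr scalerN opprK. Qed.

Lemma near_Q1 {R : realType} {n : nat} (a : 'rV[R]_n * R -> R) (L : R) (A : set 'rV[R]_(n + 1))
    (z0 : 'rV[R]_(n + 1)) :
  (forall z, A z -> closed_cylinder z) -> 0 <= L ->
  (forall z z', Q1 R n (vec_pt z) -> Q1 R n (vec_pt z') ->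
     `|a (vec_pt z) - a (vec_pt z')| <= L * enorm (z - z')) ->
  Q1 R n (vec_pt z0) ->
  forall t : R, 0 < t -> exists2 r : R, 0 < r & forall z, A z -> enorm (z - z0) < r ->
    Q1 R n (vec_pt z) /\ `|a (vec_pt z) - a (vec_pt z0)| < t.
Proof.
move=> Acyl L0 aL Q0 t t0; have [/= x1 /andP[t1 _]] := Q0.
have L1 : 0 < L + 1 by rewrite ltr_wpDl.
have d0 : 0 < 1 - enorm (lsubmx z0) by rewrite subr_gt0.
have d1 : 0 < rsubmx z0 0 0 + 1 by lra.
exists (Num.min (t / (L + 1)) (Num.min (1 - enorm (lsubmx z0)) (rsubmx z0 0 0 + 1))).
  by rewrite !lt_min d0 d1 divr_gt0.
move=> z Az; rewrite !lt_min ltr_pdivlMr// => /and3P[k1 k2 k3].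
have [m1 m2] := enorm_sub_row (z - z0).
have m3 : enorm (lsubmx z) <= enorm (lsubmx z0) + enorm (lsubmx (z - z0)).
  by rewrite linearB -[in leLHS](subrKC (lsubmx z0) (lsubmx z)) ler_enormD.
have Qz : Q1 R n (vec_pt z).
  have [_ /andP[_ h]] := Acyl _ Az; rewrite /Q1 /vec_pt /= h andbT.
  by move: m2; rewrite linearB /= !mxE ler_norml => /andP[m2 _]; move: k3; rewrite !mxE; split; lra.
split=> //; apply: le_lt_trans (aL _ _ Qz Q0) _.
by have := enorm_ge0 (z - z0); lra.
Qed.

Lemma trmx_outer {R : realType} {n : nat} (d : 'rV[R]_n) : \tr (d^T *m d) = enorm d ^+ 2.
Proof. by rewrite enorm_sq; apply: eq_bigr => i _; rewrite !mxE big_ord1 !mxE. Qed.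

(** The gradient is parallel to [d], an eigenvector of the Hessian. Its eigenvalue
    [(2b - 1) j |d|^(2b - 2)] is weighted by [p - 1], and the [n - 1] others equal
    [j |d|^(2b - 2)]. *)
Lemma sum_qf_penalty {R : realType} {n : nat} (p : R) (k : nat) (j : R) (d : 'rV[R]_n) :
  1 < p -> 0 < j -> d != 0 ->
  \sum_i qf (penalty_hess_x k j d) (p_direction p (penalty_grad_x k j d) i) =
  (n%:R + p - 2 + 2 * k.+1%:R * (p - 1)) * (j * enorm d ^+ (2 * k.+1)).
Proof.
move=> p1 j0 d0; have e0 : 0 < enorm d by rewrite enorm_gt0.
have m0 : 0 < j * enorm d ^+ (2 * k.+1) by rewrite mulr_gt0// exprn_gt0.
rewrite sum_qf_p_direction//; last by rewrite -enorm_gt0 enormZ mulr_gt0// normr_gt0 gt_eqF.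
rewrite /penalty_grad_x /penalty_hess_x mxtraceD !mxtraceZ mxtrace1 trmx_outer.
rewrite !qfZ !qfDm !qfZm qf1m qf_outer -enorm_sq enormZ exprMn real_normK ?num_real//.
rewrite mulnS exprD; move: m0 e0; rewrite mulnS exprD.
move: (enorm d) (enorm d ^+ (2 * k)) => c V m0 c0.
have V0 : V != 0 by apply: contraTneq m0 => ->; rewrite mulr0 mulr0 ltxx.
by field; rewrite V0 !gt_eqF.
Qed.

(** Maximality is read in three ways: moving [z1], moving [z2], and moving both. The factor 8 is
    that of [(r + t)^4 <= 8 (r^4 + t^4)]. *)
Lemma doubled_contact {R : realType} {n : nat} (A B : set 'rV[R]_(n + 1)) (u g : 'rV[R]_(n + 1) -> R)
    (e : R) (k : nat) (j J dl : R) (z1 z2 : 'rV[R]_(n + 1)) :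
  (forall y, doubled A B u g e (penalty k j J) y <= doubled A B u g e (penalty k j J) (z1, z2)) ->
  0 <= j -> 0 < dl ->
  let G := penalty_grad k j J (z1 - z2) in let H := penalty_hess k j J (z1 - z2) + dl *: 1%:M in
  exists2 K : R, 0 <= K &
    [/\ forall y, enorm y <= 1 ->
          supconv A u e (z1 + y) <= supconv A u e z1 + inner G y + qf H y / 2 + K * enorm y ^+ 3,
        forall y, enorm y <= 1 ->
          supconv B g e (z2 + y) <= supconv B g e z2 + inner (- G) y + qf H y / 2 + K * enorm y ^+ 3 &
        forall y1 y2, enorm y1 <= 1 / 2 -> enorm y2 <= 1 / 2 ->
          supconv A u e (z1 + y1) + supconv B g e (z2 + y2) <=
          supconv A u e z1 + supconv B g e z2 + inner G (y1 - y2) + qf H (y1 - y2) / 2 +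
            8 * K * (enorm y1 ^+ 4 + enorm y2 ^+ 4)].
Proof.
move=> zmax j0 dl0 G H; have [K K0 HK] := penalty_taylor k J (z1 - z2) j0 dl0.
have K3 (y : 'rV[R]_(n + 1)) : enorm y <= 1 -> K * enorm y ^+ 4 <= K * enorm y ^+ 3.
  by move=> y1; rewrite ler_wpM2l// exprS ler_piMl ?exprn_ge0 ?enorm_ge0.
exists K => //; split=> [y y1|y y1|y1 y2 h1 h2].
- have := doubled_touchl zmax y; have := HK y y1; have := K3 y y1.
  by rewrite -/G -/H; clear; lra.
- have yN : enorm (- y) <= 1 by rewrite enormN.
  have := doubled_touchr zmax y; have := HK _ yN; have := K3 y y1.
  by rewrite -/G -/H qfN innerNr innerNl enormN; clear; lra.
have y12 : enorm (y1 - y2) <= enorm y1 + enorm y2 by exact: ler_enormB.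
have y1' : enorm (y1 - y2) <= 1 by lra.
have := HK _ y1'; rewrite -/G -/H => hK.
have : enorm (y1 - y2) ^+ 4 <= 8 * (enorm y1 ^+ 4 + enorm y2 ^+ 4).
  apply: le_trans (lerXn 4 (enorm_ge0 _) y12) _.
  move: (enorm y1) (enorm y2) => r t.
  rewrite -subr_ge0 (_ : _ - _ = (r - t) ^+ 2 * (7 * r ^+ 2 + 10 * r * t + 7 * t ^+ 2)); last by ring.
  rewrite mulr_ge0 ?sqr_ge0// (_ : _ + _ = 5 * (r + t) ^+ 2 + 2 * r ^+ 2 + 2 * t ^+ 2); last by ring.
  by have := sqr_ge0 (r + t); have := sqr_ge0 r; have := sqr_ge0 t; clear; lra.
move=> /(ler_wpM2l K0); have := zmax (z1 + y1, z2 + y2); move: hK; rewrite /doubled /=.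
have -> : z1 + y1 - (z2 + y2) = z1 - z2 + (y1 - y2) by rewrite opprD addrACA.
by clear; lra.
Qed.

(** The counterpart of [contact_visc] for a vanishing spatial gradient, where the diffusion term has
    disappeared in the limit. *)
Definition degenerate_visc {R : realType} {n : nat} (b : nat)
    (A : set 'rV[R]_(n + 1)) (u : 'rV[R]_(n + 1) -> R) (gam : R) : Prop :=
  forall z C tau C' r, A z -> Q1 R n (vec_pt z) -> 0 < C -> 0 < r ->
    (forall y, A (z + y) -> enorm y <= r ->
       u (z + y) <= u z + C * enorm (lsubmx y) ^+ (2 * b) + tau * rsubmx y 0 0 +
         C' * (rsubmx y 0 0) ^+ 2) ->
    tau + gam <= 0.

Section Cases.
Context {R : realType} {n : nat}.
Variables (A B : set 'rV[R]_(n + 1)) (u g : 'rV[R]_(n + 1) -> R) (e gam : R) (k : nat) (j J : R).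
Variables z1 z2 z1' z2' : 'rV[R]_(n + 1).
Hypothesis zmax : forall y,
  doubled A B u g e (penalty k j J) y <= doubled A B u g e (penalty k j J) (z1, z2).
Hypotheses (at1 : supconv_at A u e z1 z1') (at2 : supconv_at B g e z2 z2').
Hypotheses (Q1z1 : Q1 R n (vec_pt z1')) (Q1z2 : Q1 R n (vec_pt z2')) (j0 : 0 < j).
Hypotheses (e0 : 0 < e) (A0 : A !=set0) (B0 : B !=set0).
Hypotheses (Acyl : forall z, A z -> closed_cylinder z) (Bcyl : forall z, B z -> closed_cylinder z).
Hypotheses (uA : usc_ext A u) (gB : usc_ext B g).

Lemma doubled_degenerate : lsubmx (z1 - z2) = 0 ->
  degenerate_visc k.+2 A u gam -> degenerate_visc k.+2 B g 0 -> gam <= 0.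
Proof.
move=> d0 du dg; set t0 := rsubmx (z1 - z2) 0 0.
have C0 : 0 < j / (2 * k.+2%:R) by rewrite divr_gt0.
have pen y : penalty k j J (z1 - z2 + y) - penalty k j J (z1 - z2) =
    j / (2 * k.+2%:R) * enorm (lsubmx y) ^+ (2 * k.+2) + J * t0 * rsubmx y 0 0 +
    J / 2 * (rsubmx y 0 0) ^+ 2.
  rewrite /penalty; have -> : lsubmx (z1 - z2 + y) = lsubmx y by rewrite linearD /= d0 add0r.
  have -> : rsubmx (z1 - z2 + y) 0 0 = t0 + rsubmx y 0 0 by rewrite linearD /= mxE.
  by rewrite d0 enorm0 -/t0 expr0n muln_eq0 /=; field.
have A2 z : A z -> enorm z <= 2 by move=> /Acyl/closed_cylinder_enorm.
have B2 z : B z -> enorm z <= 2 by move=> /Bcyl/closed_cylinder_enorm.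
have h1 : J * t0 + gam <= 0.
  apply: (du z1' _ _ (J / 2) 1 (proj1 at1) Q1z1 C0 ltr01) => y Ay _.
  have := supconv_shift_ge A0 A2 uA at1 Ay; have := doubled_touchl zmax y; rewrite pen.
  by move: (j / _ * _) => W; lra.
have h2 : - (J * t0) + 0 <= 0.
  apply: (dg z2' _ _ (J / 2) 1 (proj1 at2) Q1z2 C0 ltr01) => y By _.
  have := supconv_shift_ge B0 B2 gB at2 By; have := doubled_touchr zmax y; rewrite pen.
  have -> : rsubmx (- y) 0 0 = - rsubmx y 0 0 by rewrite linearN /= mxE.
  by rewrite linearN /= enormN; move: (j / _ * _) => W; lra.
by lra.
Qed.

(** The penalty touches both sup-convolutions from above at the maximum, so by [supconv_touch] the
    maximizers are unique and given by the gradient [G]. Uniqueness is what [supconv_visc_sub] asks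
    for. *)
Lemma doubled_shift : let G := penalty_grad k j J (z1 - z2) in
  (forall z', supconv_at A u e z1 z' -> z' = z1 + e *: G) /\
  (forall z', supconv_at B g e z2 z' -> z' = z2 - e *: G).
Proof.
move=> G; have [K K0] := doubled_contact zmax (ltW j0) ltr01; rewrite -/G => -[h1 h2 _].
have A2 z : A z -> enorm z <= 2 by move=> /Acyl/closed_cylinder_enorm.
have B2 z : B z -> enorm z <= 2 by move=> /Bcyl/closed_cylinder_enorm.
have e1 : e != 0 by rewrite gt_eqF.
split=> z' atz.
  have [-> _ _] := supconv_touch e0 A0 A2 uA ltr01 atz h1.
  by rewrite scalerA divff// scale1r subrKC.
have [E _ _] := supconv_touch e0 B0 B2 gB ltr01 atz h2.
by rewrite -scalerN E scalerA divff// scale1r subrKC.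
Qed.

(** The sum rule for the equations frozen at [z1'] and [z2']. The time slopes of [G] and [- G]
    cancel, and [p_direction] is even in [xi], so both equations use the same spatial directions,
    scaled by the square roots of the two speeds; only the difference of these square roots
    survives. *)
Lemma doubled_nondegenerate (p q s L : R) (a : 'rV[R]_n * R -> R) :
  let d := lsubmx (z1 - z2) in let xi := penalty_grad_x k j d in
  1 < p -> d != 0 -> 0 <= L ->
  (forall z z', Q1 R n (vec_pt z) -> Q1 R n (vec_pt z') ->
     `|a (vec_pt z) - a (vec_pt z')| <= L * enorm (z - z')) ->
  (forall z, Q1 R n (vec_pt z) -> 0 < a (vec_pt z)) ->
  contact_visc p q s a A u gam -> contact_visc p q s a B g 0 ->
  gam <= (Num.sqrt (speed q s (a (vec_pt z1')) xi) - Num.sqrt (speed q s (a (vec_pt z2')) xi)) ^+ 2 *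
    \sum_i qf (penalty_hess_x k j d) (p_direction p xi i).
Proof.
move=> d xi p1 d0 L0 aL a0 cu cg; set k1 := speed _ _ _ _; set k2 := speed _ _ _ _.
have A2 z : A z -> enorm z <= 2 by move=> /Acyl/closed_cylinder_enorm.
have B2 z : B z -> enorm z <= 2 by move=> /Bcyl/closed_cylinder_enorm.
have [uniq1 uniq2] := doubled_shift; set G := penalty_grad k j J (z1 - z2) in uniq1 uniq2.
have e1 : e != 0 by rewrite gt_eqF.
have E1 : e^-1 *: (z1' - z1) = G by rewrite (uniq1 _ at1) addrAC subrr add0r scalerA mulVf ?scale1r.
have E2 : e^-1 *: (z2' - z2) = - G.
  by rewrite (uniq2 _ at2) addrAC subrr add0r scalerN scalerA mulVf ?scale1r.
have Gl : lsubmx G = xi by rewrite row_mxKl.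
have xi0 : xi != 0.
  by rewrite -enorm_gt0 enormZ mulr_gt0 ?enorm_gt0// normr_gt0 gt_eqF// mulr_gt0// exprn_gt0// enorm_gt0.
have U1 z' : supconv_at A u e z1 z' -> z' = z1' by move=> /uniq1 ->; rewrite -(uniq1 _ at1).
have U2 z' : supconv_at B g e z2 z' -> z' = z2' by move=> /uniq2 ->; rewrite -(uniq2 _ at2).
have k10 : 0 <= k1 by rewrite /k1 /speed; have := ltW (a0 _ Q1z1) => ?; nneg.
have k20 : 0 <= k2 by rewrite /k2 /speed; have := ltW (a0 _ Q1z2) => ?; nneg.
have spN (al : R) : speed q s al (- xi) = speed q s al xi by rewrite /speed enormN.
set V := \sum_i _; set S := (_ - _) ^+ 2.
pose T := S * \sum_i qf 1%:M (p_direction p xi i).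
have T0 : 0 <= T.
  by rewrite mulr_ge0 ?sqr_ge0// sumr_ge0// => i _; rewrite qf1m -enorm_sq sqr_ge0.
pose c : R := 1 + (n%:R + 1) / e.
have c0 : 0 < c by rewrite /c ltr_wpDr// divr_ge0 ?addr_ge0// ltW.
(* [dl] measures the freezing error, the added Laplacian and the enlargement of the Hessian alike;
   it tends to 0 with all other data fixed. *)
suff key (dl : R) : 0 < dl -> gam <= S * V + dl * (2 * c + T).
  apply/ler_addgt0Pr => t t0; have D0 : 0 < 2 * c + T by rewrite ltr_wpDr// mulr_gt0.
  by have := key (t / (2 * c + T)); rewrite divfK ?gt_eqF// => -> //; rewrite divr_gt0.
move=> dl0; have [K K0 [_ _ HK]] := doubled_contact zmax (ltW j0) dl0.
have near1 := near_Q1 Acyl L0 aL Q1z1; have near2 := near_Q1 Bcyl L0 aL Q1z2.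
have := supconv_visc_sub (dl := dl) p1 e0 (ler0n R 2) A0 A2 uA cu U1 _ near1.
rewrite E1 /= Gl => /(_ k10 xi0 dl0)[r1 r10 v1].
have := supconv_visc_sub (dl := dl) p1 e0 (ler0n R 2) B0 B2 gB cg U2 _ near2.
rewrite E2 /= linearN /= Gl spN oppr_eq0 => /(_ k20 xi0 dl0)[r2 r20 v2].
pose r := Num.min (Num.min r1 r2) (1 / 2); have r0 : 0 < r by rewrite !lt_min r10 r20 divr_gt0.
have [rr1 rr2 rh] : [/\ r <= r1, r <= r2 & r <= 1 / 2] by rewrite !ge_min !lexx !orbT.
pose rad := enorm z1 + enorm z2 + 1; pose Lip := (rad + 2) / e.
have Lip0 : 0 <= Lip by rewrite /Lip /rad; nneg.
have lip1 : lipschitz_ball Lip r (fun y => supconv A u e (z1 + y)).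
  move=> x y xr yr; have := supconv_lipschitz (r := rad) e0 A0 A2 uA (x := z1 + x) (y := z1 + y).
  rewrite (_ : z1 + x - (z1 + y) = x - y); last by rewrite opprD addrACA subrr add0r.
  have := enorm_ge0 z2; have := ler_enormD z1 x; have := ler_enormD z1 y.
  by rewrite /rad => h1 h2 h3; apply; lra.
have lip2 : lipschitz_ball Lip r (fun y => supconv B g e (z2 + y)).
  move=> x y xr yr; have := supconv_lipschitz (r := rad) e0 B0 B2 gB (x := z2 + x) (y := z2 + y).
  rewrite (_ : z2 + x - (z2 + y) = x - y); last by rewrite opprD addrACA subrr add0r.
  have := enorm_ge0 z1; have := ler_enormD z2 x; have := ler_enormD z2 y.
  by rewrite /rad => h1 h2 h3; apply; lra.
have K80 : 0 <= 8 * K by rewrite mulr_ge0.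
set Bm := penalty_hess k j J (z1 - z2) + dl *: 1%:M in HK *.
suff : rsubmx G 0 0 + gam - c * dl + (rsubmx (- G) 0 0 + 0 - c * dl) <=
    \sum_i qf Bm (freeze_dir p k1 dl xi i - freeze_dir p k2 dl (- xi) i); last first.
  apply: (visc_sub_coupled_sum r0 Lip0 K80 lip1 lip2 (visc_sub_le rr1 v1) (visc_sub_le rr2 v2)).
  by move=> y1 y2 y1r y2r; rewrite !addr0; apply: HK; exact: le_trans rh.
(* The directions of the added Laplacian are common to both equations and cancel. The remaining ones
   have no time component, so the time part of the Hessian contributes nothing. *)
have dirE i : freeze_dir p k1 dl xi i - freeze_dir p k2 dl (- xi) i =
    if i is inl i then (Num.sqrt k1 - Num.sqrt k2) *: row_mx (p_direction p xi i) 0 else 0.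
  by case: i => i /=; rewrite ?p_directionN ?scalerBl// subrr.
have -> : \sum_i qf Bm (freeze_dir p k1 dl xi i - freeze_dir p k2 dl (- xi) i) = S * V + dl * T.
  rewrite (eq_bigr _ (fun i _ => congr1 (qf _) (dirE i))) big_sumType /= [X in _ + X]big1 ?addr0; last first.
    by move=> i _; rewrite qf0r.
  rewrite /T /V mulrCA -mulrDr !mulr_sumr -big_split mulr_sumr; apply: eq_bigr => i _ /=.
  by rewrite qfZ qfDm qfZm qf_row block_mxKul !qf1m -!enorm_sq enorm_row [X in _ + X ^+ 2]mxE expr0n addr0.
have -> : rsubmx (- G) 0 0 = - rsubmx G 0 0 by rewrite linearN /= mxE.
by move: (rsubmx G 0 0) (S * V) => t1 t2; lra.
Qed.

End Cases.

(** [k1 - k2 = (al - be) |xi|^s], while [(sqrt k1 + sqrt k2)^2 >= k1 >= |xi|^q]. *)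
Lemma sqrt_speed_diff {R : realType} {n : nat} (q s al be : R) (xi : 'rV[R]_n) :
  0 <= al -> 0 <= be -> xi != 0 ->
  (Num.sqrt (speed q s al xi) - Num.sqrt (speed q s be xi)) ^+ 2 <=
    (al - be) ^+ 2 * enorm xi `^ (2 * s - q).
Proof.
move=> al0 be0 xi0; have e0 : 0 < enorm xi by rewrite enorm_gt0.
set k1 := speed q s al xi; set k2 := speed q s be xi.
have P0 : 0 < enorm xi `^ q by exact: powR_gt0.
have s0 : 0 <= enorm xi `^ s by exact: powR_ge0.
have k1P : enorm xi `^ q <= k1 by rewrite /k1 /speed lerDl mulr_ge0.
have k10 : 0 <= k1 by exact: le_trans (ltW P0) k1P.
have k20 : 0 <= k2 by rewrite /k2 /speed; nneg.
rewrite -(ler_pM2r P0) -[leRHS]mulrA -powRD ?subrK; last by rewrite (gt_eqF e0) implybT.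
rewrite (_ : (al - be) ^+ 2 * enorm xi `^ (2 * s) = (k1 - k2) ^+ 2); last first.
  rewrite /k1 /k2 /speed (_ : 2 * s = s + s); last by ring.
  by rewrite powRD ?(gt_eqF e0) ?implybT//; ring.
apply: le_trans (ler_wpM2l (sqr_ge0 _) k1P) _.
have [r1 r2] := (sqrtr_ge0 k1, sqrtr_ge0 k2).
rewrite -{2}(sqr_sqrtr k10) -{3}(sqr_sqrtr k10) -(sqr_sqrtr k20) (sqrtr_sqr (Num.sqrt k2)).
rewrite ger0_norm//.
move: (Num.sqrt k1) (Num.sqrt k2) r1 r2 => x y x0 y0.
rewrite (_ : (x ^+ 2 - y ^+ 2) ^+ 2 = (x - y) ^+ 2 * (x + y) ^+ 2); last by ring.
by rewrite ler_wpM2l ?sqr_ge0// lerXn// lerDl.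
Qed.

Lemma penalty_power_bound {R : realType} (q t j D : R) (k : nat) :
  0 < j -> 0 < D -> D <= 1 -> q <= t -> 1 < (2 * k.+2%:R - 1) * (q + 1) ->
  (j * D ^+ (2 * k.+1) * D) `^ t * (j * D ^+ (2 * k.+1)) <= j `^ (t + 1).
Proof.
move=> j0 D0 D1 qt kq; set m : R := (2 * k.+1)%:R.
have -> : D ^+ (2 * k.+1) = D `^ m by rewrite powR_mulrn// ltW.
have mE : m = 2 * k.+2%:R - 2 by rewrite /m natrM -(natr1 k.+1); ring.
have m0 : 0 <= m by exact: ler0n.
have E : (j * D `^ m * D) `^ t * (j * D `^ m) = j `^ (t + 1) * D `^ ((m + 1) * t + m).
  have -> : j * D `^ m * D = j * D `^ (m + 1).
    by rewrite powRD ?(gt_eqF D0) ?implybT// powRr1 ?(ltW D0)// mulrA.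
  rewrite powRM ?powR_ge0 ?(ltW j0)// -powRrM powRD ?(gt_eqF j0) ?implybT// powRr1 ?(ltW j0)//.
  by rewrite powRD ?(gt_eqF D0) ?implybT//; ring.
have h : 0 <= (m + 1) * t + m.
  have : (m + 1) * (q + 1) <= (m + 1) * (t + 1) by rewrite ler_wpM2l ?addr_ge0// lerD2r.
  by move: kq; rewrite mE; clear; lra.
rewrite E ler_piMr ?powR_ge0//; apply: le_trans (ge0_ler_powR h _ _ D1) _.
- by rewrite nnegrE ltW.
- by rewrite nnegrE.
by rewrite powR1.
Qed.

Lemma enorm_le_split {R : realType} {n : nat} (z : 'rV[R]_(n + 1)) :
  enorm z <= enorm (lsubmx z) + `|rsubmx z 0 0|.
Proof.
have d0 := enorm_ge0 (lsubmx z); have t0 := normr_ge0 (rsubmx z 0 0).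
rewrite -(@ler_pXn2r _ 2) ?nnegrE ?enorm_ge0 ?addr_ge0// -[in leLHS](hsubmxK z) enorm_row.
rewrite sqrrD real_normK ?num_real//; have := mulr_ge0 d0 t0; clear; lra.
Qed.

Lemma inner_cylinder_Q1 {R : realType} {n : nat} (c : R) (z : 'rV[R]_(n + 1)) : 0 < c ->
  inner_cylinder c z -> Q1 R n (vec_pt z).
Proof. by move=> c0 [h1 /andP[h2 h3]]; rewrite /Q1 /vec_pt /= h3 andbT; split; lra. Qed.

(** The difference of [a] at the two contact points is at most [L (D + S)], with [D] the spatial
    distance and [S] collecting the time difference and both shifts. The [D^2] part is small because
    [|xi|] is bounded, the [S^2] part because [e] is chosen after [j]; their sum is then below
    [gam]. *)
Lemma strict_comparison {R : realType} {n : nat} (p q s L gam : R) (a : 'rV[R]_n * R -> R) (k : nat)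
    (A B : set 'rV[R]_(n + 1)) (u g : 'rV[R]_(n + 1) -> R) :
  1 < p -> -1 < q -> q <= s -> 1 < (2 * k.+2%:R - 1) * (q + 1) -> 0 <= L -> 0 < gam ->
  (forall z, Q1 R n (vec_pt z) -> 0 < a (vec_pt z)) ->
  (forall z z', Q1 R n (vec_pt z) -> Q1 R n (vec_pt z') ->
     `|a (vec_pt z) - a (vec_pt z')| <= L * enorm (z - z')) ->
  (forall z, A z -> closed_cylinder z) -> (forall z, B z -> closed_cylinder z) ->
  (forall z, Q1 R n (vec_pt z) -> B z) -> usc_ext A u -> usc_ext B g ->
  contact_visc p q s a A u gam -> contact_visc p q s a B g 0 ->
  degenerate_visc k.+2 A u gam -> degenerate_visc k.+2 B g 0 ->
  (forall c : R, 0 < c -> exists2 C : R, 0 <= C & forall z h,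
     inner_cylinder c z -> inner_cylinder c (z + row_mx h 0) ->
     `|g (z + row_mx h 0) - g z| <= C * enorm h) ->
  (forall z, A z -> B z -> ~ Q1 R n (vec_pt z) -> u z + g z <= 0) ->
  forall z, A z -> B z -> u z + g z <= 0.
Proof.
move=> p1 q1 qs kq L0 gam0 a0 aL Acyl Bcyl QB uA gB cu cg du dg glip bd z0 Az0 Bz0.
rewrite leNgt; apply/negP => th0; set th := u z0 + g z0 in th0.
have A0 : A !=set0 by exists z0.
have B0 : B !=set0 by exists z0.
have A2 z : A z -> enorm z <= 2 by move=> /Acyl/closed_cylinder_enorm.
have B2 z : B z -> enorm z <= 2 by move=> /Bcyl/closed_cylinder_enorm.
have [zu Azu umax] := usc_ext_attains A0 A2 uA.
have [zg Bzg gmax] := usc_ext_attains B0 B2 gB.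
have [c c0 loc] := localize A0 B0 Acyl Bcyl uA gB th0 bd.
pose M := u zu + g zg.
have M0 : 0 < M by rewrite /M; have := umax _ Az0; have := gmax _ Bz0; rewrite /th in th0; lra.
have [C C0 glipc] := glip (c / 2) (divr_gt0 c0 (ltr0Sn R 1)).
pose b : R := k.+2%:R; have b0 : 0 < b by rewrite ltr0n.
(* The exponent of [sqrt_speed_diff]; [q <= s] gives [t >= q], hence [t + 1 > 0]. The number [N]
   below is the factor of [sum_qf_penalty] with [p - 1] in place of [p - 2], which makes it
   nonnegative. *)
pose t := 2 * s - q; have t1 : 0 < t + 1 by rewrite /t; lra.
pose N : R := n%:R + (p - 1) + 2 * k.+1%:R * (p - 1).
have p10 : 0 <= p - 1 by rewrite subr_ge0 ltW.
have N0 : 0 <= N by rewrite /N; nneg.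
(* Bounds [|xi|^(t + 1)], since the Lipschitz constant [C] of [g] will give [|xi| <= 2 b C]. *)
pose E := (2 * b * C) `^ (t + 1); have E0 : 0 <= E by exact: powR_ge0.
have NL0 : 0 <= N * L ^+ 2 by rewrite mulr_ge0// sqr_ge0.
have smallE (F : R) : 0 <= F -> exists2 x : R, 0 < x & x * F <= gam / 8.
  move=> F0; exists (gam / 8 / (F + 1)); first by rewrite !divr_gt0// ltr_wpDl.
  by rewrite mulrAC ler_pdivrMr ?ltr_wpDl// ler_wpM2l ?divr_ge0 ?(ltW gam0)// lerDl.
have [x x0 xF] := smallE _ (mulr_ge0 NL0 E0).
(* [j] is chosen first and makes the spatial distance [D] at most [ep]; then [e] makes the
   time difference and the shifts of the sup-convolutions small compared to powers of [j]. *)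
pose ep := Num.min (Num.min x (c / 4)) 1.
have ep0 : 0 < ep by rewrite !lt_min x0 ltr01 divr_gt0.
have [epx epc ep1] : [/\ ep <= x, ep <= c / 4 & ep <= 1] by rewrite !ge_min !lexx !orbT.
pose j := 1 + 2 * b * M / ep ^+ (2 * k.+2).
have j0 : 0 < j by rewrite ltr_wpDr// divr_ge0 ?exprn_ge0 ?mulr_ge0 ?(ltW b0) ?(ltW M0) ?(ltW ep0).
have jep : M < j / (2 * b) * ep ^+ (2 * k.+2).
  have P0 : 0 < ep ^+ (2 * k.+2) by rewrite exprn_gt0.
  rewrite /j; move: (ep ^+ _) P0 => P P0.
  have -> : (1 + 2 * b * M / P) / (2 * b) * P = P / (2 * b) + M by field; rewrite !gt_eqF.
  by rewrite ltrDr divr_gt0// mulr_gt0.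
pose F := N * L ^+ 2 * j `^ (t + 1) * (18 * M).
have F0 : 0 <= F by rewrite /F; nneg.
have [y y0 yF] := smallE _ F0.
(* The second bound gives [S^2 <= 18 M e <= c^2 / 16]. With [D <= c / 4] the two contact points are
   then at distance less than [c], as [localize] requires. *)
pose e := Num.min y (c ^+ 2 / 16 / (18 * M)).
have e0 : 0 < e by rewrite lt_min y0 !divr_gt0 ?exprn_gt0 ?mulr_gt0.
have [ey ec] : e <= y /\ e * (18 * M) <= c ^+ 2 / 16.
  by rewrite -ler_pdivlMr ?mulr_gt0// !ge_min !lexx orbT.
clearbody e ep j.
pose phi := penalty k j e^-1 : 'rV[R]_(n + 1) -> R.
have phi_ge0 w : 0 <= phi w.
  by rewrite /phi /penalty; have := sqr_ge0 (rsubmx w 0 0) => ?; nneg.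
have [[z1 z2] [thz zmax]] : exists z : 'rV[R]_(n + 1) * 'rV[R]_(n + 1),
    th <= doubled A B u g e phi z /\ forall y, doubled A B u g e phi y <= doubled A B u g e phi z.
  apply: (doubled_max (rho := 2)) => //.
    move=> w1 w2; apply: penalty_cvg => i.
    rewrite !mxE; under eq_fun do rewrite !mxE.
    apply: cvgB.
      by apply: (@cvg_comp _ _ _ fst (fun x : 'rV[R]_(n + 1) => x 0 i)); [exact: cvg_fst|exact: coord_continuous].
    by apply: (@cvg_comp _ _ _ snd (fun x : 'rV[R]_(n + 1) => x 0 i)); [exact: cvg_snd|exact: coord_continuous].
  by rewrite /phi /penalty !linear0 enorm0 mxE !expr0n muln_eq0 /= !mulr0 addr0.
have [z1' at1] := supconv_ex e A0 A2 uA z1; have [z2' at2] := supconv_ex e B0 B2 gB z2.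
have Az1 := proj1 at1; have Bz2 := proj1 at2.
set d := lsubmx (z1 - z2); set tau := rsubmx (z1 - z2) 0 0; set D := enorm d.
have D0 : 0 <= D by exact: enorm_ge0.
have [h1 h2 h3 h4 thz'] : [/\ enorm (z1 - z1') ^+ 2 <= 2 * e * M, enorm (z2 - z2') ^+ 2 <= 2 * e * M,
    j / (2 * b) * D ^+ (2 * k.+2) <= M, tau ^+ 2 <= 2 * e * M & th <= u z1' + g z2'].
  have g1 : 0 <= j / (2 * b) * D ^+ (2 * k.+2) by nneg.
  have := thz; rewrite /doubled /= (proj2 at1) (proj2 at2) /phi /penalty -/d -/D -/tau -/b.
  have := umax _ Az1; have := gmax _ Bz2; rewrite -/M.
  have e2 : 0 < 2 * e by rewrite mulr_gt0.
  have g2 : 0 <= enorm (z1 - z1') ^+ 2 / (2 * e) by nneg.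
  have g3 : 0 <= enorm (z2 - z2') ^+ 2 / (2 * e) by nneg.
  have -> : e^-1 / 2 * tau ^+ 2 = tau ^+ 2 / (2 * e) by field; rewrite gt_eqF.
  have g4 : 0 <= tau ^+ 2 / (2 * e) by rewrite divr_ge0 ?sqr_ge0 ?(ltW e2).
  move=> gm um thz2; have cv (X : R) : X / (2 * e) <= M -> X <= 2 * e * M by rewrite ler_pdivrMr// (mulrC M).
  suff [i1 i2 i3 i4 i5] : [/\ enorm (z1 - z1') ^+ 2 / (2 * e) <= M, enorm (z2 - z2') ^+ 2 / (2 * e) <= M,
      j / (2 * b) * D ^+ (2 * k.+2) <= M, tau ^+ 2 / (2 * e) <= M & th <= u z1' + g z2'].
    by split=> //; exact: cv.
  move: g1 g2 g3 g4 thz2; move: (enorm (z1 - z1') ^+ 2 / (2 * e)) (enorm (z2 - z2') ^+ 2 / (2 * e)).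
  move: (j / (2 * b) * D ^+ (2 * k.+2)) (tau ^+ 2 / (2 * e)) => y1 y2 y3 y4.
  by move: th0 gm um; rewrite /M; clear; move=> *; split; lra.
have Dep : D <= ep.
  rewrite leNgt; apply/negP => epD.
  have : j / (2 * b) * ep ^+ (2 * k.+2) <= j / (2 * b) * D ^+ (2 * k.+2).
    by rewrite ler_wpM2l ?lerXn ?(ltW ep0) ?(ltW epD)// divr_ge0 ?(ltW j0)// mulr_ge0// ltW.
  by move=> /(lt_le_trans jep)/lt_le_trans/(_ h3); rewrite ltxx.
have k1 : enorm (z2' - z1') <= D + (`|tau| + enorm (z1 - z1') + enorm (z2 - z2')).
  have := enorm_le_split (z1 - z2); rewrite -/d -/D -/tau.
  have := ler_enorm_dist z2' z2 z1'; have := ler_enorm_dist z2 z1 z1'.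
  by rewrite (enormB z2 z1) (enormB z2' z2); lra.
set S := _ + _ + _ in k1.
(* [S] has three terms, each with square at most [2 e M], and the square of the sum is at most three
   times the sum of the squares. *)
have S2 : S ^+ 2 <= 18 * M * e.
  have : `|tau| ^+ 2 = tau ^+ 2 by rewrite real_normK ?num_real.
  rewrite /S; move: `|tau| (enorm (z1 - z1')) (enorm (z2 - z2')) h1 h2 h4 => r1 r2 r3 h1 h2 h4 r1E.
  have := sqr_ge0 (r1 - r2); have := sqr_ge0 (r1 - r3); have := sqr_ge0 (r2 - r3).
  by move: h1 h2 h4; rewrite -r1E; clear; lra.
have S0 : 0 <= S by rewrite /S; nneg.
have Sc : S <= c / 4.
  rewrite -(@ler_pXn2r _ 2) ?nnegrE// ?divr_ge0 ?(ltW c0)//; apply: le_trans S2 _.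
  by move: ec; clear; lra.
have [|in1 in2] := loc _ _ Az1 Bz2 thz'; first by apply: le_lt_trans k1 _; lra.
have Q1z1 := inner_cylinder_Q1 c0 in1; have Q1z2 := inner_cylinder_Q1 c0 in2.
have [d0|d0] := eqVneq d 0.
  have := doubled_degenerate zmax at1 at2 Q1z1 Q1z2 j0 A0 B0 Acyl Bcyl uA gB d0 du dg.
  by rewrite leNgt gam0.
have D1 : 0 < D by rewrite enorm_gt0.
(* Moving the second point by [d] at fixed time closes the spatial gap and saves the whole spatial
   penalty. By maximality this saving is at most the change of [g], that is [C D]. As [D <= c / 4],
   the moved point remains in the inner cylinder of margin [c / 2]. *)
have jD : j * D ^+ (2 * k.+1) * D <= 2 * b * C.
  have in2' : inner_cylinder (c / 2) z2'.
    by move: in2 => [i1 /andP[i2 i3]]; split; [lra|rewrite i3 andbT; lra].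
  have in3 : inner_cylinder (c / 2) (z2' + row_mx d 0).
    have [i1 i2] := in2'; split; rewrite linearD /= ?row_mxKl ?row_mxKr ?addr0//.
    by apply: le_trans (ler_enormD _ _) _; have [i3 _] := in2; move: i3 Dep epc; rewrite /D; lra.
  have in3' := inner_cylinder_Q1 (divr_gt0 c0 (ltr0Sn R 1)) in3.
  have := glipc _ _ in2' in3; rewrite -/D ler_norml => /andP[gl _].
  have := supconv_shift_ge B0 B2 gB at2 (QB _ in3'); have := doubled_touchr zmax (row_mx d 0).
  have -> : phi (z1 - z2 - row_mx d 0) - phi (z1 - z2) = - (j / (2 * b) * D ^+ (2 * k.+2)).
    have w1 : lsubmx (z1 - z2 - row_mx d 0) = 0 by rewrite [LHS]linearB /= row_mxKl subrr.
    have w2 : rsubmx (z1 - z2 - row_mx d 0) = rsubmx (z1 - z2) by rewrite [LHS]linearB /= row_mxKr subr0.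
    by rewrite /phi /penalty w1 w2 enorm0 expr0n muln_eq0 /= -/d -/D -/b; ring.
  move=> m1 m2; have : j / (2 * b) * D ^+ (2 * k.+2) <= C * D.
    by move: gl m1 m2; move: (j / (2 * b) * _) => W; clear; lra.
  have -> : j / (2 * b) * D ^+ (2 * k.+2) = j * D ^+ (2 * k.+1) * D / (2 * b) * D.
    by rewrite (mulnS 2 k.+1) exprD; ring.
  by rewrite ler_pM2r// ler_pdivrMr ?mulr_gt0// (mulrC C).
have := doubled_nondegenerate zmax at1 at2 Q1z1 Q1z2 j0 e0 A0 B0 Acyl Bcyl uA gB p1 d0 L0 aL a0 cu cg.
rewrite -/d sum_qf_penalty// -/D; set xi := penalty_grad_x k j d.
have xiE : enorm xi = j * D ^+ (2 * k.+1) * D by rewrite enormZ ger0_norm//; nneg.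
have xi0 : xi != 0 by rewrite -enorm_gt0 xiE !mulr_gt0// exprn_gt0.
have := sqrt_speed_diff q s (ltW (a0 _ Q1z1)) (ltW (a0 _ Q1z2)) xi0.
rewrite xiE -/t; set P := _ `^ t; set W := j * _ => hs hn.
have P0 : 0 <= P by exact: powR_ge0.
have W0 : 0 <= W by rewrite /W; nneg.
have aa : (a (vec_pt z1') - a (vec_pt z2')) ^+ 2 <= 2 * L ^+ 2 * (D ^+ 2 + S ^+ 2).
  have := aL _ _ Q1z1 Q1z2; rewrite enormB => /le_trans/(_ (ler_wpM2l L0 k1))/(lerXn 2 (normr_ge0 _)).
  rewrite real_normK ?num_real// exprMn => /le_trans; apply; rewrite [2 * _]mulrC -[leRHS]mulrA.
  by rewrite ler_wpM2l ?sqr_ge0//; have := sqr_ge0 (D - S); clear; lra.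
have WD0 : 0 <= W * D by exact: mulr_ge0.
(* [W D = |xi|] and [P = |xi|^t], so the left-hand side is [D |xi|^(t + 1)]. *)
have PW1 : D ^+ 2 * (P * W) <= ep * E.
  have -> : D ^+ 2 * (P * W) = D * (P * (W * D)) by ring.
  rewrite (_ : P * (W * D) = (W * D) `^ (t + 1)); last first.
    by rewrite powRD ?(gt_eqF t1)// powRr1.
  apply: ler_pM => //; first exact: powR_ge0.
  by apply: ge0_ler_powR jD; rewrite ?nnegrE ?(ltW t1)// !mulr_ge0// ltW.
have PW2 : P * W <= j `^ (t + 1).
  apply: (penalty_power_bound (q := q)) => //; first exact: le_trans ep1.
  by rewrite /t; lra.
have S2' : S ^+ 2 * (P * W) <= 18 * M * e * j `^ (t + 1).
  by apply: ler_pM => //; [exact: sqr_ge0|exact: mulr_ge0].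
have : gam <= 2 * (N * L ^+ 2) * (ep * E + 18 * M * e * j `^ (t + 1)).
  apply: le_trans hn _; set sq := (_ - _) ^+ 2.
  apply: (@le_trans _ _ (sq * (N * W))).
    by rewrite ler_wpM2l ?sqr_ge0// ler_wpM2r// /N; lra.
  have NW := mulr_ge0 N0 W0.
  apply: le_trans (ler_wpM2r NW hs) _; apply: le_trans (ler_wpM2r NW (ler_wpM2r P0 aa)) _.
  rewrite (_ : _ * (N * W) = 2 * (N * L ^+ 2) * (D ^+ 2 * (P * W) + S ^+ 2 * (P * W))); last by ring.
  by apply: ler_wpM2l; [exact: mulr_ge0|exact: lerD].
have : ep * (N * L ^+ 2 * E) <= gam / 8 by apply: le_trans xF; rewrite ler_wpM2r// mulr_ge0.
have : e * F <= gam / 8 by apply: le_trans yF; rewrite ler_wpM2r.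
by move: gam0; rewrite /F; clear; lra.
Qed.

(** * Extended-real-valued solutions *)

Lemma residualN {R : realType} {n : nat} (p q s : R) (a phi : 'rV[R]_n * R -> R) z :
  smooth phi -> residual p q s a (fun z => - phi z) z = - residual p q s a phi z.
Proof.
move=> sphi; rewrite !residualE opprB addrC /dt derive_smoothN//; congr (_ - _).
have -> : grad (fun z => - phi z) z = - grad phi z.
  by apply/rowP => i; rewrite !mxE derive_smoothN.
have -> : hess (fun z => - phi z) z = - hess phi z.
  apply/matrixP => i j; rewrite !mxE.
  rewrite (_ : 'D_(dir_x j) (fun z => - phi z) = fun z => - 'D_(dir_x j) phi z).
    by rewrite derive_smoothN//; exact: smooth_derive.
  by apply/funext => y; rewrite derive_smoothN.
rewrite /oper -sumrN; apply: eq_bigr => i _; rewrite -sumrN; apply: eq_bigr => j _.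
by rewrite /acoef /speed enormN !mxE mulrNN mulrN opprK.
Qed.

Section Bridge.
Context {R : realType} {n : nat}.
Local Notation pt := ('rV[R]_n * R)%type.
Local Notation cyl := (Q1 R n `|` parabolic_boundary R n).

Lemma cylE z : cyl (vec_pt z) <-> closed_cylinder z.
Proof.
rewrite /closed_cylinder /Q1 /parabolic_boundary /=; split.
  by move=> [[h1 /andP[h2 h3]]|[[-> ->]|[h1 ->]]]; rewrite ?(ltW h1) ?(ltW h2) ?h3 ?lexx ?lerN10.
move=> [h1 /andP[h2 h3]]; have [x1|x1] := eqVneq (enorm (lsubmx z)) 1.
  by right; left; rewrite x1 h2 h3.
have {}h1 : enorm (lsubmx z) < 1 by rewrite lt_neqAle x1.
have [t1|t1] := eqVneq (rsubmx z 0 0) (-1); first by right; right.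
by left; split=> //; rewrite h3 andbT lt_neqAle eq_sym t1.
Qed.

(** For functions below [+oo] on the cylinder this is where [fine] gives the true value; elsewhere
    in the cylinder the value is [-oo]. *)
Definition finite_part (w : pt -> \bar R) : set pt := [set z | cyl z /\ (-oo < w z)%E].

Lemma ereal_contact (w : pt -> \bar R) z0 phi : (forall z, Q1 R n z -> (w z < +oo)%E) ->
  Q1 R n z0 -> finite_part w z0 -> sub_contact (finite_part w) (fine \o w) z0 phi ->
  \forall z \near within (Q1 R n) (nbhs z0), (w z - (phi z)%:E <= w z0 - (phi z0)%:E)%E.
Proof.
move=> wlt Q0 [_ w0] [r r0 h]; apply/nbhs_ptP; exists r => // z h1 h2 Qz.
have := h z _ Qz h1 h2; rewrite /finite_part /=; have := wlt z Qz; have := wlt z0 Q0; move: w0.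
case: (w z0) => [r1| |]// _ _; case: (w z) => [r2| |]// _ /= k.
  by rewrite -!EFinB lee_fin; apply: k; split; [left|rewrite ltNyr].
by rewrite leNye.
Qed.

Lemma limf_einf_ge (T : set_system pt) (f : pt -> \bar R) (e : \bar R) :
  (\forall z \near T, (e <= f z)%E) -> (e <= limf_einf f T)%E.
Proof.
move=> h; rewrite limf_einfE; apply: (@le_trans _ _ (ereal_inf [set f x | x in [set z | (e <= f z)%E]])).
  by apply: le_ereal_inf_tmp => _ [z /= ez <-].
by apply: ereal_sup_ubound; exists [set z | (e <= f z)%E].
Qed.

Lemma limf_esup_le (T : set_system pt) (f : pt -> \bar R) (e : \bar R) :
  (\forall z \near T, (f z <= e)%E) -> (limf_esup f T <= e)%E.
Proof.
move=> h; apply: (@le_trans _ _ (ereal_sup [set f x | x in [set z | (f z <= e)%E]])).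
  by apply: ereal_inf_lbound; exists [set z | (f z <= e)%E].
by apply: ge_ereal_sup => _ [z /= ez <-].
Qed.

Lemma sub_visc_subsolution (p q s : R) (a : pt -> R) (u : pt -> \bar R) :
  viscosity_subsolution p q s a u -> sub_visc p q s a (finite_part u) (fine \o u).
Proof.
move=> [ult _ _ hu] z0 phi e Q0 A0 sphi g0 ct e0 re.
have := hu z0 phi Q0 (conj (smooth_C2 sphi) g0) (ereal_contact ult Q0 A0 ct).
apply/negP; rewrite -ltNge; apply: (@lt_le_trans _ _ e%:E); first by rewrite lte_fin.
by apply: limf_einf_ge; apply: filterS re => z; rewrite lee_fin.
Qed.

Lemma sub_visc_supersolution (p q s : R) (a : pt -> R) (v : pt -> \bar R) :
  viscosity_supersolution p q s a v ->
  sub_visc p q s a (finite_part (fun z => - v z)%E) (fine \o (fun z => - v z)%E).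
Proof.
move=> [vgt _ _ hv] z0 phi e Q0 A0 sphi g0 ct e0 re.
have vlt z : Q1 R n z -> (- v z < +oo)%E by move=> /vgt; rewrite lteNl.
have sN := smoothN sphi.
have tf : test_function z0.1 (fun z => - phi z).
  split=> [|z Qz zz]; first exact: smooth_C2.
  rewrite (_ : grad _ z = - grad phi z) ?oppr_eq0 ?g0//.
  by apply/rowP => i; rewrite !mxE derive_smoothN.
have near : \forall z \near within (Q1 R n) (nbhs z0),
    (v z0 - (- phi z0)%:E <= v z - (- phi z)%:E)%E.
  apply: filterS (ereal_contact vlt Q0 A0 ct) => z.
  case: (v z0) => [r1| |]; case: (v z) => [r2| |] //=; rewrite ?leey ?leNye//.
  by rewrite -!EFinB !lee_fin; lra.
have := hv z0 _ Q0 tf near; apply/negP; rewrite -ltNge.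
apply: (@le_lt_trans _ _ (- e)%:E); last by rewrite lte_fin oppr_lt0.
by apply: limf_esup_le; apply: filterS re => z; rewrite residualN// lee_fin lerN2.
Qed.

Lemma timeD (x y : 'rV[R]_(n + 1)) : rsubmx (x + y) 0 0 = rsubmx x 0 0 + rsubmx y 0 0.
Proof. by rewrite !mxE. Qed.

Lemma timeB (x y : 'rV[R]_(n + 1)) : rsubmx (x - y) 0 0 = rsubmx x 0 0 - rsubmx y 0 0.
Proof. by rewrite !mxE. Qed.

Lemma usc_on_ext (w : pt -> \bar R) : (forall z, cyl z -> (w z < +oo)%E) -> usc_on cyl w ->
  usc_ext [set z | finite_part w (vec_pt z)] (fun z => fine (w (vec_pt z))).
Proof.
move=> wlt uw x c hc; have [cx|ncx] := pselect (cyl (vec_pt x)); last first.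
  (* [m] is the largest violation of the inequalities defining the closed cylinder; no point of the
     cylinder lies closer to [x] than that. *)
  pose t := rsubmx x 0 0; pose m := Num.max (enorm (lsubmx x) - 1) (Num.max (-1 - t) t).
  have m0 : 0 < m.
    rewrite ltNge; apply/negP => h; apply: ncx; apply/cylE; move: h.
    by rewrite !ge_max subr_le0 => /and3P[h1 h2 h3]; split=> //; rewrite h3 andbT -subr_le0.
  exists m => // y [/cylE[y1 /andP[y2 y3]] _] yx; exfalso.
  have [k1 k2] := enorm_sub_row (y - x).
  have k3 : enorm (lsubmx x) <= enorm (lsubmx y) + enorm (lsubmx (y - x)).
    by rewrite linearB -[in leLHS](subKr (lsubmx y) (lsubmx x)) ler_enormB.
  move: k2 yx; rewrite timeB -/t ler_norml => /andP[k2 k4].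
  by rewrite !lt_max => /or3P[||]; move: y1 y2 y3 k1 k2 k3 k4; clear; lra.
have wc : (w (vec_pt x) < c%:E)%E.
  move: hc (wlt _ cx); rewrite /finite_part /=; case: (w _) => [r| |] //= hc _; last by rewrite ltNyr.
  by rewrite lte_fin; apply: hc; split=> //; rewrite ltNyr.
have [|V nV hV] := uw (vec_pt x) (- c); first by rewrite EFinN lteN2.
move: nV; rewrite /nbhs /= -nbhs_subspace_in// => /nbhs_ptP[r r0 h].
exists r => // y [cy wy] yx; have [k1 k2] := enorm_sub_row (y - x).
have : (- c%:E < - w (vec_pt y))%E.
  rewrite -EFinN; apply/hV/h => //.
    by move: k1; rewrite linearB => /le_lt_trans; apply.
  by move: k2; rewrite timeB => /le_lt_trans; apply.
by rewrite lteN2; move: wy; case: (w _) => [b| |] //=; rewrite lte_fin.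
Qed.

Lemma inner_time (c : R) (y : 'rV[R]_(n + 1)) : inner (row_mx 0 c%:M) y = c * rsubmx y 0 0.
Proof.
rewrite -[in LHS](hsubmxK y) /inner big_split_ord /= big_ord1 !row_mxEr [_%:M _ _]mxE eqxx mulr1n.
by rewrite big1 ?add0r// => i _; rewrite row_mxEl mxE mul0r.
Qed.

(** [t + 1] is nonnegative on the closed cylinder, so for [gam >= 0] subtracting the linear term
    preserves the boundary inequality. The subsolution built from [v] is used with [gam = 0]. *)
Definition tilt (U : pt -> R) (gam : R) (z : 'rV[R]_(n + 1)) : R :=
  U (vec_pt z) - gam * (rsubmx z 0 0 + 1).

Lemma tiltD U gam z y : tilt U gam (z + y) =
  U (vec_pt (z + y)) - gam * rsubmx y 0 0 - gam * (rsubmx z 0 0 + 1).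
Proof. by rewrite /tilt timeD; ring. Qed.

Lemma usc_ext_tilt (A : set pt) (U : pt -> R) (gam : R) : 0 <= gam ->
  usc_ext [set z | A (vec_pt z)] (fun z => U (vec_pt z)) ->
  usc_ext [set z | A (vec_pt z)] (tilt U gam).
Proof.
move=> gam0; apply: usc_ext_sub => x t t0; exists (t / (gam + 1)); first by rewrite divr_gt0// ltr_wpDl.
move=> y; rewrite ltr_pdivlMr ?ltr_wpDl// => yt; apply: le_lt_trans yt.
have [_ k] := enorm_sub_row (y - x); move: k; rewrite timeB => k.
rewrite (_ : _ - _ = (rsubmx y 0 0 - rsubmx x 0 0) * gam); last by ring.
rewrite normrM (ger0_norm gam0); apply: ler_pM => //; lra.
Qed.

Lemma contact_visc_tilt (p q s : R) (a : pt -> R) (A : set pt) (U : pt -> R) (gam : R) :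
  sub_visc p q s a A U -> (forall z0, Q1 R n z0 -> a z @[z --> within (Q1 R n) (nbhs z0)] --> a z0) ->
  contact_visc p q s a [set z | A (vec_pt z)] (tilt U gam) gam.
Proof.
move=> sv ca z G H C r Az Qz r0 ct G0.
have Gl : lsubmx (G + row_mx 0 gam%:M) = lsubmx G by rewrite linearD /= row_mxKl addr0.
have Gr : rsubmx (G + row_mx 0 gam%:M) 0 0 = rsubmx G 0 0 + gam.
  by rewrite timeD row_mxKr [_%:M _ _]mxE eqxx mulr1n.
rewrite -Gr -Gl; apply: (nondegenerate_contact (C := C) sv (ca _ Qz) Qz Az r0) => //; last by rewrite Gl.
move=> y Ay Qy; rewrite vec_ptK; set y' := pt_vec y - z => yr.
have E : z + y' = pt_vec y by rewrite subrKC.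
have := ct y'; rewrite tiltD /tilt E pt_vecK /= pt_vecK => /(_ Ay yr).
rewrite innerDl inner_time; move: (U y) (U (vec_pt z)) (inner G y') (qf H y' / 2) (C * _).
by move: (rsubmx y' 0 0) (rsubmx z 0 0); clear; move=> *; lra.
Qed.

Lemma degenerate_visc_tilt (p q s am : R) (a : pt -> R) (A : set pt) (U : pt -> R) (gam : R) (b : nat) :
  q <= s -> (2 <= b)%N -> 1 < (2 * b%:R - 1) * (q + 1) -> (forall z, Q1 R n z -> 0 <= a z <= am) ->
  sub_visc p q s a A U -> degenerate_visc b [set z | A (vec_pt z)] (tilt U gam) gam.
Proof.
move=> qs b2 bq aam sv z C tau C' r Az Qz C0 r0 ct.
apply: (degenerate_contact (C' := C') qs b2 bq C0 aam sv Qz Az).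
exists (r / 2) => [|y Ay Qy h1 h2]; first by rewrite divr_gt0.
set y' := pt_vec y - z; have E : z + y' = pt_vec y by rewrite subrKC.
have yl : lsubmx y' = y.1 - lsubmx z by rewrite linearB /= row_mxKl.
have yr : rsubmx y' 0 0 = y.2 - rsubmx z 0 0.
  by rewrite timeB row_mxKr [_%:M _ _]mxE eqxx mulr1n.
have y'r : enorm y' <= r.
  rewrite -(@ler_pXn2r _ 2) ?nnegrE ?enorm_ge0 ?(ltW r0)// -(hsubmxK y') enorm_row yl yr.
  have := lerXn 2 (enorm_ge0 _) (ltW h1); have := lerXn 2 (normr_ge0 _) (ltW h2).
  by rewrite real_normK ?num_real//=; have := sqr_ge0 r; clear; lra.
have := ct y'; rewrite tiltD /tilt E pt_vecK /= pt_vecK => /(_ Ay y'r).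
rewrite /radial_test /vec_pt /= subrr enorm0 yl yr !subrr !expr0n muln_eq0 /= (gtn_eqF (ltnW b2)) /=.
move: (C * _ ^+ (2 * b)) => W; clear; lra.
Qed.

End Bridge.

Lemma norm_pt_le {R : realType} {n : nat} (z z' : 'rV[R]_n * R) :
  `|z - z'| <= enorm (pt_vec z - pt_vec z').
Proof.
have [h1 h2] := enorm_sub_row (pt_vec z - pt_vec z').
move: h1 h2; rewrite timeB linearB /= !row_mxKl !row_mxKr ![_%:M _ _]mxE eqxx !mulr1n => h1 h2.
rewrite prod_normE /= ge_max h2 andbT; exact: le_trans (ler_norm_enorm _) h1.
Qed.

Lemma lipschitz_enorm {R : realType} {n : nat} (a : 'rV[R]_n * R -> R) (A : set ('rV[R]_n * R)) :
  [lipschitz a z | z in A] -> exists2 L : R, 0 <= L &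
    forall z z', A z -> A z' -> `|a z - a z'| <= L * enorm (pt_vec z - pt_vec z').
Proof.
move=> /pinfty_ex_gt0[L L0 aL]; exists L => [|z z' Az Az']; first exact: ltW.
apply: le_trans (aL (z, z') (conj Az Az')) _.
by rewrite ler_wpM2l ?(ltW L0)// norm_pt_le.
Qed.

Lemma lipschitz_cvg_within {R : realType} {n : nat} (a : 'rV[R]_n * R -> R) (A : set ('rV[R]_n * R))
    (L : R) (z0 : 'rV[R]_n * R) : 0 <= L -> A z0 ->
  (forall z z', A z -> A z' -> `|a z - a z'| <= L * enorm (pt_vec z - pt_vec z')) ->
  a z @[z --> within A (nbhs z0)] --> a z0.
Proof.
move=> L0 Az0 aL; apply/cvgrPdist_lt => t t0; apply/nbhs_ptP.
have L1 : 0 < 2 * (L + 1) by rewrite mulr_gt0// ltr_wpDl.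
exists (t / (2 * (L + 1))) => [|z]; first by rewrite divr_gt0.
rewrite !ltr_pdivlMr// => h1 h2 Az; apply: le_lt_trans (aL _ _ Az0 Az) _; rewrite enormB.
have : enorm (pt_vec z - pt_vec z0) <= enorm (z.1 - z0.1) + `|z.2 - z0.2|.
  have := enorm_le_split (pt_vec z - pt_vec z0).
  by rewrite pt_vecB row_mxKl row_mxKr [_%:M _ _]mxE eqxx mulr1n.
move=> /(ler_wpM2l L0); have := enorm_ge0 (z.1 - z0.1); have := normr_ge0 (z.2 - z0.2).
by move: h1 h2; clear; lra.
Qed.

Lemma locally_lipschitz_fin {R : realType} {n : nat} (v : 'rV[R]_n * R -> \bar R) z :
  locally_lipschitz_x v -> Q1 R n z -> v z \is a fin_num.
Proof.
move=> vL Qz; have [C] := vL [set z] (@compact_set1 _ z) (fun _ E => eq_ind_r _ Qz E).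
case: z Qz => x t Qz; move=> /(_ x x t erefl erefl).
by case: (v (x, t)).
Qed.

Lemma locally_lipschitz_inner {R : realType} {n : nat} (v : 'rV[R]_n * R -> \bar R) (c : R) :
  locally_lipschitz_x v -> 0 < c -> exists2 C : R, 0 <= C & forall z h,
     inner_cylinder c z -> inner_cylinder c (z + row_mx h 0) ->
     `|fine (- v (vec_pt (z + row_mx h 0)))%E - fine (- v (vec_pt z))%E| <= C * enorm h.
Proof.
move=> vL c0; pose K := [set y : 'rV[R]_n | enorm (y - 0) <= 1 - c] `*` `[-1 + c, 0]%classic.
have KQ : K `<=` Q1 R n.
  move=> z [/=]; rewrite subr0 in_itv /= => h1 /andP[h2 h3]; rewrite /Q1 /= h3 andbT; split; lra.
have cK : compact K by apply: compact_setX; [exact: compact_eball|exact: segment_compact].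
have [C hC] := vL K cK KQ; exists `|C| => // z h iz izh.
have inK w : inner_cylinder c w -> K (vec_pt w).
  by move=> [h1 h2]; split=> /=; rewrite ?subr0 ?in_itv.
have zt : vec_pt (z + row_mx h 0) = (lsubmx z + h, rsubmx z 0 0).
  by rewrite /vec_pt !linearD /= row_mxKl row_mxKr addr0.
have k1 := inK _ iz; have k2 := inK _ izh; rewrite zt in k2 *.
have := hC _ _ _ k2 k1; have := locally_lipschitz_fin vL (KQ _ k2); have := locally_lipschitz_fin vL (KQ _ k1).
rewrite (_ : lsubmx z + h - lsubmx z = h); last by rewrite addrAC subrr add0r.
rewrite /vec_pt; case: (v _) => [r1| |]// _; case: (v _) => [r2| |]// _ /=.
rewrite lee_fin => k; apply: le_trans (ler_wpM2r (enorm_ge0 h) (ler_norm C)).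
by apply: le_trans k; rewrite -opprB normrN opprK addrC.
Qed.

(* Both u and v are functions on the closed cylinder, semicontinuous up to the
   parabolic boundary, so that "u <= v on the parabolic boundary" constrains
   them inside Q1. *)
Theorem proposition3p5 (R : realType) (n : nat) (hn : (0 < n)%N)
  (p q s : R) (hp : 1 < p) (hq : -1 < q) (hqs : q <= s)
  (a : 'rV[R]_n * R -> R)
  (ha_pos : forall z, Q1 R n z -> 0 < a z)
  (ha_lip : [lipschitz a z | z in Q1 R n])
  (u v : 'rV[R]_n * R -> \bar R)
  (hu : viscosity_subsolution p q s a u)
  (hv : viscosity_supersolution p q s a v)
  (hv_lip : locally_lipschitz_x v)
  (hu_usc : usc_on (Q1 R n `|` parabolic_boundary R n) u)
  (hv_lsc : lsc_on (Q1 R n `|` parabolic_boundary R n) v)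
  (hu_lt : forall z, parabolic_boundary R n z -> (u z < +oo)%E)
  (hv_gt : forall z, parabolic_boundary R n z -> (-oo < v z)%E)
  (huv : forall z, parabolic_boundary R n z -> (u z <= v z)%E) :
  forall z, Q1 R n z -> (u z <= v z)%E.
Proof.
have [L L0 aL] := lipschitz_enorm ha_lip.
have ca z0 : Q1 R n z0 -> a z @[z --> within (Q1 R n) (nbhs z0)] --> a z0.
  by move=> Qz0; exact: lipschitz_cvg_within aL.
have aL' z z' : Q1 R n (vec_pt z) -> Q1 R n (vec_pt z') ->
    `|a (vec_pt z) - a (vec_pt z')| <= L * enorm (z - z').
  by move=> Qz Qz'; have := aL _ _ Qz Qz'; rewrite !vec_ptK.
(* The origin of space-time lies in [Q1], at Euclidean distance at most 2 from every point of it. *)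
have am z : Q1 R n z -> 0 <= a z <= a 0 + 2 * L.
  move=> Qz; have Q0 : Q1 R n 0 by rewrite /Q1 /= enorm0 ltr01 lexx ltrN10.
  rewrite (ltW (ha_pos _ Qz))/=; have := aL _ _ Qz Q0.
  have -> : pt_vec z - pt_vec 0 = pt_vec z.
    by rewrite pt_vecB /= !subr0.
  have : enorm (pt_vec z) <= 2.
    by apply: closed_cylinder_enorm; apply/cylE; rewrite pt_vecK; left.
  move=> /(ler_wpM2l L0) h1 /(le_trans (ler_norm _)); move: h1; clear; lra.
(* Any [k] above [1 / (q + 1)] serves, since [2 (k + 2) - 1 >= k]. *)
have [k kq] : exists k : nat, 1 < (2 * k.+2%:R - 1) * (q + 1).
  have q0 : 0 < q + 1 by move: hq; clear; lra.
  exists (Num.bound (1 / (q + 1))); have := archi_boundP (ltW (divr_gt0 ltr01 q0)).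
  rewrite ltr_pdivrMr// => /lt_le_trans; apply; rewrite ler_wpM2r ?(ltW q0)//.
  move: (Num.bound _) => m; rewrite -(@natr1 _ m.+1) -natr1.
  by have := ler0n R m; clear; lra.
pose g z := (- v z)%E.
have cylu z : (Q1 R n `|` parabolic_boundary R n) z -> (u z < +oo)%E.
  by have [h _ _ _] := hu; case=> [/h//|/hu_lt].
have cylg z : (Q1 R n `|` parabolic_boundary R n) z -> (g z < +oo)%E.
  by have [h _ _ _] := hv; rewrite /g lteNl; case=> [/h//|/hv_gt].
have uscg : usc_on (Q1 R n `|` parabolic_boundary R n) g.
  by rewrite /usc_on (_ : (fun z => - g z)%E = v)//; apply/funext => z; rewrite /g oppeK.
have svu := sub_visc_subsolution hu; have svg := sub_visc_supersolution hv.
have key gam w : 0 < gam -> finite_part u (vec_pt w) -> finite_part g (vec_pt w) ->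
    tilt (fine \o u) gam w + tilt (fine \o g) 0 w <= 0.
  move=> gam0; apply: (@strict_comparison _ _ p q s L gam a k [set w | finite_part u (vec_pt w)]
    [set w | finite_part g (vec_pt w)] (tilt (fine \o u) gam) (tilt (fine \o g) 0) hp hq hqs kq L0 gam0) => //.
  - by move=> z; exact: ha_pos.
  - by move=> z [/cylE cz _].
  - by move=> z [/cylE cz _].
  - move=> z Qz; split; first by left.
    by have := locally_lipschitz_fin hv_lip Qz; rewrite /g; case: (v _) => // r _; rewrite ltNyr.
  - by apply: usc_ext_tilt; [exact: ltW|exact: usc_on_ext].
  - by apply: usc_ext_tilt => //; exact: usc_on_ext.
  - exact: contact_visc_tilt.
  - exact: contact_visc_tilt.
  - exact: (degenerate_visc_tilt hqs (isT : 2 <= k.+2)%N kq am svu).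
  - exact: (degenerate_visc_tilt hqs (isT : 2 <= k.+2)%N kq am svg).
  - move=> c c0; have [C C0 hC] := locally_lipschitz_inner hv_lip c0.
    by exists C => // z h iz izh; rewrite /tilt !mul0r !subr0; exact: hC.
  move=> z [cz uz] [_ gz] nQ; have bz : parabolic_boundary R n (vec_pt z) by case: cz.
  have [_ /andP[t1 _]] : closed_cylinder z by apply/cylE.
  have := huv _ bz; have := hu_lt _ bz; have := hv_gt _ bz; move: uz gz; rewrite /tilt /g /=.
  case: (u _) => [r1| |]//; case: (v _) => [r2| |]// _ _ _ _; rewrite lee_fin /= mul0r subr0 => r12.
  have t0 : 0 <= rsubmx z 0 0 + 1 by rewrite -lerBlDr sub0r.
  by have := mulr_ge0 (ltW gam0) t0; lra.
move=> z Qz; have := locally_lipschitz_fin hv_lip Qz.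
have := key _ (pt_vec z) _; rewrite /finite_part pt_vecK /g /tilt /= pt_vecK.
have := cylu z (or_introl Qz); case: (u z) => [r1| |]//; last by rewrite leNye.
case: (v z) => [r2| |]// _ h _; rewrite lee_fin.
(* The tilt [gam = e] is arbitrary, and it lowers [u] at [z] by [e (t + 1) <= e] because
   [t <= 0]. *)
apply/ler_addgt0Pr => e e0; have := h e e0 (conj (or_introl Qz) (ltNyr _)) (conj (or_introl Qz) (ltNyr _)).
rewrite mul0r subr0 row_mxKr [_%:M _ _]mxE eqxx mulr1n.
have [_ /andP[t1 t2]] := Qz.
have z0 : 0 <= - z.2 by rewrite oppr_ge0.
by have := mulr_ge0 (ltW e0) z0; rewrite /=; lra.
Qed.
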